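(* Let $G$ be a finitely generated group acting by isometries on a $\delta$-hyperbolic space $X$. Suppose that the action is acylindrical and non-elementary. Assume that there exists a constant $M$ such that for any finite generating set $S$ of $G$, the set $S^M$ contains an element that is hyperbolic on $X$. Assume that $G$ is equationally Noetherian. Then for any $\rho\in\xi(G)$, up to the action of $\mathrm{Aut}(G)$, there are at most finitely many finite generating sets $S$ of $G$ such that $e(G,S)=\rho$.
   Context: A $\delta$-hyperbolic space is a geodesic metric space that is $\delta$-hyperbolic in the sense of Gromov; distance is written $d$ or $|x-y|$. Growth. Generating sets are always assumed symmetric: $S=S^{-1}$. For a finite generating set $S$ of a finitely generated group $G$, $S^n=B_n(G,S)$ denotes the set of elements of $G$ of word length at most $n$ with respect to $S$, and $e(G,S)=\lim_{n\to\infty}|B_n(G,S)|^{1/n}$. Put $\xi(G)=\{e(G,S) : S \text{ a finite generating set of } G\}\subset\mathbb{R}$. Actions. The action of $G$ on $X$ is acylindrical if for every $\epsilon>0$ there exist $R=R(\epsilon)>0$ and $N=N(\epsilon)>0$ such that for all $x,y\in X$ with $d(x,y)\ge R$, the set $\{g\in G : d(x,g(x))\le\epsilon,\ d(y,g(y))\le\epsilon\}$ contains at most $N$ elements. The action is elementary if the limit set of $G$ in the Gromov boundary $\partial X$ has at most two points, and non-elementary otherwise. An isometry $g$ of $X$ is hyperbolic if there are $x\in X$ and $C>0$ with $|x-g^n(x)|>Cn$ for all $n>0$. Equationally Noetherian. For a subset $S$ of the free group $F(x_1,\dots,x_\ell)$ let $V_G(S)=\{(g_1,\dots,g_\ell)\in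 G^\ell : s(g_1,\dots,g_\ell)=1 \text{ for all } s\in S\}$. $G$ is equationally Noetherian if for every $\ell\ge1$ and every subset $S\subset F(x_1,\dots,x_\ell)$ there is a finite subset $S_0\subset S$ with $V_G(S_0)=V_G(S)$. *)

(* Defs.v *)
From HB Require Import structures.
From mathcomp Require Import all_boot all_order all_algebra finmap.
From mathcomp Require Import all_classical all_reals all_analysis.

Set Implicit Arguments.
Unset Strict Implicit.
Unset Printing Implicit Defensive.

Import Order.TTheory GRing.Theory Num.Theory.

Local Open Scope classical_set_scope.
Local Open Scope card_scope.
Local Open Scope ring_scope.

(* The free group F(x_1, ..., x_l), realized on the reduced words in the
   letters x_i = (i, false) and x_i^-1 = (i, true). *)
Section FreeGroup.
Variable l : nat.

Definition letter := ('I_l * bool)%type.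
Implicit Types (a b : letter) (u v w : seq letter).

Definition inv_letter a : letter := (a.1, ~~ a.2).

Definition reduced w := sorted (fun a b => b != inv_letter a) w.

Record free_group := FreeGroup { word : seq letter; _ : reduced word }.

HB.instance Definition _ := [isSub for word].
HB.instance Definition _ := [Choice of free_group by <:].

(* Left multiplication of a reduced word by one letter. *)
Definition push a w :=
  if w is b :: w' then if b == inv_letter a then w' else a :: w else [:: a].

Definition reduce w := foldr push [::] w.

Lemma inv_letterK : involutive inv_letter.
Proof. by case=> i b; rewrite /inv_letter /= negbK. Qed.

Lemma reduced_push a w : reduced w -> reduced (push a w).
Proof.
case: w => [//|b w] /= bw; case: ifPn => [_|ab] /=; last by rewrite ab.
exact: path_sorted bw.
Qed.

Lemma reduced_foldr u w : reduced w -> reduced (foldr push w u).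
Proof. by move=> rw; elim: u => //= a u; apply: reduced_push. Qed.

Lemma reduced_reduce w : reduced (reduce w).
Proof. exact: reduced_foldr. Qed.

Lemma pushK a w : reduced w -> push (inv_letter a) (push a w) = w.
Proof.
case: w => [_|b w] /=; first by rewrite inv_letterK eqxx.
case: (eqVneq b (inv_letter a)) => [->|ab] bw /=; last by rewrite inv_letterK eqxx.
by case: w bw => [//|c w] /= /andP[/negPf ->].
Qed.

Lemma pushVK a w : reduced w -> push a (push (inv_letter a) w) = w.
Proof. by move=> rw; rewrite -[a in push a]inv_letterK pushK. Qed.

Lemma foldr_push_reduce u w :
  reduced w -> foldr push w (reduce u) = foldr push w u.
Proof.
move=> rw; elim: u => //= a u <-; rewrite -/(reduce u).
case: (reduce u) => [//|b v] /=; case: ifP => // /eqP ->.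
by rewrite pushVK // reduced_foldr.
Qed.

Lemma reduce_id w : reduced w -> reduce w = w.
Proof.
elim: w => //= a w IH aw; rewrite -/(reduce w) (IH (path_sorted aw)).
by case: w aw {IH} => [//|b w] /= /andP[/negPf ->].
Qed.

Definition free_one : free_group := @FreeGroup [::] isT.

Definition free_mul (x y : free_group) : free_group :=
  FreeGroup (reduced_reduce (word x ++ word y)).

Definition free_inv (x : free_group) : free_group :=
  FreeGroup (reduced_reduce (rev [seq inv_letter a | a <- word x])).

Lemma reduced_word (x : free_group) : reduced (word x).
Proof. by case: x. Qed.

Lemma reduce_catl u v : reduce (reduce u ++ v) = reduce (u ++ v).
Proof.
rewrite /reduce !foldr_cat -/(reduce u) -/(reduce v).
exact/foldr_push_reduce/reduced_reduce.
Qed.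

Lemma reduce_catr u v : reduce (u ++ reduce v) = reduce (u ++ v).
Proof.
rewrite /reduce !foldr_cat -/(reduce v) -/(reduce (reduce v)).
by rewrite (reduce_id (reduced_reduce v)).
Qed.

Lemma free_mulA : associative free_mul.
Proof. by move=> x y z; apply: val_inj; rewrite /= reduce_catl reduce_catr catA. Qed.

Lemma free_mul1 : left_id free_one free_mul.
Proof. by move=> x; apply: val_inj; rewrite /= reduce_id // reduced_word. Qed.

Lemma free_mulr1 : right_id free_one free_mul.
Proof. by move=> x; apply: val_inj; rewrite /= cats0 reduce_id // reduced_word. Qed.

Lemma reduce_mulV w : reduce (rev [seq inv_letter a | a <- w] ++ w) = [::].
Proof.
elim: w => //= a w IH; rewrite rev_cons cat_rcons /reduce foldr_cat /=.
by rewrite -/(reduce w) pushK ?reduced_reduce // -foldr_cat.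
Qed.

Lemma free_mulV : left_inverse free_one free_inv free_mul.
Proof. by move=> x; apply: val_inj; rewrite /= reduce_catl reduce_mulV. Qed.

Lemma free_mulrV : right_inverse free_one free_inv free_mul.
Proof.
move=> x; apply: val_inj; rewrite /= reduce_catr.
set w := word x; set w' := rev _.
have -> : w = rev [seq inv_letter a | a <- w'].
  by rewrite map_rev revK -map_comp map_id_in // => a _; apply: inv_letterK.
exact: reduce_mulV.
Qed.

HB.instance Definition _ := isGroup.Build free_group
  free_mulA free_mul1 free_mulr1 free_mulV free_mulrV.

End FreeGroup.

Section Evaluation.
Variables (G : groupType) (l : nat) (g : 'I_l -> G).

Definition eval_letter (a : letter l) : G :=
  if a.2 then ((g a.1)^-1)%g else g a.1.

(* s(g_1, ..., g_l) for s in F(x_1, ..., x_l). *)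
Definition free_eval (s : free_group l) : G :=
  (\prod_(a <- word s) eval_letter a)%g.

Lemma free_evalM : {morph free_eval : s t / (s * t)%g}.
Proof.
have eV a : eval_letter (inv_letter a) = ((eval_letter a)^-1)%g.
  by case: a => i [] //=; rewrite /eval_letter /= invgK.
have push_eval a w : (\prod_(b <- push a w) eval_letter b
                      = eval_letter a * \prod_(b <- w) eval_letter b)%g.
  case: w => [|b w] /=; first by rewrite big_seq1 big_nil mulg1.
  by case: ifP => [/eqP ->|_]; rewrite !big_cons // eV mulVKg.
have reduce_eval w : (\prod_(b <- reduce w) eval_letter b
                      = \prod_(b <- w) eval_letter b)%g.
  by elim: w => [//|a w IH]; rewrite /reduce /= push_eval IH big_cons.
by move=> s t; rewrite /free_eval reduce_eval big_cat.
Qed.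

End Evaluation.

Section EquationallyNoetherian.
Variable G : groupType.

Definition solutions (l : nat) (S : set (free_group l)) : set ('I_l -> G) :=
  [set g | forall s, S s -> free_eval g s = 1%g].

Definition equationally_noetherian : Prop :=
  forall (l : nat), (1 <= l)%N -> forall S : set (free_group l),
    exists S0 : set (free_group l),
      [/\ finite_set S0, S0 `<=` S & solutions S0 = solutions S].

End EquationallyNoetherian.

Section Growth.
Variable G : groupType.
Implicit Types S : {fset G}.

(* B_n(G, S), also written S^n: the products of at most n elements of S. *)
Definition word_ball S (n : nat) : {fset G} :=
  iter n (fun B => B `|` [fset (x * y)%g | x in B, y in S])%fset [fset 1%g]%fset.

Definition generating_set S : Prop :=
  (forall x, x \in S -> (x^-1)%g \in S) /\
  (forall g, exists n, g \in word_ball S n).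

Definition finitely_generated : Prop := exists S, generating_set S.

Definition growth_rate (R : realType) S : R :=
  lim ((#|` word_ball S n|%:R : R) `^ (n%:R^-1) @[n --> \oo]).

Definition growth_rates (R : realType) : set R :=
  [set growth_rate R S | S in generating_set].

(* The automorphisms of G are the bijective multiplicative maps G -> G. *)
Definition aut_orbit S : set {fset G} :=
  [set [fset phi x | x in S]%fset
    | phi in [set phi : {multiplicative G -> G} | bijective phi]].

End Growth.

Arguments growth_rates : clear implicits.

Section Hyperbolicity.
Variables (R : realType) (X : metricType R).
Implicit Types (o x y z : X) (u v : nat -> X).

Definition geodesic_space : Prop :=
  forall x y, exists gamma : R -> X,
    [/\ gamma 0 = x, gamma (mdist x y) = y &
      {in `[0, mdist x y] &, forall s t, mdist (gamma s) (gamma t) = `|s - t|}].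

Definition gromov_product o x y : R :=
  (mdist x o + mdist y o - mdist x y) / 2.

Definition hyperbolic_space (delta : R) : Prop :=
  geodesic_space /\
  forall o x y z,
    Num.min (gromov_product o x y) (gromov_product o y z) - delta
      <= gromov_product o x z.

(* (u_i | v_j)_o tends to infinity as i and j tend to infinity. *)
Definition same_end u v : Prop :=
  forall o, gromov_product o (u p.1) (v p.2) @[p --> (\oo, \oo)] --> +oo.

Definition converges_at_infinity u : Prop := same_end u u.

Definition end_of u : set (nat -> X) :=
  [set v | converges_at_infinity v /\ same_end u v].

(* The Gromov boundary; a point is an equivalence class of sequences
   converging at infinity. *)
Definition gromov_boundary : set (set (nat -> X)) :=
  [set end_of u | u in converges_at_infinity].

Definition hyperbolic_isometry (f : X -> X) : Prop :=
  exists x, exists2 C : R, 0 < C &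
    forall n : nat, (0 < n)%N -> C * n%:R < mdist x (iter n f x).

End Hyperbolicity.

Section Actions.
Variables (R : realType) (X : metricType R) (G : groupType).
Variable act : G -> X -> X.

Definition isometric_action : Prop :=
  [/\ forall x, act 1%g x = x,
      forall g h x, act (g * h)%g x = act g (act h x) &
      forall g x y, mdist (act g x) (act g y) = mdist x y].

Definition acylindrical : Prop :=
  forall eps : R, 0 < eps -> exists (r : R) (N : nat),
    [/\ 0 < r, (0 < N)%N &
      forall x y, r <= mdist x y ->
        [set g | mdist x (act g x) <= eps /\ mdist y (act g y) <= eps]
          #<= `I_N].

(* A sequence in X converges to a boundary point exactly when it belongs to
   that point, so these are the accumulation points of the orbits in the
   boundary. *)
Definition limit_set : set (set (nat -> X)) :=
  [set xi | gromov_boundary xi /\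
    exists x (g : nat -> G), xi (fun n => act (g n) x)].

Definition elementary : Prop := limit_set #<= `I_2.

End Actions.

(* Main.v *)
(* Translation lengths of hyperbolic elements are uniformly bounded below, and
   S^M contains one; by acylindricity a power [h] of it, of bounded S-length,
   is long compared with the displacement of some base point by S, for all S
   at once.  With a suitable high power of [h] inserted between the two factors, a
   product lies on a quasigeodesic path from which its factors can be
   recovered up to O(n) choices:
   #{(x, y)} <= C n |B_n+C| for pairs of total length at most [n].  Doubling
   this inequality gives rho^n <= |B_n| <= O(n) rho^n uniformly in S; in
   particular |S| is bounded.

   Were there infinitely many orbits, a non-principal ultrafilter on marked
   generating sets [phi] of rate [rho] would give a limit group F / K which,
   [G] being equationally Noetherian, surjects onto [G] through some [f] of
   the same family with a relator [r] outside [K].  For most [phi], the image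
   of [ker f] under [phi] is then a normal subgroup too large for its
   centralizer to have more than N elements.  Inserting relators of [f] at
   various places in a word for [g] in B_k(f) produces many elements of
   B_(k+q)(phi), so |B_m(phi)| is at least beta rho^m on an arbitrarily long
   range of [m], for any given [beta].  For [beta] large this contradicts the
   product inequality, which replaces such a lower bound [beta] by a multiple
   of [beta ^ 2] further on, and the upper bound O(n) rho^n. *)

(* The upper bound on |B_n| exceeds rho^n by a factor O(n), so a constant gain beta is no
   contradiction by itself. It has to be amplified: for a constant c depending on C and rho, each
   use of the product inequality squares c beta and multiplies the length from which the bound holds
   by about 4. A doubly exponential gain thus meets an upper bound that is only exponential in the
   number of iterations. The factor O(n) comes from rigidity: the first factor of a product is
   determined up to finitely many choices only once its displacement of the base point is known to
   within the scale of S, and this displacement falls into one of n + 1 intervals. The Noetherian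
   hypothesis serves twice. It shows that most f kill K, and it lets finitely many relators decide
   whether an element centralizes the image of ker f, which makes a pigeonhole argument over
   relators possible. *)
Require Import Defs.
From HB Require Import structures.
From mathcomp Require Import all_boot all_order all_algebra finmap.
From mathcomp Require Import all_classical all_reals all_analysis.
From mathcomp Require Import lra ring zify.

Set Implicit Arguments.
Unset Strict Implicit.
Unset Printing Implicit Defensive.

Import Order.TTheory GRing.Theory Num.Theory.
Import numFieldNormedType.Exports.

Local Open Scope classical_set_scope.
Local Open Scope ring_scope.

(* A copy of [mdist] whose instance path to [R] is fixed once and for all, so
   that [lra] recognizes equal distances. *)
Definition dist (R : realType) (X : metricType R) (x y : X) : R := mdist x y.

(** * Near-geodesic points and Gromov products in hyperbolic spaces *)

Section Distance.
Variables (R : realType) (X : metricType R).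
Implicit Types x y z : X.

Lemma distC x y : dist x y = dist y x.
Proof. exact: metric_sym. Qed.

Lemma distxx x : dist x x = 0.
Proof. exact: mdistxx. Qed.

Lemma dist_ge0 x y : 0 <= dist x y.
Proof. exact: mdist_ge0. Qed.

Lemma dist_triangle y x z : dist x z <= dist x y + dist y z.
Proof. exact: metric_triangle. Qed.

Lemma gromov_productE (o x y : X) :
  gromov_product o x y = (dist x o + dist y o - dist x y) / 2.
Proof. by []. Qed.

End Distance.

Arguments dist : simpl never.

Section Hyperbolic_geometry.
Variables (R : realType) (X : metricType R) (delta : R).
Local Notation d := (@dist R X).
Implicit Types (a b e o x y z w : X).

(** The hyperbolic inequality without base point, as a disjunction of two linear inequalities: most
    distance estimates are then closed by choosing four points, splitting the cases and calling
    [lra]. *)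
Definition four_point := forall x y z w,
  d x z + d y w <= d x y + d z w + 2 * delta \/
  d x z + d y w <= d x w + d y z + 2 * delta.

Lemma hyperbolic_four_point : hyperbolic_space X delta -> four_point.
Proof.
case=> _ H x y z w; have := H w x y z; rewrite !gromov_productE.
case: (leP ((d x w + d y w - d x y) / 2)) => _ ?; [left|right]; lra.
Qed.

Lemma geodesic_point x y t : geodesic_space X -> 0 <= t <= d x y ->
  exists z, d x z = t /\ d z y = d x y - t.
Proof.
move=> gX /andP[t0 td]; have [g [g0 g1 giso]] := gX x y.
have xx : 0 \in `[0, mdist x y] by rewrite in_itv /= lexx; exact: dist_ge0.
have yy : mdist x y \in `[0, mdist x y] by rewrite in_itv /= lexx andbT; exact: dist_ge0.
have tt : t \in `[0, mdist x y] by rewrite in_itv /= t0.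
exists (g t); rewrite /dist; split.
- by rewrite -{1}g0 (giso _ _ xx tt) sub0r normrN ger0_norm.
- by rewrite -{1}g1 (giso _ _ tt yy) distrC ger0_norm // subr_ge0.
Qed.

Definition between (k : R) a b w := d a w + d w b <= d a b + k.

Hypothesis fp : four_point.

Lemma between_sym k a b w : between k a b w -> between k b a w.
Proof. by rewrite /between (distC b w) (distC w a) (distC b a); lra. Qed.

Lemma between_close k t a b w w' : between k a b w -> between k a b w' ->
  `|d a w - d a w'| <= t -> d w w' <= t + k + 2 * delta.
Proof.
rewrite /between ler_norml => bw bw' /andP[? ?].
have := fp w a w' b; rewrite (distC w a).
by case=> ?; lra.
Qed.

(** Geodesics from [b] to [a] and to [e] separate at distance (a|e)_b from [b]; beyond that, the
    former runs along a geodesic from [e] to [a]. *)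
Lemma between_extend k a b e w : between k b a w ->
  gromov_product b a e + k / 2 <= d b w -> between (k + 2 * delta) e a w.
Proof.
rewrite /between gromov_productE => bw ge.
have := fp e b w a; have := distC b e; have := distC a b; have := distC a e.
by move=> ? ? ?; case=> ?; lra.
Qed.

(** Moving an endpoint by [r] disturbs a geodesic only within about [r] of that endpoint. *)
Lemma between_move k r a a' b w : between k a' b w -> d a a' <= r ->
  r + k + 2 * delta < d a' w -> between (k + 2 * delta) a b w.
Proof.
rewrite /between => bw aa' aw; have := fp a a' w b; have := dist_ge0 a w.
by move=> ?; case=> ?; lra.
Qed.

(* The contrapositive uses of the hyperbolic inequality: a large product
   (x|y) can be dropped from an upper bound on (x|z). *)
Lemma gromov_product_drop o x y z t : gromov_product o x z <= t ->
  t + delta < gromov_product o x y -> gromov_product o y z <= t + delta.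
Proof.
rewrite !gromov_productE => ? ?.
have := fp x y z o; have := distC y x.
by move=> ?; case=> ?; lra.
Qed.

End Hyperbolic_geometry.

Lemma gromov_productC (R : realType) (X : metricType R) (o x y : X) :
  gromov_product o x y = gromov_product o y x.
Proof. rewrite !gromov_productE (distC y x); lra. Qed.

Lemma gromov_product_move (R : realType) (X : metricType R) (o x y z : X) :
  gromov_product o x z <= gromov_product o y z + dist x y.
Proof.
rewrite !gromov_productE; have := dist_triangle y x o; have := dist_triangle x y z.
by rewrite (distC y x); lra.
Qed.

(** * Orbits of powers of an isometry, and fellow travelling *)

Section Isometries.
Variables (R : realType) (X : metricType R) (G : groupType) (act : G -> X -> X).
Hypothesis isom : isometric_action act.
Local Notation d := (@dist R X).
Implicit Types (g h y s : G) (o x z : X).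

Lemma act1 x : act 1%g x = x.
Proof. by case: isom => H _ _; apply: H. Qed.

Lemma actM g h x : act (g * h)%g x = act g (act h x).
Proof. by case: isom => _ H _; apply: H. Qed.

Lemma dist_act g x z : d (act g x) (act g z) = d x z.
Proof. by case: isom => _ _ H; apply: H. Qed.

Lemma dist_actl g x z : d (act g x) z = d x (act (g^-1)%g z).
Proof. by rewrite -(dist_act g x) -actM mulgV act1. Qed.

Lemma dist_actr g x z : d x (act g z) = d (act (g^-1)%g x) z.
Proof. by rewrite dist_actl invgK. Qed.

Lemma dist_actV g x : d x (act (g^-1)%g x) = d x (act g x).
Proof. by rewrite dist_actr invgK distC. Qed.

(** All distances between the points [h^i o] are terms of this sequence, so hyperbolicity along an
    orbit becomes a family of inequalities between its terms. *)
Definition orb o h n := d o (act (h ^+ n)%g o).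

Lemma orb0 o h : orb o h 0 = 0.
Proof. by rewrite /orb expg0 act1 distxx. Qed.

Lemma orb_ge0 o h n : 0 <= orb o h n.
Proof. exact: dist_ge0. Qed.

Lemma orbV o h n : orb o (h^-1)%g n = orb o h n.
Proof. by rewrite /orb expVgn dist_actV. Qed.

Lemma dist_orb o h m n :
  d (act (h ^+ m)%g o) (act (h ^+ (m + n))%g o) = orb o h n.
Proof. by rewrite expgnDr actM dist_act. Qed.

Lemma dist_orbV o h m n :
  d (act (h^-1 ^+ m)%g o) (act (h ^+ n)%g o) = orb o h (m + n).
Proof. by rewrite dist_actl -actM expVgn invgK -expgnDr. Qed.

Lemma orbD o h m n : orb o h (m + n) <= orb o h m + orb o h n.
Proof.
by rewrite -(dist_orb o h m n); exact: dist_triangle.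
Qed.

Lemma orb_exp o h m n : orb o (h ^+ m)%g n = orb o h (m * n).
Proof. by rewrite /orb expgnA. Qed.

Lemma orb_le_mul o h n : orb o h n <= n%:R * orb o h 1.
Proof.
elim: n => [|n IH]; first by rewrite orb0 mul0r.
by rewrite -addn1 (le_trans (orbD o h n 1)) // natrD mulrDl mul1r lerD2r.
Qed.

End Isometries.

Section Good_isometries.
Variables (R : realType) (X : metricType R) (G : groupType) (act : G -> X -> X).
Variable delta : R.
Hypotheses (isom : isometric_action act) (fp : four_point X delta).
Hypothesis delta_ge1 : 1 <= delta.
Local Ltac lrad := have := delta_ge1; lra.
Local Notation d := (@dist R X).
Local Notation b := (orb act).
Implicit Types (g h y s : G) (o x z : X).

Lemma orb_four_point o h n m k :
  b o h (n + m) + b o h (m + k) <= b o h n + b o h k + 2 * delta \/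
  b o h (n + m) + b o h (m + k) <= b o h (n + m + k) + b o h m + 2 * delta.
Proof.
have := fp o (act (h ^+ n)%g o) (act (h ^+ (n + m))%g o) (act (h ^+ (n + (m + k)))%g o).
rewrite !(dist_orb isom) [(n + (m + k))%N]addnA (dist_orb isom).
by case=> ?; [left|right].
Qed.

(** Equivalently, twice the Gromov product of [h o] and [h^-1 o] at [o] is at most
    [d o (act h o) - 1000 * delta]. This local condition makes the orbit of [o] under [h] a
    quasigeodesic; 1000 leaves room for the errors of later estimates. *)
Definition good o h := b o h 1 + 1000 * delta <= b o h 2.

Lemma goodV o h : good o h -> good o (h^-1)%g.
Proof. by rewrite /good !(orbV isom). Qed.

(** Passage from local to global. For the points of index 0, n, n+1 and n+2, one alternative of the
    four-point inequality would make the sequence decrease from n to n+1, against the induction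
    hypothesis; the other is the claim. *)
Lemma orb_incr o h n : good o h ->
  b o h n + (b o h 2 - b o h 1 - 2 * delta) <= b o h n.+1.
Proof.
rewrite /good => gh; elim: n => [|n IH].
  have : b o h 2 <= b o h 1 + b o h 1 := orbD isom o h 1 1; rewrite orb0 //; lrad.
have := orb_four_point o h n 1 1; rewrite !addn1.
by case=> ?; lrad.
Qed.

Lemma orb_ge o h n : good o h ->
  n%:R * (b o h 2 - b o h 1 - 2 * delta) <= b o h n.
Proof.
move=> gh; elim: n => [|n IH]; first by rewrite mul0r orb0.
by rewrite -natr1 mulrDl mul1r; have := orb_incr n gh; lrad.
Qed.

Lemma orb_mono o h m n : good o h -> b o h m <= b o h (m + n).
Proof.
move=> gh; elim: n => [|n IH]; first by rewrite addn0.
by rewrite addnS; have := orb_incr (m + n) gh; have := gh; rewrite /good; lrad.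
Qed.

Lemma orb_superadd o h n m k : good o h -> (0 < m)%N ->
  b o h (n + m) + b o h (m + k) <= b o h (n + m + k) + b o h m + 2 * delta.
Proof.
move=> gh m0.
have far i : b o h i + (b o h 2 - b o h 1 - 2 * delta) <= b o h (i + m).
  case: m m0 => // m _; rewrite addnS.
  by apply: le_trans (orb_incr _ gh); rewrite lerD2r; apply: orb_mono.
have := far n; have := far k; rewrite (addnC k); have := gh; rewrite /good.
by have := orb_four_point o h n m k; case=> ?; lrad.
Qed.

(** The left-hand side is twice the Gromov product of [o] and [h^(n+m) o] at [h^n o]: the orbit
    never backtracks by more than half a step. *)
Lemma orb_product o h n m : good o h -> b o h n + b o h m - b o h (n + m) <= b o h 1.
Proof.
move=> gh; case: m => [|m]; first by rewrite addn0 orb0 // addr0 subrr; exact: orb_ge0.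
have := orb_superadd n m gh (isT : 0 < 1)%N; rewrite addnAC addn1 add1n addn1.
by have := orb_incr n gh; rewrite addnS; have := gh; rewrite /good; lrad.
Qed.

Lemma good_gromov_product o h n m : good o h ->
  gromov_product o (act (h ^+ n)%g o) (act (h^-1 ^+ m)%g o) <= b o h 1 / 2.
Proof.
move=> gh; rewrite gromov_productE (distC (act (h ^+ n)%g o) (act _ _)) dist_orbV //.
rewrite !(distC _ o) -/(b o h n) -/(b o h^-1%g m) orbV // addnC.
by have := orb_product m n gh; rewrite addnC; lrad.
Qed.

Definition on_segment o h p (t : R) x :=
  d o x = t /\ d x (act (h ^+ p)%g o) = b o h p - t.

(* [h^i] acts on the middle part of a geodesic from [o] to [h^p o] as the
   translation by [b_(p+i) - b_p], up to [6 delta]. *)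
Lemma segment_translate o h p i t x x' :
  let sigma := b o h (p + i) - b o h p in
  let c := (b o h i - sigma) / 2 in
  on_segment o h p t x -> on_segment o h p (t + sigma) x' ->
  c <= t -> t + sigma <= b o h p - c -> d (act (h ^+ i)%g x) x' <= 6 * delta.
Proof.
(* [c] is the Gromov product of [o] and [h^(p+i) o], both at [h^i o] and at [h^p o]. Farther than
   [c] from these points, the segments starting at [h^i o] and ending at [h^p o] run along one from
   [o] to [h^(p+i) o]. *)
move=> sigma c [ox xA] [ox' xA'] ct tc.
pose A := act (h ^+ p)%g o; pose A' := act (h ^+ (i + p))%g o.
pose z := act (h ^+ i)%g x.
have oA : d o A = b o h p by [].
have oA' : d o A' = b o h p + sigma by rewrite /sigma /orb /A' addnC; lrad.
have oi : d o (act (h ^+ i)%g o) = b o h i by [].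
have iA' : d (act (h ^+ i)%g o) A' = b o h p by exact: (dist_orb isom).
have AA' : d A A' = b o h i by rewrite /A' addnC; exact: (dist_orb isom).
have iz : d (act (h ^+ i)%g o) z = t by rewrite dist_act.
have zA' : d z A' = b o h p - t by rewrite /z /A' expgnDr actM // dist_act.
have oz : t + sigma <= d o z <= t + sigma + 2 * delta.
  apply/andP; split; first by have := dist_triangle z o A'; lrad.
  by have := fp o (act (h ^+ i)%g o) z A'; case=> ?; rewrite /c in ct; lrad.
have x'A' : d x' A' <= b o h p + sigma - (t + sigma) + 2 * delta.
  by have := fp x' o A' A; rewrite (distC x' o) (distC A') => -[] ?; rewrite /c in tc; lrad.
have -> : 6 * delta = 2 * delta + 2 * delta + 2 * delta by lrad.
apply: (@between_close _ _ _ fp _ _ o A'); rewrite /between; try lrad.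
by rewrite ler_norml; lrad.
Qed.

Lemma good_segment_translate o h p i t x x' :
  let sigma := b o h (p + i) - b o h p in good o h ->
  on_segment o h p t x -> on_segment o h p (t + sigma) x' ->
  b o h 1 / 2 <= t -> t + sigma <= b o h p - b o h 1 / 2 ->
  d (act (h ^+ i)%g x) x' <= 6 * delta.
Proof.
move=> sigma gh sx sx' t1 t2; have := orb_product p i gh => ?.
by apply: (segment_translate sx sx'); rewrite /sigma in t2 *; lrad.
Qed.

End Good_isometries.

Lemma conj_exp_commute (G : groupType) (h y : G) i j : (i < j)%N ->
  (h ^- i * y * h ^+ i = h ^- j * y * h ^+ j ->
   y * h ^+ (j - i) = h ^+ (j - i) * y)%g.
Proof.
move=> /ltnW /subnK; set k := (j - i)%N => <-.
rewrite expgnDr invgM !mulgA => /mulIg; rewrite -!mulgA => /mulgI e.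
by rewrite {2}e mulVKg.
Qed.

Lemma flip_exp (G : groupType) (h y : G) i j : (i < j)%N ->
  (h ^- i * y * h ^- i = h ^- j * y * h ^- j ->
   h ^+ (j - i) * y * h ^+ (j - i) = y)%g.
Proof.
move=> /ltnW /subnK; set k := (j - i)%N => <-.
rewrite {1}expgnDr addnC expgnDr !invgM -!mulgA => /mulgI.
rewrite !mulgA => /mulIg e.
by rewrite {1}e -!mulgA mulVKg mulVg mulg1.
Qed.

Section Fellow_travelling.
Variables (R : realType) (X : metricType R) (G : groupType) (act : G -> X -> X).
Variables (delta R0 : R) (N0 : nat).
Hypotheses (isom : isometric_action act) (fp : four_point X delta).
Hypotheses (gX : geodesic_space X) (delta_ge1 : 1 <= delta).
Local Ltac lrad := have := delta_ge1; lra.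
Local Notation d := (@dist R X).
Local Notation b := (orb act).
Implicit Types (g h y s : G) (o x z : X).

(** Acylindricity at a single displacement, with its constants as parameters: with [e = 100 * delta]
    throughout, [R0] and [N0] are fixed once for the whole proof. *)
Definition acylindrical_at (e : R) := 0 <= R0 /\
  forall x z, R0 <= d x z -> forall A : {fset G},
  (forall g, g \in A -> d x (act g x) <= e /\ d z (act g z) <= e) ->
  (#|` A| <= N0)%N.

Hypothesis acyl : acylindrical_at (100 * delta).

Lemma acyl_pigeonhole x z (w : nat -> G) : R0 <= d x z ->
  (forall i, (i <= N0)%N -> d x (act (w i) x) <= 100 * delta /\
                            d z (act (w i) z) <= 100 * delta) ->
  exists i j, [/\ (i < j)%N, (j <= N0)%N & w i = w j].
Proof.
move=> xz wN.
have : ~~ uniq [seq w i | i <- iota 0 N0.+1].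
  apply/negP => uw.
  have := acyl.2 _ _ xz [fset g in [seq w i | i <- iota 0 N0.+1]]%fset.
  rewrite card_fseq undup_id // size_map size_iota ltnn => /(_ _)/notF; apply.
  move=> g; rewrite in_fset => /mapP[i]; rewrite mem_iota add0n ltnS => iN ->.
  exact: wN.
move/(uniqPn 1%g) => [i [j []]]; rewrite size_map size_iota ltnS => ij jN.
have iN := leq_trans (ltnW ij) jN.
rewrite !(nth_map 0%N) ?size_iota ?ltnS // !nth_iota ?ltnS // !add0n => wij.
by exists i, j.
Qed.

Lemma segment_point o h p t : 0 <= t <= b o h p ->
  exists x, on_segment act o h p t x.
Proof. exact: geodesic_point. Qed.

Lemma segment_dist o h p t t' x x' : on_segment act o h p t x ->
  on_segment act o h p t' x' -> `|t - t'| <= d x x'.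
Proof.
move=> [ox _] [ox' _]; rewrite ler_norml.
by have := dist_triangle x o x'; have := dist_triangle x' o x; rewrite (distC x' x); lra.
Qed.

Lemma orb_shift_bounds o h p i : good act delta o h -> (i <= N0)%N ->
  0 <= b o h (p + i) - b o h p <= N0%:R * b o h 1.
Proof.
move=> gh iN; have := orb_mono isom fp delta_ge1 p i gh; have := orbD isom o h p i.
have := orb_le_mul isom o h i.
have : i%:R * b o h 1 <= N0%:R * b o h 1 by rewrite ler_wpM2r ?orb_ge0 // ler_nat.
lra.
Qed.

(* The [N0 + 1] commutators [h^-i y h^i y^-1] all move two points at distance
   at least [R0] by at most [28 delta], so two of them coincide. *)
Lemma fellow_travel_commute o h y p t0 c0 : good act delta o h ->
  let l := R0 + N0%:R * b o h 1 in
  b o h 1 / 2 <= t0 -> b o h 1 / 2 <= c0 + t0 ->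
  t0 + l <= b o h p - b o h 1 / 2 -> c0 + t0 + l <= b o h p - b o h 1 / 2 ->
  (forall t x x', t0 <= t <= t0 + l -> on_segment act o h p t x ->
     on_segment act o h p (c0 + t) x' -> d (act y x) x' <= 8 * delta) ->
  exists j, (0 < j <= N0)%N /\ (y * h ^+ j = h ^+ j * y)%g.
Proof.
move=> gh l t0l ct0l t0r ct0r match_.
have [R0_ge0 _] := acyl.
have b1_ge0 := orb_ge0 act o h 1.
have Nb_ge0 : 0 <= N0%:R * b o h 1 by rewrite mulr_ge0.
have seg t : 0 <= t <= b o h p -> exists x, on_segment act o h p t x.
  exact: segment_point.
have moves t x i : t0 <= t <= t0 + R0 -> on_segment act o h p t x -> (i <= N0)%N ->
    d (act y x) (act (h ^- i * y * h ^+ i * y^-1)%g (act y x)) <= 28 * delta.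
  move=> tI sx iN; have sigI := orb_shift_bounds p gh iN.
  pose sig := b o h (p + i) - b o h p; have sigE : sig = b o h (p + i) - b o h p by [].
  have [|u su] := seg (c0 + t); first by rewrite /l in t0r ct0r; lra.
  have [|v sv] := seg (c0 + t + sig); first by rewrite /l in t0r ct0r; lra.
  have [|w sw] := seg (t + sig); first by rewrite /l in t0r ct0r; lra.
  have yu : d (act y x) u <= 8 * delta by apply: (match_ t) => //; rewrite /l; lra.
  have yw : d (act y w) v <= 8 * delta.
    by apply: (match_ (t + sig)) => //; [rewrite /l; lra | rewrite addrA].
  have uv : d (act (h ^+ i)%g u) v <= 6 * delta.
    apply: (good_segment_translate isom fp delta_ge1 gh su sv);
      by rewrite /l in t0r ct0r; lra.
  have xw : d (act (h ^+ i)%g x) w <= 6 * delta.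
    apply: (good_segment_translate isom fp delta_ge1 gh sx sw);
      by rewrite /l in t0r ct0r; lra.
  rewrite -(actM isom) mulgVK !(actM isom) (dist_actr isom) invgK.
  have := dist_triangle (act (h ^+ i)%g u) (act (h ^+ i)%g (act y x)) (act y (act (h ^+ i)%g x)).
  have := dist_triangle v (act (h ^+ i)%g u) (act y (act (h ^+ i)%g x)).
  have := dist_triangle (act y w) v (act y (act (h ^+ i)%g x)).
  by rewrite !(dist_act isom) (distC v (act y w)) (distC w); lra.
have [|x sx] := seg t0; first by rewrite /l in t0r; lra.
have [|x' sx'] := seg (t0 + R0); first by rewrite /l in t0r; lra.
have xx' : R0 <= d (act y x) (act y x').
  by rewrite dist_act //; have := segment_dist sx sx'; rewrite distrC ger0_norm; lra.
have [i|i [j [ij jN]]] := acyl_pigeonhole (w := fun i => (h ^- i * y * h ^+ i * y^-1)%g) xx'.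
  move=> iN; split.
    by have := moves t0 x i _ sx iN; rewrite lexx lerDl R0_ge0 => /(_ isT); lrad.
  by have := moves (t0 + R0) x' i _ sx' iN; rewrite lexx lerDl R0_ge0 => /(_ isT); lrad.
move=> /mulIg eij; exists (j - i)%N; split.
  by rewrite subn_gt0 ij (leq_trans (leq_subr _ _)).
exact: conj_exp_commute.
Qed.

(** When [y] reverses the segment, [y h^-i] nearly agrees with [h^i y] on it, so the pigeonhole is
    applied to the elements [h^-i y h^-i y^-1]. *)
Lemma fellow_travel_flip o h y p t0 c0 : good act delta o h ->
  let l := R0 + N0%:R * b o h 1 in
  b o h 1 / 2 <= t0 -> b o h 1 / 2 <= c0 - (t0 + l) ->
  t0 + l <= b o h p - b o h 1 / 2 -> c0 - t0 <= b o h p - b o h 1 / 2 ->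
  (forall t x x', t0 <= t <= t0 + l -> on_segment act o h p t x ->
     on_segment act o h p (c0 - t) x' -> d (act y x) x' <= 8 * delta) ->
  exists j, (0 < j <= N0)%N /\ (h ^+ j * y * h ^+ j = y)%g.
Proof.
move=> gh l t0l ct0l t0r ct0r match_.
have [R0_ge0 _] := acyl.
have b1_ge0 := orb_ge0 act o h 1.
have Nb_ge0 : 0 <= N0%:R * b o h 1 by rewrite mulr_ge0.
have seg t : 0 <= t <= b o h p -> exists x, on_segment act o h p t x.
  exact: segment_point.
(* A power [h^-i] shifts parameters to the left by at most [N0 * b1], hence this margin in front of
   the two test points. *)
pose t1 := t0 + N0%:R * b o h 1; have t1E : t1 = t0 + N0%:R * b o h 1 by [].
have moves t x i : t1 <= t <= t1 + R0 -> on_segment act o h p t x -> (i <= N0)%N ->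
    d (act y x) (act (h ^- i * y * h ^- i * y^-1)%g (act y x)) <= 28 * delta.
  move=> tI sx iN; have sigI := orb_shift_bounds p gh iN.
  pose sig := b o h (p + i) - b o h p; have sigE : sig = b o h (p + i) - b o h p by [].
  have [|u su] := seg (c0 - t); first by rewrite /l in t0r ct0l; lra.
  have [|v sv] := seg (c0 - t + sig); first by rewrite /l in t0r ct0l; lra.
  have [|w sw] := seg (t - sig); first by rewrite /l in t0r ct0l; lra.
  have yu : d (act y x) u <= 8 * delta by apply: (match_ t) => //; rewrite /l; lra.
  have yw : d (act y w) v <= 8 * delta.
    apply: (match_ (t - sig)) => //; first by rewrite /l; lra.
    by have -> : c0 - (t - sig) = c0 - t + sig by ring.
  have uv : d (act (h ^+ i)%g u) v <= 6 * delta.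
    apply: (good_segment_translate isom fp delta_ge1 gh su sv);
      by rewrite /l in t0r ct0l; lra.
  have xw : d (act (h ^+ i)%g w) x <= 6 * delta.
    have sx' : on_segment act o h p (t - sig + sig) x by rewrite subrK.
    apply: (good_segment_translate isom fp delta_ge1 gh sw sx');
      by rewrite /l in t0r ct0l; lra.
  rewrite -(actM isom) mulgVK !(actM isom) (dist_actr isom) invgK.
  have := dist_triangle (act (h ^+ i)%g u) (act (h ^+ i)%g (act y x)) (act y (act (h ^- i)%g x)).
  have := dist_triangle v (act (h ^+ i)%g u) (act y (act (h ^- i)%g x)).
  have := dist_triangle (act y w) v (act y (act (h ^- i)%g x)).
  rewrite !(dist_act isom) (distC v (act y w)) [d w _](dist_actr isom) invgK.
  by lra.
have [|x sx] := seg t1; first by rewrite /l in t0r; lra.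
have [|x' sx'] := seg (t1 + R0); first by rewrite /l in t0r; lra.
have xx' : R0 <= d (act y x) (act y x').
  by rewrite dist_act //; have := segment_dist sx sx'; rewrite distrC ger0_norm; lra.
have [i|i [j [ij jN]]] := acyl_pigeonhole (w := fun i => (h ^- i * y * h ^- i * y^-1)%g) xx'.
  move=> iN; split.
    by have := moves t1 x i _ sx iN; rewrite lexx lerDl R0_ge0 => /(_ isT); lrad.
  by have := moves (t1 + R0) x' i _ sx' iN; rewrite lexx lerDl R0_ge0 => /(_ isT); lrad.
move=> /mulIg eij; exists (j - i)%N; split.
  by rewrite subn_gt0 ij (leq_trans (leq_subr _ _)).
exact: flip_exp.
Qed.

(* The segments [o, h^p o] and [q, A'] are within [8 delta] of each other on
   the length on which they fellow travel, which is about [(h^p o | A')_o]. *)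
Lemma segment_match o h p q A' z x' t r :
  let phi := d o A' - b o h p in
  d o q <= r -> d q A' = b o h p -> d q z = t -> d z A' = b o h p - t ->
  r <= t -> t + phi + 2 * delta <= gromov_product o (act (h ^+ p)%g o) A' ->
  on_segment act o h p (t + phi) x' -> d z x' <= 8 * delta.
Proof.
move=> phi oq qA' qz zA' rt; rewrite gromov_productE => tG [ox' x'A].
set A := act (h ^+ p)%g o in tG x'A.
have oA : d o A = b o h p by [].
have phiE : phi = d o A' - b o h p by [].
have oz : phi + t <= d o z <= phi + t + 2 * delta.
  apply/andP; split; first by have := dist_triangle z o A'; lra.
  by have := fp o q z A'; have := dist_triangle o q A'; rewrite (distC q o) => ?; case=> ?; lra.
have zA : d z A <= b o h p - (phi + t) + 2 * delta.
  have := fp z o A A'; rewrite (distC z o) (distC A o) (distC A' o) in tG *.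
  by case=> ?; lra.
have -> : 8 * delta = 2 * delta + 4 * delta + 2 * delta by lra.
apply: (@between_close _ _ _ fp _ _ o A); rewrite /between; try lrad.
by rewrite ler_norml; lra.
Qed.

(** Excludes exactly the two conclusions of the fellow-travelling lemmas. *)
Definition independent h s := forall j, (0 < j <= N0)%N ->
  (s * h ^+ j <> h ^+ j * s)%g /\ (h ^+ j * s * h ^+ j <> s)%g.

(** If a segment of [h] and its translate by [s] stayed together for this length, they would fellow
    travel for [R0 + N0 * b1] besides the margins, against independence. *)
Definition divergence o h s := 3 * d o (act s o) + (N0%:R + 2) * b o h 1 + R0 + 10 * delta.

Lemma independent_same_sign o h s p : good act delta o h -> independent h s ->
  gromov_product o (act (h ^+ p)%g o) (act (s * h ^+ p)%g o) < divergence o h s.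
Proof.
move=> gh ind; rewrite ltNge; apply/negP; rewrite /divergence => Glarge.
have [R0_ge0 _] := acyl.
have b1_ge0 := orb_ge0 act o h 1.
have Nb_ge0 : 0 <= N0%:R * b o h 1 by rewrite mulr_ge0.
set A' := act (s * h ^+ p)%g o in Glarge.
pose phi := d o A' - b o h p; have phiE : phi = d o A' - b o h p by [].
have oA : d o (act (h ^+ p)%g o) = b o h p by [].
have qA' : d (act s o) A' = b o h p by rewrite /A' (actM isom) dist_act.
have := dist_triangle (act s o) o A'; have := dist_triangle o (act s o) A'.
rewrite (distC (act s o) o) => ? ?.
have Gle : gromov_product o (act (h ^+ p)%g o) A' <= b o h p.
  rewrite gromov_productE -oA (distC _ o) (distC A' o).
  by have := dist_triangle (act (h ^+ p)%g o) o A'; lra.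
have [||||t x x' tI [ox xA] sx'|j [jN]] :=
    @fellow_travel_commute o h s p (d o (act s o) + b o h 1) phi gh;
  [lrad | lrad | lrad | lrad | |].
  apply: (@segment_match o h p (act s o) A' (act s x) x' t (d o (act s o))) => //.
  - by rewrite dist_act.
  - by rewrite /A' (actM isom) dist_act.
  - by lrad.
  - by rewrite -/phi; lrad.
  - by rewrite -/phi addrC.
by case: (ind j jN).
Qed.

Lemma independent_opposite_sign o h s p : good act delta o h -> independent h s ->
  gromov_product o (act (h ^+ p)%g o) (act (s * h ^- p)%g o) < divergence o h s.
Proof.
move=> gh ind; rewrite ltNge; apply/negP; rewrite /divergence => Glarge.
have [R0_ge0 _] := acyl.
have b1_ge0 := orb_ge0 act o h 1.
have Nb_ge0 : 0 <= N0%:R * b o h 1 by rewrite mulr_ge0.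
set A' := act (s * h ^- p)%g o in Glarge.
pose phi := d o A' - b o h p; have phiE : phi = d o A' - b o h p by [].
have oA : d o (act (h ^+ p)%g o) = b o h p by [].
have qA' : d (act s o) A' = b o h p by rewrite /A' (actM isom) dist_act // (dist_actV isom).
have := dist_triangle (act s o) o A'; have := dist_triangle o (act s o) A'.
rewrite (distC (act s o) o) => ? ?.
have Gle : gromov_product o (act (h ^+ p)%g o) A' <= b o h p.
  rewrite gromov_productE -oA (distC _ o) (distC A' o).
  by have := dist_triangle (act (h ^+ p)%g o) o A'; lra.
(* [s h^-p] maps a segment from [o] to [h^p o] to one from [A'] to [s o], with the orientation
   reversed. The relation obtained for it passes to [s], as [h^-p] commutes with [h^j]. *)
have [||||t x x' tI [ox xA] sx'|j [jN]] :=
    @fellow_travel_flip o h (s * h ^- p)%g p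
      (b o h p - (d o (act s o) + b o h 1) - (R0 + N0%:R * b o h 1)) (phi + b o h p) gh;
    [lrad | lrad | lrad | lrad | |].
  apply: (@segment_match o h p (act s o) A' (act (s * h ^- p)%g x) x' (b o h p - t)
    (d o (act s o))) => //.
  - by rewrite (actM isom) dist_act // (dist_actr isom) invgK (distC _ x).
  - by rewrite dist_act // (distC x); lra.
  - by lrad.
  - by rewrite -/phi; lrad.
  - by have -> : b o h p - t + phi = phi + b o h p - t by ring.
move=> e; case: (ind j jN) => _; apply; apply: (mulIg (h ^- p)%g).
rewrite -[RHS]e -!mulgA; congr (_ * (_ * _))%g.
by rewrite -!expVgn; apply/commuteX2/commuteV/commute_refl.
Qed.

End Fellow_travelling.

(** * Elements independent of an isometry, and common centralizers *)

Section Independent_elements.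
Variables (R : realType) (X : metricType R) (G : groupType) (act : G -> X -> X).
Variables (delta R0 : R) (N0 : nat).
Hypotheses (isom : isometric_action act) (fp : four_point X delta).
Hypotheses (gX : geodesic_space X) (delta_ge1 : 1 <= delta).
Local Ltac lrad := have := delta_ge1; lra.
Local Notation d := (@dist R X).
Local Notation b := (orb act).
Implicit Types (g h y s : G) (o x z : X).
Hypothesis acyl : acylindrical_at act R0 N0 (100 * delta).

Definition sg (e : bool) h := if e then (h^-1)%g else h.

Lemma orb_sg o h e n : b o (sg e h) n = b o h n.
Proof. by case: e => //=; apply: orbV. Qed.

Lemma good_sg o h e : good act delta o h -> good act delta o (sg e h).
Proof. by case: e => //=; apply: goodV. Qed.

Lemma independentV h s : independent N0 h s -> independent N0 (h^-1)%g s.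
Proof.
move=> ind j /ind[ind1 ind2]; rewrite !expVgn; split=> e.
  by apply: ind1; apply: (mulgI (h ^- j)%g); apply: (mulIg (h ^- j)%g);
    rewrite -!mulgA mulgV mulg1 mulKg -e.
by apply: ind2; rewrite -{1}e -!mulgA mulVg mulg1 mulVKg.
Qed.

Lemma independent_product o h s p e e' : good act delta o h -> independent N0 h s ->
  gromov_product o (act (sg e h ^+ p)%g o) (act (s * sg e' h ^+ p)%g o)
    < divergence act delta R0 N0 o h s.
Proof.
move=> gh ind.
have divV : divergence act delta R0 N0 o (h^-1)%g s = divergence act delta R0 N0 o h s.
  by rewrite /divergence orbV.
have gV := goodV isom gh; have indV := independentV ind.
case: e; case: e' => /=.
- by rewrite -divV; apply: independent_same_sign indV.
- rewrite -divV; have := independent_opposite_sign isom fp gX delta_ge1 acyl p gV indV.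
  by rewrite -(expVgn (h^-1)%g) invgK.
- by rewrite expVgn; apply: independent_opposite_sign ind.
- exact: independent_same_sign ind.
Qed.

Lemma orb_unbounded o h k (W : R) : good act delta o h -> (0 < k)%N ->
  exists n0, forall n, (n0 <= n)%N -> W <= b o h (k * n).
Proof.
move=> gh k0; exists (Num.bound W) => n n0.
have := orb_ge isom fp delta_ge1 (k * n) gh.
have : n%:R <= (k * n)%:R :> R by rewrite ler_nat leq_pmull.
have : W <= n%:R.
  have := archi_boundP; move=> H; case: (lerP 0 W) => W0; last first.
    by apply: (le_trans (ltW W0)).
  apply: (le_trans (ltW (archi_boundP W0))); by rewrite ler_nat.
move=> H1 H2 H3; apply: le_trans H3.
apply: (le_trans H1); apply: (le_trans H2); rewrite ler_peMr //.
by move: gh; rewrite /good; lrad.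
Qed.

(* [A] coarsely fixes the centre of the ideal triangle with vertices
   [h^+oo], [h^-oo] and [s h^+oo]. *)
Lemma card_commuting o h s k (A : {fset G}) : good act delta o h ->
  independent N0 h s -> (0 < k)%N ->
  (forall y, y \in A -> commute y (h ^+ k)%g /\ commute y (s * h ^+ k * s^-1)%g) ->
  (#|` A| <= N0)%N.
Proof.
move=> gh ind k0 comA.
(* [D] depends on [A], but it only fixes how far out the triangle is taken; the bound on the
   displacement of the centre does not involve it. *)
have [D D_ge] : exists D, forall y, y \in A -> d o (act y o) <= D /\ d (act s o) (act y (act s o)) <= D.
  exists (\sum_(y <- A) (d o (act y o) + d (act s o) (act y (act s o)))) => y yA.
  have nn (z : G) : 0 <= d o (act z o) + d (act s o) (act z (act s o)).
    by rewrite addr_ge0 ?dist_ge0.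
  rewrite (big_fsetD1 y) //=.
  have : 0 <= \sum_(i <- (A `\ y)%fset) (d o (act i o) + d (act s o) (act i (act s o))).
    by apply: sumr_ge0 => z _; apply: nn.
  by have := dist_ge0 o (act y o); have := dist_ge0 (act s o) (act y (act s o)); lra.
pose Div := divergence act delta R0 N0 o h s.
have [n0 n0_ge] := orb_unbounded (D + 10 * delta + 2 * Div + b o h 1 + d o (act s o)) gh k0.
pose P := (k * n0)%N; have bP := n0_ge n0 (leqnn _); rewrite -/P in bP.
pose a := act (h ^+ P)%g o; pose a' := act (h^-1 ^+ P)%g o; pose c := act (s * h ^+ P)%g o.
have ac : gromov_product o a c < Div by apply: (independent_product P false false gh ind).
have a'c : gromov_product o a' c < Div by apply: (independent_product P true false gh ind).
have aa' : gromov_product o a a' <= b o h 1 / 2 by apply: good_gromov_product.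
have oa : d a o = b o h P by rewrite distC.
have oa' : d a' o = b o h P by rewrite distC; apply: orbV.
have sc : d (act s o) c = b o h P by rewrite /c actM // dist_act.
have := dist_triangle (act s o) o c; have := dist_triangle o (act s o) c.
rewrite (distC (act s o) o) sc (distC o c) => oc1 oc2.
have b1 := orb_ge0 act o h 1; have os := dist_ge0 o (act s o).
rewrite !gromov_productE oa oa' in ac a'c aa'.
have aa1 : d a a' <= b o h P + b o h P by rewrite -{1}oa -oa' (distC a' o); apply: dist_triangle.
have ac1 : d a c <= b o h P + d c o by rewrite -oa (distC c o); apply: dist_triangle.
have a'c1 : d a' c <= b o h P + d c o by rewrite -oa' (distC c o); apply: dist_triangle.
have Div0 : 0 <= Div by have := dist_triangle o a c; rewrite (distC o c) oa; lra.
(* The Gromov product of [a'] and [c] at [a]: at this distance from [a], the segment towards [a']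
   passes the centre of the triangle [a], [a'], [c]. *)
pose t := (d a a' + d a c - d a' c) / 2.
have [|m [am ma']] := @geodesic_point _ _ a a' t gX.
  by have := dist_triangle a' a c; have := dist_triangle a a' c; rewrite (distC a' a) /t; lra.
have mc : d m c <= (d a c + d a' c - d a a') / 2 + 2 * delta.
  have := fp m a c a'; rewrite (distC m a) (distC c a').
  by rewrite /t in am ma'; case=> ?; lra.
have far_a : D + 6 * delta < d a m by rewrite /t in am; lrad.
have far_a' : D + 6 * delta < d a' m by rewrite (distC a'); rewrite /t in am ma'; lrad.
have far_c : D + 6 * delta < d c m.
  by rewrite (distC c); have := dist_triangle m a c; rewrite /t in am ma'; lrad.
have small y : y \in A -> d m (act y m) <= 100 * delta.
  move=> yA; have [com1 com2] := comA y yA; have [D1 D2] := D_ge y yA.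
  have comP : commute y (h ^+ P)%g by rewrite /P expgnA; apply: commuteX.
  have comP' : commute y (h^-1 ^+ P)%g by rewrite expVgn; apply: commuteV.
  have comc : (y * (s * h ^+ P) = s * h ^+ P * s^-1 * (y * s))%g.
    have : commute y ((h ^+ P) ^ s^-1)%g.
      rewrite /P expgnA conjXg; apply: commuteX.
      by rewrite conjgE invgK mulgA.
    rewrite conjgE invgK /commute !mulgA => e.
    by rewrite -e mulgVK.
  have da : d a (act y a) <= D by rewrite /a -actM // comP actM // dist_act.
  have da' : d a' (act y a') <= D by rewrite /a' -actM // comP' actM // dist_act.
  have dc : d c (act y c) <= D.
    rewrite /c -[act y _]actM // comc.
    have -> : (s * h ^+ P * s^-1 * (y * s) = (s * h ^+ P) * (s^-1 * y * s))%g by rewrite !mulgA.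
    by rewrite (actM isom (s * h ^+ P)%g) dist_act // -(mulgA (s^-1)%g)
      (actM isom (s^-1)%g) (dist_actr isom) invgK (actM isom y).
  have mv p q : between (2 * delta) p q m -> d p (act y p) <= D -> d q (act y q) <= D ->
      D + 6 * delta < d p m -> D + 6 * delta < d q m -> between (6 * delta) p q (act y m).
    move=> bt Dp Dq pm qm.
    have bt1 : between (2 * delta) (act y p) (act y q) (act y m) by rewrite /between !dist_act.
    have bt2 : between (2 * delta + 2 * delta) p (act y q) (act y m).
      by apply: (between_move fp bt1 Dp); rewrite dist_act //; lrad.
    have -> : 6 * delta = 2 * delta + 2 * delta + 2 * delta by lra.
    apply: between_sym; apply: (between_move fp (between_sym bt2) Dq).
    by rewrite dist_act //; lrad.
  have aa'm : between (2 * delta) a a' m by rewrite /between; lrad.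
  have acm : between (2 * delta) a c m by rewrite /between; rewrite /t in am ma'; lra.
  have a'cm : between (2 * delta) a' c m.
    by rewrite /between (distC a' m); rewrite /t in am ma'; lra.
  have := mv _ _ aa'm da da' far_a far_a'; have := mv _ _ acm da dc far_a far_c.
  have := mv _ _ a'cm da' dc far_a' far_c.
  rewrite /between => e1 e2 e3.
  have e0 : `|d a m - d a (act y m)| <= 6 * delta.
    have := dist_triangle (act y m) a a'; have := dist_triangle (act y m) a c.
    have := dist_triangle (act y m) a' c; rewrite (distC a' (act y m)) in e1 *.
    by rewrite ler_norml am /t; lrad.
  have aa'm6 : between (6 * delta) a a' m by rewrite /between; lrad.
  by apply: le_trans (between_close fp aa'm6 e3 e0) _; lrad.
(* Elements of [A] commute with the powers of [h^k], so they move a far translate of [m] exactly as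
   little as [m], and acylindricity applies to these two points. *)
have [n1 n1_ge] := orb_unbounded (R0 + 2 * d o m) gh k0.
pose P1 := (k * n1)%N; have bP1 := n1_ge n1 (leqnn _); rewrite -/P1 in bP1.
apply: (acyl.2 m (act (h ^+ P1)%g m)).
  have := dist_triangle m o (act (h ^+ P1)%g o).
  have := dist_triangle (act (h ^+ P1)%g m) m (act (h ^+ P1)%g o).
  by rewrite dist_act // -/(b o h P1) (distC m o); lra.
move=> y yA; split; first exact: small.
have comP : commute y (h ^+ P1)%g.
  by rewrite /P1 expgnA; apply: commuteX; have [] := comA y yA.
by rewrite -[act y (act _ _)]actM // comP actM // dist_act //; apply: small.
Qed.

End Independent_elements.

(** * Limit points and non-elementary actions *)

Lemma gromov_product_base (R : realType) (X : metricType R) (o o' x y : X) :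
  gromov_product o x y <= gromov_product o' x y + dist o o'.
Proof.
rewrite !gromov_productE; have := dist_triangle o' x o; have := dist_triangle o' y o.
by rewrite (distC o' o); lra.
Qed.

Section Ends.
Variables (R : realType) (X : metricType R) (delta : R).
Hypothesis fp : four_point X delta.
Implicit Types (u v w : nat -> X) (o : X).

(** [same_end] tested at one base point; a change of base point alters Gromov products by a bounded
    amount. *)
Definition diverges o u v := forall W : R, exists N, forall n m, (N <= n)%N ->
  (N <= m)%N -> W <= gromov_product o (u n) (v m).

Lemma same_endP o u v : same_end u v <-> diverges o u v.
Proof.
split=> [+ W|uv o'].
  move=> /(_ o)/cvgryPge/(_ W)[[P Q] [[N _ NP] [M _ MQ]] PQ].
  exists (maxn N M) => n m; rewrite !geq_max => /andP[Nn _] /andP[_ Mm].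
  by apply: (PQ (n, m)); split; [apply: NP | apply: MQ].
apply/cvgryPge => W; have [N NW] := uv (W + dist o o').
exists ([set n | (N <= n)%N], [set n | (N <= n)%N]).
  by split; exists N.
move=> [n m] [/= Nn Nm]; have := NW _ _ Nn Nm.
by have := gromov_product_base o o' (u n) (v m); lra.
Qed.

Lemma diverges_sym o u v : diverges o u v -> diverges o v u.
Proof.
by move=> uv W; have [N NW] := uv W; exists N => n m Nn Nm; rewrite gromov_productC NW.
Qed.

Lemma diverges_trans o u v w : diverges o u v -> diverges o v w -> diverges o u w.
Proof.
move=> uv vw W; have [N NW] := uv (W + delta); have [M MW] := vw (W + delta).
exists (maxn N M) => n m; rewrite !geq_max => /andP[Nn Mn] /andP[Nm Mm].
have := NW n (maxn N M) Nn (leq_maxl _ _); have := MW (maxn N M) m (leq_maxr _ _) Mm.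
rewrite !gromov_productE.
by have := fp (u n) (v (maxn N M)) (w m) o; case=> ?; lra.
Qed.

Lemma end_of_eq o u v : diverges o u v -> end_of u = end_of v.
Proof.
move=> uv; apply/seteqP; split=> w [cw /(same_endP o) H]; split=> //; apply/(same_endP o).
  exact: diverges_trans (diverges_sym uv) H.
exact: diverges_trans uv H.
Qed.

End Ends.

Lemma word_ball_ind (G : groupType) (S : {fset G}) (P : G -> Prop) n g : P 1%g ->
  (forall x y, P x -> y \in S -> P (x * y)%g) -> g \in word_ball S n -> P g.
Proof.
move=> P1 PM; elim: n g => [|n IH] g; first by rewrite inE => /eqP ->.
rewrite /word_ball iterS -/(word_ball S n) in_fsetU => /orP[/IH //|].
by move=> /imfset2P[x xB [y yS ->]]; apply: PM => //; apply: IH.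
Qed.

Section Non_elementary.
Variables (R : realType) (X : metricType R) (G : groupType) (act : G -> X -> X).
Variables (delta R0 : R) (N0 : nat).
Hypotheses (isom : isometric_action act) (fp : four_point X delta).
Hypotheses (gX : geodesic_space X) (delta_ge1 : 1 <= delta).
Local Ltac lrad := have := delta_ge1; lra.
Local Notation d := (@dist R X).
Local Notation b := (orb act).
Implicit Types (g h y s : G) (o x z : X).

Definition inverts_or_commutes (a g : G) := (g * a = a * g)%g \/ (a * g * a = g)%g.

Lemma inverts_or_commutesM a g g' : inverts_or_commutes a g ->
  inverts_or_commutes a g' -> inverts_or_commutes a (g * g')%g.
Proof.
move=> [e1|e1] [e2|e2].
- by left; rewrite -mulgA e2 !mulgA e1.
- by right; rewrite mulgA -e1 -!mulgA [(a * (g' * a))%g]mulgA e2.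
- by right; rewrite -!mulgA e2 !mulgA e1.
by left; rewrite -{1}e1 -!mulgA [(a * (g' * a))%g]mulgA e2.
Qed.

Lemma inverts_or_commutesX a g n : inverts_or_commutes a g ->
  (forall m, g * (a ^+ n) ^+ m = (a ^+ n) ^+ m * g)%g \/
  (forall m, g * (a ^+ n) ^+ m = (a ^+ n) ^- m * g)%g.
Proof.
case=> e; [left|right] => m; rewrite -expgnA.
  by apply: commuteX; exact: e.
have ga : (g * a = a^-1 * g)%g by apply: (mulgI a); rewrite mulgA e mulVKg.
elim: (n * m)%N => [|i IH]; first by rewrite !expg0 invg1 mulg1 mul1g.
by rewrite {1}expgSr mulgA IH -mulgA ga expgS invgM mulgA.
Qed.

(** Up to an exchange, [g] moves the far points [h^P o] and [h^-P o] by no more than it moves [o].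
    As [P] is large, [g o] lies near a geodesic between them, hence near a point [h^i o], within a
    bound independent of [g]. *)
Lemma orb_near_axis o h k g : good act delta o h -> (0 < k)%N ->
  inverts_or_commutes (h ^+ k)%g g ->
  exists e i, d (act g o) (act (sg e h ^+ i)%g o) <= 2 * b o h 1 + 10 * delta.
Proof.
move=> gh k0 ghk; pose D := d o (act g o).
have b1 := orb_ge0 act o h 1.
have [n0 n0_ge] := orb_unbounded isom fp delta_ge1 (D + b o h 1 + 5 * delta) gh k0.
pose P := (k * n0)%N; have bP := n0_ge n0 (leqnn _); rewrite -/P in bP.
pose a := act (h ^+ P)%g o; pose a' := act (h^-1 ^+ P)%g o.
have oa : d a o = b o h P by rewrite distC.
have oa' : d a' o = b o h P by rewrite distC; apply: orbV.
have [a1 [a2 [a1D a2D ga1 ga2 ga12]]] : exists a1 a2, [/\ d a a1 <= D, d a' a2 <= D,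
    d a1 (act g o) = b o h P, d a2 (act g o) = b o h P & d a1 a2 = d a a'].
  case: (inverts_or_commutesX 1 ghk) => /(_ n0) E; rewrite expg1 -expgnA -/P in E.
    exists (act g a), (act g a'); split; rewrite ?dist_act //.
      by rewrite /a -[act g _]actM // E actM // dist_act.
    have EV : (g * h^-1 ^+ P = h^-1 ^+ P * g)%g by rewrite expVgn; apply: commuteV.
    by rewrite /a' -[act g _]actM // EV actM // dist_act.
  exists (act g a'), (act g a); split; rewrite ?dist_act //; last exact: distC.
    have EV : (g * h^-1 ^+ P = h ^+ P * g)%g.
      apply: (mulIg (h ^+ P)%g); rewrite expVgn mulgVK -mulgA E mulVKg //.
    by rewrite /a /a' -[act g _]actM // EV actM // dist_act.
  by rewrite /a /a' -[act g _]actM // E expVgn actM // dist_act.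
have aa' : 2 * b o h P - b o h 1 <= d a a'.
  have := good_gromov_product isom fp delta_ge1 P P gh.
  by rewrite -/a -/a' gromov_productE oa oa'; lra.
have bt : between (b o h 1) a1 a2 (act g o).
  by rewrite /between (distC _ a2) ga1 ga2 ga12; lra.
have bt1 : between (b o h 1 + 2 * delta) a a2 (act g o).
  by apply: (between_move fp bt a1D); lrad.
have bt2 : between (b o h 1 + 4 * delta) a' a (act g o).
  have -> : b o h 1 + 4 * delta = b o h 1 + 2 * delta + 2 * delta by lra.
  by apply: (between_move fp (between_sym bt1) a2D); lrad.
pose q j := act (h^-1 ^+ P * h ^+ j)%g o.
have a'q j : d a' (q j) = b o h j by rewrite /a' /q actM // dist_act.
have qP2 : q (P + P)%N = a by rewrite /q expgnDr expVgn mulKg.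
have qa j : (j <= P + P)%N -> d (q j) a = b o h (P + P - j).
  move=> jP; have := dist_orb isom o h j (P + P - j); rewrite subnKC // => <-.
  by rewrite -qP2 /q !(actM isom) dist_act.
(* A discrete intermediate value argument: the sequence [b o h] increases by at most [b o h 1] at
   each step. *)
have [j [jP bj]] : exists j, (j <= P + P)%N /\
    `|d a' (act g o) - b o h j| <= b o h 1 + 4 * delta.
  have x_le : d a' (act g o) <= b o h (P + P) + b o h 1 + 4 * delta.
    have <- : d a' a = b o h (P + P) by rewrite -qP2 a'q.
    by move: bt2; rewrite /between; have := dist_ge0 (act g o) a; lra.
  have x_ge := dist_ge0 a' (act g o).
  elim: (P + P)%N x_le => [|i IH] x_le.
    by exists 0%N; split => //; rewrite ler_norml orb0 // in x_le *; lrad.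
  case: (lerP (d a' (act g o)) (b o h i + b o h 1 + 4 * delta)) => xi.
    by have [j [ji bj]] := IH xi; exists j; split => //; apply: leqW.
  exists i.+1; split => //; rewrite ler_norml.
  by have := orbD isom o h i 1; rewrite addn1; lrad.
have btq : between (b o h 1 + 4 * delta) a' a (q j).
  rewrite /between a'q qa //.
  have <- : b o h (P + P) = d a' a by rewrite -qP2 a'q.
  by have := orb_product isom fp delta_ge1 j (P + P - j) gh; rewrite subnKC //; lrad.
have gq : d (act g o) (q j) <= 2 * b o h 1 + 10 * delta.
  by apply: le_trans (between_close fp bt2 btq _) _; [rewrite a'q; exact: bj | lrad].
case: (leqP P j) => Pj.
  exists false, (j - P)%N; rewrite /=.
  by have <- : (h^-1 ^+ P * h ^+ j = h ^+ (j - P))%g by rewrite -{1}(subnKC Pj) expgnDr expVgn mulKg.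
exists true, (P - j)%N; rewrite /=.
have <- : (h^-1 ^+ P * h ^+ j = h^-1 ^+ (P - j))%g; last by [].
by rewrite -{1}(subnK (ltnW Pj)) expgnDr (expVgn _ j) mulgVK.
Qed.

Lemma ray_product o h i m (W : R) : good act delta o h -> W <= b o h i -> W <= b o h m ->
  W - b o h 1 / 2 <= gromov_product o (act (h ^+ i)%g o) (act (h ^+ m)%g o).
Proof.
move=> gh; wlog im : i m / (i <= m)%N => [H|].
  case: (leqP i m) => [|/ltnW] im Wi Wm; first exact: H.
  by rewrite gromov_productC; apply: H.
move=> Wi Wm; rewrite gromov_productE !(distC _ o) -!/(b o h _).
have := dist_orb isom o h i (m - i); rewrite subnKC // => ->.
by have := orb_product isom fp delta_ge1 i (m - i) gh; rewrite subnKC //; lra.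
Qed.

(** Every orbit stays near the powers of [h]. Points on opposite rays have bounded Gromov product,
    so a sequence of an orbit that converges at infinity eventually follows one ray: the ends of the
    two rays are the only limit points. *)
Lemma elementary_of_commensurated o h k : good act delta o h -> (0 < k)%N ->
  (forall g, inverts_or_commutes (h ^+ k)%g g) -> elementary act.
Proof.
move=> gh k0 ghk; pose E e := end_of (fun n => act (sg e h ^+ n)%g o).
have sub : limit_set act `<=` [set E (n == 0%N) | n in `I_2].
  move=> xi [[u cu <-] [x [gam [cw uw]]]].
  have b1 := orb_ge0 act o h 1.
  have /choice[f fP] : forall n, exists ei : bool * nat,
      d (act (gam n) o) (act (sg ei.1 h ^+ ei.2)%g o) <= 2 * b o h 1 + 10 * delta.
    by move=> n; have [e [i H]] := orb_near_axis gh k0 (ghk (gam n)); exists (e, i).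
  pose w n := act (gam n) x; pose p n := act (sg (f n).1 h ^+ (f n).2)%g o.
  pose D := d x o + (2 * b o h 1 + 10 * delta).
  have wp n : d (w n) (p n) <= D.
    apply: le_trans (dist_triangle (act (gam n) o) _ _) _.
    by rewrite dist_act // lerD2l.
  have wwpp n m : gromov_product o (w n) (w m) <= gromov_product o (p n) (p m) + 2 * D.
    have := gromov_product_move o (w n) (p n) (w m).
    have := gromov_product_move o (w m) (p m) (p n).
    rewrite (gromov_productC o (w m)) (gromov_productC o (p m)).
    by have := wp n; have := wp m; lra.
  have /(same_endP o) ww : same_end w w := cw.
  have /(same_endP o) uwd : same_end u w := uw.
  have [N NW] := ww (b o h 1 / 2 + 2 * D + 1).
  have sgn n : (N <= n)%N -> (f n).1 = (f N).1.
    move=> Nn; apply/eqP/negPn/negP => ne.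
    have := wwpp n N; have := NW n N Nn (leqnn _).
    suff : gromov_product o (p n) (p N) <= b o h 1 / 2.
      by move=> ? ? ?; have : (1 : R) <= 0 by [lra]; rewrite ler10.
    rewrite /p; case: (f n) (f N) ne => [[] i] [[] j] //= _.
      by rewrite gromov_productC; apply: good_gromov_product.
    exact: good_gromov_product.
  suff -> : end_of u = E (f N).1.
    by case: (f N).1; [exists 0%N | exists 1%N].
  apply: (end_of_eq (delta := delta) fp (o := o)); apply: diverges_trans uwd _ => // W.
  have [N1 N1W] := ww (W + 3 * D + b o h 1 / 2).
  have [n0 n0W] := orb_unbounded isom fp delta_ge1 (W + D + b o h 1 / 2) (good_sg isom (f N).1 gh) (isT : 0 < 1)%N.
  exists (maxn N (maxn N1 n0)) => n m; rewrite !geq_max => /and3P[Nn N1n n0n] /and3P[Nm N1m n0m].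
  have := gromov_product_move o (w n) (p n) (act (sg (f N).1 h ^+ m)%g o).
  have := gromov_product_move o (act (sg (f N).1 h ^+ m)%g o) (act (sg (f N).1 h ^+ m)%g o) (w n).
  have bm := n0W m n0m; rewrite mul1n in bm.
  have bi : W + D + b o h 1 / 2 <= b o (sg (f N).1 h) (f n).2.
    have := N1W n n N1n N1n; have := wwpp n n.
    suff -> : gromov_product o (p n) (p n) = b o (sg (f N).1 h) (f n).2 by lra.
    by rewrite gromov_productE distxx (distC _ o) /p (sgn n Nn) -/(b _ _ _); lra.
  have := ray_product (good_sg isom (f N).1 gh) bi bm.
  rewrite orb_sg // /p (sgn n Nn).
  have := gromov_product_move o (act (sg (f N).1 h ^+ (f n).2)%g o) (w n) (act (sg (f N).1 h ^+ m)%g o).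
  by have := wp n; rewrite /p (sgn n Nn) (distC (act _ o) (w n)); lra.
rewrite /elementary; apply: card_le_trans (subset_card_le sub) _.
exact: card_image_le.
Qed.

(** If no generator were independent, each would commute with or invert some [h^j], [j <= N0], hence
    also [h^(N0!)]. This property is closed under products, so it would hold on all of [G]. *)
Lemma exists_independent o h (S : {fset G}) : ~ elementary act -> generating_set S ->
  good act delta o h -> exists2 s, s \in S & independent N0 h s.
Proof.
move=> nel [_ genS] gh; apply: contrapT => none; apply: nel.
apply: (elementary_of_commensurated gh (fact_gt0 N0)) => g.
have [n gB] := genS g; apply: (word_ball_ind _ _ gB).
  by left; rewrite mul1g mulg1.
move=> x s Hx sS; apply: inverts_or_commutesM => //.
have : ~ independent N0 h s by move=> ind; apply: none; exists s.
move=> /existsNP[j] /not_implyP[/andP[j0 jN]] /not_andP; rewrite !not_notE.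
have /dvdnP[q ->] : (j %| N0`!)%N by rewrite dvdn_fact // j0.
rewrite mulnC => H.
have : inverts_or_commutes (h ^+ j)%g s by case: H; [left | right].
case=> e; [left|right].
  by rewrite expgnA; apply: commuteX.
have sa : (s * h ^+ j = h ^- j * s)%g by apply: (mulgI (h ^+ j)%g); rewrite mulgA e mulVKg.
rewrite expgnA; elim: q => [|i IH]; first by rewrite expg0 mul1g mulg1.
by rewrite {1}expgSr expgS -!mulgA [(s * _)%g]mulgA sa -!mulgA mulVKg mulgA.
Qed.

End Non_elementary.

(** * Word balls *)

Section Word_balls.
Variable G : groupType.
Implicit Types (S : {fset G}) (x y g : G).

Lemma word_ball0 S x : (x \in word_ball S 0) = (x == 1%g).
Proof. by rewrite inE. Qed.

Lemma word_ballS S n x : reflect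
  (x \in word_ball S n \/ exists y z, [/\ y \in word_ball S n, z \in S & x = (y * z)%g])
  (x \in word_ball S n.+1).
Proof.
rewrite /word_ball iterS -/(word_ball S n) in_fsetU; apply: (iffP orP) => -[H|H]; [by left| |by left|].
  by right; move: H => /imfset2P[y yB [z zS ->]]; exists y, z.
by right; have [y [z [yB zS ->]]] := H; apply: in_imfset2.
Qed.

Lemma word_ball_subS S n x : x \in word_ball S n -> x \in word_ball S n.+1.
Proof. by move=> xn; apply/word_ballS; left. Qed.

Lemma word_ball_mono S m n x : (m <= n)%N -> x \in word_ball S m -> x \in word_ball S n.
Proof.
move=> /subnK <-; elim: (n - m)%N => [//|k IH] xm.
by rewrite addSn; apply/word_ball_subS/IH.
Qed.

Lemma word_ball1 S n : 1%g \in word_ball S n.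
Proof. by apply: (@word_ball_mono S 0); rewrite ?word_ball0. Qed.

Lemma word_ballM S m n x y : x \in word_ball S m -> y \in word_ball S n ->
  (x * y)%g \in word_ball S (m + n).
Proof.
move=> xm; elim: n y => [|n IH] y.
  by rewrite word_ball0 addn0 => /eqP ->; rewrite mulg1.
move=> /word_ballS[yn|[z [s [zn sS ->]]]]; rewrite addnS.
  exact/word_ball_subS/IH.
by apply/word_ballS; right; exists (x * z)%g, s; rewrite IH // mulgA.
Qed.

Lemma word_ball_gen S x : x \in S -> x \in word_ball S 1.
Proof.
by move=> xS; apply/word_ballS; right; exists 1%g, x; rewrite word_ball1 mul1g.
Qed.

Lemma word_ballX S m n x : x \in word_ball S m -> (x ^+ n)%g \in word_ball S (m * n).
Proof.
move=> xm; elim: n => [|n IH]; first by rewrite expg0 word_ball1.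
by rewrite expgS mulnS; apply: word_ballM.
Qed.

Lemma word_ballV S m x : generating_set S -> x \in word_ball S m -> (x^-1)%g \in word_ball S m.
Proof.
move=> [symS _]; elim: m x => [|m IH] x.
  by rewrite !word_ball0 => /eqP ->; rewrite invg1.
move=> /word_ballS[/IH/word_ball_subS //|[y [s [ym sS ->]]]].
rewrite invgM -add1n; apply: word_ballM (IH _ ym).
exact/word_ball_gen/symS.
Qed.

End Word_balls.

Lemma dist_word_ball (R : realType) (X : metricType R) (G : groupType) (act : G -> X -> X)
    (S : {fset G}) n g (o : X) (L : R) : isometric_action act ->
  (forall s, s \in S -> dist o (act s o) <= L) -> 0 <= L -> g \in word_ball S n ->
  dist o (act g o) <= n%:R * L.
Proof.
move=> isom oS L0; elim: n g => [|n IH] g.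
  by rewrite word_ball0 => /eqP ->; rewrite act1 // distxx mul0r.
move=> /word_ballS[/IH gn|[y [s [/IH yn sS ->]]]].
  by apply: le_trans gn _; rewrite ler_wpM2r // ler_nat.
rewrite -natr1 mulrDl mul1r; apply: le_trans (dist_triangle (act y o) _ _) _.
by apply: lerD yn _; rewrite actM // dist_act //; apply: oS.
Qed.

(** * Uniform lower bound on translation lengths *)

Lemma exp2_beats_linear (R : realType) (C x : R) : 0 < C ->
  exists i0, forall i, (i0 <= i)%N -> x * i.+1%:R < C * (2 ^ i)%:R.
Proof.
move=> C0; exists (Num.bound (4 * `|x| / C)) => i i0.
have sq : (i.+1 ^ 2 <= 4 * 2 ^ i)%N.
  elim: i {i0} => [//|[//|i] IH]; rewrite expnS.
  by move: IH; rewrite !expnS !expn0; nia.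
have xi : 4 * `|x| < C * i.+1%:R.
  rewrite [C * _]mulrC -ltr_pdivrMr //.
  have := archi_boundP (divr_ge0 (mulr_ge0 (ler0n R 4) (normr_ge0 x)) (ltW C0)).
  by move=> /lt_le_trans; apply; rewrite ler_nat leqW.
have : C * i.+1%:R * i.+1%:R <= C * (4 * (2 ^ i)%:R).
  by rewrite -mulrA ler_pM2l // -!natrM ler_nat -mulnn in sq *.
have : 4 * `|x| * i.+1%:R < C * i.+1%:R * i.+1%:R by rewrite ltr_pM2r.
have : x * i.+1%:R <= `|x| * i.+1%:R by rewrite ler_wpM2r // ler_norm.
by lra.
Qed.

Lemma exists_min_le (R : realType) (a : nat -> R) m n : (m <= n)%N ->
  exists2 q, (m <= q <= n)%N & forall i, (m <= i <= n)%N -> a q <= a i.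
Proof.
move=> /subnK <-; elim: (n - m)%N => [|k [q /andP[mq qk] qmin]].
  by exists m; rewrite ?leqnn // => i; rewrite add0n -eqn_leq => /eqP ->.
case: (lerP (a q) (a (k.+1 + m)%N)) => aq.
  exists q; first by rewrite mq addSn leqW.
  move=> i /andP[mi]; rewrite leq_eqVlt => /predU1P[-> //|ik].
  by apply: qmin; rewrite mi -ltnS -addSn.
exists (k.+1 + m)%N; first by rewrite leqnn leq_addl.
move=> i /andP[mi]; rewrite leq_eqVlt => /predU1P[-> //|ik].
by apply: le_trans (ltW aq) _; apply: qmin; rewrite mi -ltnS -addSn.
Qed.

Section Translation_length.
Variables (R : realType) (X : metricType R) (G : groupType) (act : G -> X -> X).
Variables (delta R0 : R) (N0 : nat).
Hypotheses (isom : isometric_action act) (fp : four_point X delta).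
Hypotheses (gX : geodesic_space X) (delta_ge1 : 1 <= delta).
Local Ltac lrad := have := delta_ge1; lra.
Local Notation d := (@dist R X).
Local Notation b := (orb act).
Implicit Types (g h y s : G) (o x z : X).
Hypothesis acyl : acylindrical_at act R0 N0 (100 * delta).

Lemma hyperbolic_orb o g : hyperbolic_isometry (act g) ->
  exists C c : R, 0 < C /\ forall n, C * n%:R - c <= b o g n.
Proof.
move=> [x [C C0 H]]; exists C, (2 * d o x); split=> // n.
have iterE m : iter m (act g) x = act (g ^+ m)%g x.
  by elim: m => [|m IH]; rewrite ?act1 // iterS IH expgS actM.
have Hn : C * n%:R <= d x (act (g ^+ n)%g x).
  case: n => [|n]; first by rewrite mulr0 dist_ge0.
  by apply/ltW; rewrite -iterE; apply: H.
have := dist_triangle o x (act (g ^+ n)%g x).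
have := dist_triangle (act (g ^+ n)%g o) o (act (g ^+ n)%g x).
by rewrite dist_act // (distC x o) -/(b o g n); lra.
Qed.

Lemma orb_incr_nat o h n m : good act delta o h -> b o h n + m%:R <= b o h (n + m).
Proof.
move=> gh; elim: m => [|m IH]; first by rewrite addn0 addr0.
rewrite addnS -natr1; have := orb_incr isom fp delta_ge1 (n + m) gh.
by move: gh; rewrite /good; lrad.
Qed.

(* Some dyadic power of a hyperbolic isometry is good at [o], so its orbit
   grows uniformly. *)
Lemma hyperbolic_orb_growth o g (W : R) : hyperbolic_isometry (act g) ->
  exists m0, forall n m, (m0 <= m)%N -> b o g n + W <= b o g (n + m).
Proof.
move=> hg; have [C [c [C0 Cc]]] := hyperbolic_orb o hg.
have [i gi] : exists i, good act delta o (g ^+ (2 ^ i))%g.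
  apply: contrapT => /forallNP bad.
  have up i : b o g (2 ^ i) <= b o g 1 + 1000 * delta * i%:R.
    elim: i => [|i IH]; first by rewrite mulr0 addr0.
    have := bad i; rewrite /good !orb_exp muln1 mulnC -expnS => /negP.
    by rewrite -ltNge -natr1; lra.
  have [i0 H] := exp2_beats_linear (`|b o g 1| + `|c| + 1000 * delta) C0.
  have := H i0 (leqnn _); have := up i0; have := Cc (2 ^ i0)%N; rewrite -natr1.
  have : 0 <= (`|b o g 1| + `|c|) * i0%:R by rewrite mulr_ge0 // addr_ge0.
  have := ler_norm (b o g 1); have := ler_norm c.
  move=> ? ? ? ? ? ?; have : (1 : R) <= 0 by [lrad]; by rewrite ler10.
pose P := (2 ^ i)%N; have P0 : (0 < P)%N by rewrite expn_gt0.
have b1 := orb_ge0 act o g 1.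
have rem n : (n %% P)%N%:R * b o g 1 <= P%:R * b o g 1.
  by rewrite ler_wpM2r // ler_nat ltnW // ltn_mod.
have up n : b o g n <= b o (g ^+ P)%g (n %/ P) + P%:R * b o g 1.
  rewrite {1}(divn_eq n P) orb_exp // (mulnC P); apply: le_trans (orbD isom _ _ _ _) _.
  by rewrite lerD2l; apply: le_trans (orb_le_mul isom _ _ _) (rem n).
have low n : b o (g ^+ P)%g (n %/ P) - P%:R * b o g 1 <= b o g n.
  rewrite {2}(divn_eq n P) orb_exp // (mulnC P).
  have := dist_triangle (act (g ^+ (n %/ P * P + n %% P))%g o) o (act (g ^+ (n %/ P * P))%g o).
  rewrite (distC (act _ o) (act (g ^+ (n %/ P * P))%g o)) dist_orb //.
  by have := rem n; have := orb_le_mul isom o g (n %% P); rewrite -!/(b o g _); lra.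
pose K := Num.bound (`|W| + 2 * P%:R * b o g 1).
have K_ge : W + 2 * P%:R * b o g 1 <= K%:R.
  apply: le_trans (ltW (archi_boundP _)).
    by rewrite lerD2r ler_norm.
  by rewrite addr_ge0 // !mulr_ge0.
exists (K * P)%N => n m m0.
have KP : (n %/ P + K <= (n + m) %/ P)%N.
  by rewrite addnC -divnMDl // leq_div2r // addnC leq_add2l.
have := up n; have := low (n + m)%N.
have := orb_incr_nat (n %/ P) ((n + m) %/ P - n %/ P) gi.
rewrite subnKC; last exact: leq_trans (leq_addr _ _) KP.
have : K%:R <= ((n + m) %/ P - n %/ P)%N%:R :> R by rewrite ler_nat leq_subRL // (leq_trans (leq_addr _ _) KP).
by rewrite -!/P; lra.
Qed.

(* Bowditch's uniform lower bound on translation lengths. *)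
Lemma uniform_good_power (A : R) : exists j0, forall o g, hyperbolic_isometry (act g) ->
  d o (act g o) <= A -> exists2 i, (i < j0)%N & good act delta o (g ^+ (2 ^ i))%g.
Proof.
have [j0 j0P] := exp2_beats_linear (N0%:R * (`|A| + 1000 * delta)) (ltr01 : 0 < (1 : R)).
exists j0 => o g hg gA; apply: contrapT => bad.
(* Without a good dyadic power, each doubling of the exponent adds at most [1000 * delta] to the
   displacement, which is thus at most linear in [i]; [j0] makes [2^j0] exceed [N0] times this
   bound. *)
have small : N0%:R * b o g (2 ^ j0) < (2 ^ j0)%:R.
  have up i : (i <= j0)%N -> b o g (2 ^ i) <= A + 1000 * delta * i%:R.
    elim: i => [|i IH] ij; first by rewrite mulr0 addr0.
    have nb : ~ good act delta o (g ^+ (2 ^ i))%g by move=> gi; apply: bad; exists i.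
    move/negP: nb; rewrite /good !orb_exp muln1 mulnC -expnS -ltNge -natr1.
    by have := IH (ltnW ij); lra.
  have := j0P j0 (leqnn _); rewrite mul1r; apply: le_lt_trans.
  rewrite -mulrA ler_wpM2l //; apply: le_trans (up _ (leqnn _)) _.
  rewrite -(natr1 j0) mulrDr mulr1; have := ler_norm A.
  have : 0 <= `|A| * j0%:R by rewrite mulr_ge0.
  by lrad.
set q := (2 ^ j0)%N in small.
have [m0 grow] := hyperbolic_orb_growth o (2 * delta) hg.
(* Far out, the increment of the sequence over [i] steps does not shrink, up to [2 * delta], when
   the starting index grows. *)
have super m n i : (m0 <= m)%N -> b o g (m + i) - b o g m - 2 * delta <= b o g (n + m + i) - b o g (n + m).
  move=> mm; have := orb_four_point isom fp o g n m i.
  have := grow n m mm; have := grow i m mm; rewrite (addnC i).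
  by move=> ? ?; case=> ?; lrad.
(* An increment above [1 + 2 * delta] over [i] steps would accumulate to at least [q] over [q * i]
   steps, against [small]. *)
have upper m i : (m0 <= m)%N -> (i <= N0)%N -> b o g (m + i) - b o g m <= 1 + 2 * delta.
  move=> mm iN; rewrite leNgt; apply/negP => big.
  have lin j : b o g m + j%:R <= b o g (m + j * i).
    elim: j => [|j IH]; first by rewrite mul0n addn0 addr0.
    have := super m (j * i)%N i mm.
    have -> : (j * i + m + i = m + j.+1 * i)%N by rewrite mulSn; lia.
    by rewrite (addnC (j * i)%N m) -(natr1 j); lra.
  have := lin q; have := orbD isom o g m (q * i).
  have := orb_le_mul isom o (g ^+ q)%g i; rewrite !orb_exp // muln1.
  have : i%:R * b o g q <= N0%:R * b o g q by rewrite ler_wpM2r ?orb_ge0 // ler_nat.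
  by lra.
have b1 := orb_ge0 act o g 1.
pose c1 := N0%:R * b o g 1.
have c10 : 0 <= c1 by rewrite mulr_ge0.
have [m1 far] := hyperbolic_orb_growth o (2 * c1 + R0 + 10 * delta) hg.
(* A minimum over its own tail, so that the shifts [sig] below are nonnegative. *)
have [Q [Qm0 Qm1 Qmin]] : exists Q, [/\ (m0 <= Q)%N, (m1 <= Q)%N & forall n, (Q <= n)%N -> b o g Q <= b o g n].
  pose m2 := (maxn m0 m1).+1.
  have m20 : (m0 <= m2)%N by rewrite leqW // leq_maxl.
  have m21 : (m1 <= m2)%N by rewrite leqW // leq_maxr.
  have [Q /andP[Q1 Q2] Qm] := exists_min_le (b o g) (leq_addr m2 m2).
  exists Q; split; [exact: leq_trans Q1 | exact: leq_trans Q1 |].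
  move=> n Qn; have nm : (m2 <= n)%N := leq_trans Q1 Qn.
  elim/ltn_ind: n nm {Qn} => n IH nm; case: (leqP n (m2 + m2)) => [nm2|nm2].
    by apply: Qm; rewrite nm.
  have nk : (n - m2 < n)%N by rewrite ltn_subrL /= (leq_ltn_trans _ nm2).
  have nk' : (m2 <= n - m2)%N by rewrite leq_subRL // ltnW.
  by have := IH _ nk nk'; have := grow (n - m2)%N m2 m20; rewrite subnK //; lrad.
have bQ : 2 * c1 + R0 + 10 * delta <= b o g Q.
  by have := far 0%N Q Qm1; rewrite add0n orb0 // add0r.
have R0_ge0 := acyl.1.
have seg t : 0 <= t <= b o g Q -> exists x, on_segment act o g Q t x.
  exact: segment_point.
have moves t x i : c1 <= t <= c1 + R0 -> on_segment act o g Q t x -> (i <= N0)%N ->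
    d x (act (g ^+ i)%g x) <= 100 * delta.
  move=> tI sx iN; have u := upper Q i Qm0 iN; have l := Qmin (Q + i)%N (leq_addr _ _).
  pose sig := b o g (Q + i) - b o g Q; have sigE : sig = b o g (Q + i) - b o g Q by [].
  have bi : b o g i <= c1.
    by apply: le_trans (orb_le_mul isom _ _ _) _; rewrite ler_wpM2r // ler_nat.
  have [|y sy] := seg (t + sig); first by lrad.
  have xy : d (act (g ^+ i)%g x) y <= 6 * delta.
    by apply: (segment_translate isom fp delta_ge1 sx sy); lrad.
  have [[ox xA] [oy yA]] := (sx, sy).
  have xy' : d x y <= sig + 0 + 2 * delta.
    apply: (@between_close _ _ _ fp _ _ o (act (g ^+ Q)%g o)); rewrite /between.
    - by rewrite ox xA -/(b o g Q); lra.
    - by rewrite oy yA -/(b o g Q); lra.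
    - by rewrite ox oy ler_norml; lra.
  have := dist_triangle y x (act (g ^+ i)%g x); rewrite (distC y (act _ x)).
  by lrad.
have [|x sx] := seg c1; first by lrad.
have [|x' sx'] := seg (c1 + R0); first by lrad.
have xx' : R0 <= d x x'.
  by have := segment_dist sx sx'; rewrite distrC ger0_norm; lra.
(* The powers [g^0, ..., g^N0] move two far points little, so two of them coincide; then [g] has
   finite order, against the growth of its orbit. *)
have [i|i [j [ij jN eij]]] := acyl_pigeonhole acyl (w := fun i => (g ^+ i)%g) xx'.
  by move=> iN; split; [apply: (moves c1) | apply: (moves (c1 + R0))] => //; lra.
have g1 : (g ^+ (j - i) = 1)%g.
  by apply: (mulgI (g ^+ i)%g); rewrite -expgnDr subnKC ?mulg1 // ltnW.
have := grow 0%N ((j - i) * m0)%N; rewrite add0n orb0 //.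
rewrite -orb_exp g1 /orb expg1n act1 // distxx.
have -> : (m0 <= (j - i) * m0)%N by rewrite leq_pmull // subn_gt0.
by move=> /(_ isT) ?; have : (1 : R) <= 0 by [lrad]; rewrite ler10.
Qed.

End Translation_length.

(** * Good elements of bounded length at the scale of a generating set *)

Lemma seq_argmax (R : realType) (T : eqType) (f : T -> R) (s : seq T) x : x \in s ->
  exists2 y, y \in s & forall z, z \in s -> f z <= f y.
Proof.
elim: s x => [//|a [|c s] IH] x _.
  by exists a; rewrite ?mem_head // => z; rewrite inE => /eqP ->.
have [y ys ymax] := IH c (mem_head _ _).
case: (lerP (f a) (f y)) => ay.
  by exists y => [|z]; rewrite in_cons ?ys ?orbT // => /predU1P[-> //|/ymax].
exists a => [|z]; rewrite in_cons ?eqxx // => /predU1P[-> //|/ymax zy].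
exact: le_trans zy (ltW ay).
Qed.

Section Scale.
Variables (R : realType) (X : metricType R) (G : groupType) (act : G -> X -> X).
Variables (delta R0 : R) (N0 M : nat).
Hypotheses (isom : isometric_action act) (fp : four_point X delta).
Hypotheses (gX : geodesic_space X) (delta_ge1 : 1 <= delta).
Local Ltac lrad := have := delta_ge1; lra.
Local Notation d := (@dist R X).
Local Notation b := (orb act).
Implicit Types (g h s t : G) (o x z p : X) (S : {fset G}).
Hypothesis acyl : acylindrical_at act R0 N0 (100 * delta).

Lemma orb1 o g : b o g 1 = d o (act g o).
Proof. by rewrite /orb expg1. Qed.

Lemma orb2 o g : b o g 2 = d (act g o) (act (g^-1)%g o).
Proof. by rewrite (dist_actr isom) invgK -actM // -expg2 distC. Qed.

Lemma good_of_gromov_product o g : 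
  2 * gromov_product o (act g o) (act (g^-1)%g o) + 1000 * delta <= d o (act g o) ->
  good act delta o g.
Proof.
by rewrite /good orb1 orb2 gromov_productE !(distC _ o) (dist_actV isom); lra.
Qed.

(* If all the far-moving elements of [S] move [o] in the same direction, then
   moving [o] by [4 delta] in that direction decreases its displacement. *)
Lemma far_elements_diverge S o L : (forall s, s \in S -> (s^-1)%g \in S) ->
  1100 * delta <= L -> (forall s, s \in S -> d o (act s o) <= L + delta) ->
  (forall x, exists2 s, s \in S & L <= d x (act s x)) ->
  exists s t, [/\ s \in S, t \in S, L - 9 * delta <= d o (act s o),
    L - 9 * delta <= d o (act t o) & gromov_product o (act s o) (act t o) < 4 * delta].
Proof.
move=> symS L_large So dispL; apply: contrapT => none.
have same s t : s \in S -> t \in S -> L - 9 * delta <= d o (act s o) ->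
    L - 9 * delta <= d o (act t o) -> 4 * delta <= gromov_product o (act s o) (act t o).
  move=> sS tS sL tL; rewrite leNgt; apply/negP => st.
  by apply: none; exists s, t.
have [s0 s0S s0L] := dispL o.
have [|p [op ps0]] := @geodesic_point _ _ o (act s0 o) (4 * delta) gX; first by lrad.
have [s sS] := dispL p; rewrite leNgt => /negP; apply.
have := So s sS => ds.
case: (lerP (L - 9 * delta) (d o (act s o))) => sL; last first.
  have := dist_triangle o p (act s p); have := dist_triangle (act s o) o (act s p).
  by rewrite dist_act // (distC p o); lrad.
have toward t : t \in S -> L - 9 * delta <= d o (act t o) ->
    d p (act t o) <= d o (act t o) - 2 * delta.
  move=> tS tL; have st : 4 * delta <= gromov_product o (act s0 o) (act t o).
    by apply: same => //; lrad.
  rewrite gromov_productE !(distC _ o) in st.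
  by have := fp p o (act t o) (act s0 o); rewrite (distC p o) (distC (act t o)); case=> ?; lrad.
have p1 := toward s sS sL.
have p2 : d (act s p) o <= d o (act s o) - 2 * delta.
  rewrite dist_actl // -(dist_actV isom s o).
  by apply: toward; rewrite ?(dist_actV isom) //; apply: symS.
have := fp p o (act s p) (act s o).
by rewrite dist_act // (distC p o) (distC o (act s p)); case=> ?; lrad.
Qed.

(** Let [s] and [t] diverge at [o]. If both fold back, [s^-1] and [t^-1] move [o] in the directions
    of [s] and [t]; then [s^-1 t] moves it along [s^-1 o] and its inverse along [t^-1 o], and these
    directions diverge. *)
Lemma large_scale_good S o L : (forall s, s \in S -> (s^-1)%g \in S) ->
  1100 * delta <= L -> (forall s, s \in S -> d o (act s o) <= L + delta) ->
  (forall x, exists2 s, s \in S & L <= d x (act s x)) ->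
  exists h, [/\ h \in word_ball S 2, good act delta o h &
    L + delta <= 2 * (b o h 2 - b o h 1)].
Proof.
move=> symS L_large So dispL.
suff [h [hS h1 h2]] : exists h, [/\ h \in word_ball S 2, L - 9 * delta <= d o (act h o) &
    gromov_product o (act h o) (act (h^-1)%g o) <= 8 * delta].
  exists h; split=> //; first by apply: good_of_gromov_product; lrad.
  by move: h2; rewrite orb2 orb1 gromov_productE !(distC _ o) (dist_actV isom); lrad.
have [s [t [sS tS sL tL st]]] := far_elements_diverge symS L_large So dispL.
have gen1 r : r \in S -> r \in word_ball S 2 by move=> rS; apply/word_ball_subS/word_ball_gen.
case: (lerP (gromov_product o (act s o) (act (s^-1)%g o)) (8 * delta)) => ss.
  by exists s; split=> //; apply: gen1.
case: (lerP (gromov_product o (act t o) (act (t^-1)%g o)) (8 * delta)) => tt.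
  by exists t; split=> //; apply: gen1.
exists (s^-1 * t)%g; split.
- by apply: (@word_ballM _ _ 1 1); apply: word_ball_gen => //; apply: symS.
- move: st; rewrite gromov_productE !(distC _ o) actM // (dist_actr isom (s^-1)%g) invgK.
  by lrad.
have st1 : gromov_product o (act (t^-1)%g o) (act s o) <= 5 * delta.
  have -> : 5 * delta = 4 * delta + delta by lra.
  apply: (gromov_product_drop fp (x := act t o)); last by lrad.
  by rewrite gromov_productC ltW.
have st2 : gromov_product o (act (s^-1)%g o) (act (t^-1)%g o) <= 6 * delta.
  have -> : 6 * delta = 5 * delta + delta by lra.
  apply: (gromov_product_drop fp (x := act s o)); last by lrad.
  by rewrite gromov_productC.
have hst : L - 13 * delta <= gromov_product o (act (s^-1)%g o) (act (s^-1 * t)%g o).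
  move: st; rewrite !gromov_productE !(distC _ o) !actM // dist_act // (dist_actV isom).
  by rewrite (dist_actr isom (s^-1)%g) invgK; lra.
have hts : L - 13 * delta <= gromov_product o (act (t^-1)%g o) (act (s^-1 * t)^-1%g o).
  move: st; rewrite !gromov_productE !(distC _ o) invgM invgK !actM // dist_act // (dist_actV isom).
  by rewrite (dist_actr isom (t^-1)%g) invgK (distC (act t o)); lra.
have st3 : gromov_product o (act (s^-1 * t)%g o) (act (t^-1)%g o) <= 7 * delta.
  have -> : 7 * delta = 6 * delta + delta by lra.
  by apply: (gromov_product_drop fp st2); lrad.
have -> : 8 * delta = 7 * delta + delta by lra.
rewrite gromov_productC; apply: (gromov_product_drop fp (x := act (t^-1)%g o)); last by lrad.
by rewrite gromov_productC.
Qed.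

(** [L] is the infimum over [X] of the largest displacement of a point by [S], and [o] attains it up
    to [delta]. *)
Lemma near_minimal_displacement S (x0 : X) : (exists s, s \in S) ->
  exists o L, [/\ 0 <= L, forall s, s \in S -> d o (act s o) <= L + delta &
  (forall x, exists2 s, s \in S & L <= d x (act s x))].
Proof.
move=> [s0 s0S].
have /choice[f fP] : forall x, exists s, s \in S /\ forall t, t \in S -> d x (act t x) <= d x (act s x).
  by move=> x; have [s sS H] := seq_argmax (fun t => d x (act t x)) s0S; exists s.
pose disp x := d x (act (f x) x).
have dispP x : exists2 s, s \in S & disp x = d x (act s x) by exists (f x) => //; have [] := fP x.
have disp_ge x s : s \in S -> d x (act s x) <= disp x by have [_ H] := fP x; apply: H.
have hi : has_inf [set disp x | x in setT].
  split; first by exists (disp x0), x0.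
  exists 0 => _ [x _ <-]; have [s _ ->] := dispP x; exact: dist_ge0.
have [z [x1 _ zE] oL] := inf_adherent (lt_le_trans ltr01 delta_ge1) hi.
rewrite -zE in oL.
exists x1, (inf [set disp x | x in setT]); split.
- apply: lb_le_inf; first by exists (disp x0), x0.
  by move=> _ [x _ <-]; have [s _ ->] := dispP x; exact: dist_ge0.
- by move=> s sS; apply: le_trans (disp_ge _ _ sS) (ltW oL).
move=> x; have [s sS e] := dispP x; exists s => //; rewrite -e.
by apply: ge_inf; [exact: hi.2 | exists x].
Qed.

Hypothesis hypM : forall S, generating_set S ->
  exists2 g : G, g \in word_ball S M & hyperbolic_isometry (act g).

(** Two regimes. If [S] moves every point by at least [1100 * delta], its ball of radius 2 contains
    a good element at the scale of [S]. Otherwise some point is moved by at most [1101 * delta], the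
    hyperbolic element of [S^M] has bounded displacement there, and a uniformly bounded power of it
    is good. *)
Lemma uniform_scale : exists C1 : nat, forall S, generating_set S ->
  exists o L h, [/\ 0 < L, forall s, s \in S -> d o (act s o) <= L,
    h \in word_ball S C1, good act delta o h & L <= 2 * (b o h 2 - b o h 1)].
Proof.
have [j0 j0P] := uniform_good_power isom fp gX delta_ge1 acyl (M%:R * (1101 * delta)).
exists (maxn 2 (M * 2 ^ j0)) => S gS.
have [g gM hg] := hypM gS; have [x0 [C C0 gx]] := hg.
have [s0 s0S] : exists s, s \in S.
  apply: contrapT => /forallNP noS.
  have : g = 1%g by apply: (@word_ball_ind _ S (fun g => g = 1%g) M g) => // x y _ /noS.
  move=> g1; have := gx 1%N isT; rewrite /= g1 act1 // => /lt_geF.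
  by have := distxx x0; rewrite /dist => ->; rewrite mulr1 ltW.
have [x1 [L [L0 So dispL]]] := near_minimal_displacement x0 (ex_intro _ s0 s0S).
case: (lerP (1100 * delta) L) => LL.
  have [h [hB gh hL]] := large_scale_good gS.1 LL So dispL.
  exists x1, (L + delta), h; split=> //; first by lrad.
  by apply: word_ball_mono hB; rewrite leq_maxl.
have So' s : s \in S -> d x1 (act s x1) <= 1101 * delta.
  by move=> sS; have := So s sS; lrad.
have [|i ij gi] := j0P x1 g hg.
  by apply: (dist_word_ball isom So' _ gM); lrad.
exists x1, (1101 * delta), (g ^+ (2 ^ i))%g; split; [by lrad | exact: So' | | exact: gi |].
  apply: (word_ball_mono _ (word_ballX _ gM)).
  by rewrite leq_max leq_mul2l leq_exp2l // (ltnW ij) orbT orbT.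
by move: gi; rewrite /good; lrad.
Qed.

End Scale.

(** * Quasigeodesic paths with two long segments *)

Section Chain.
Variables (R : realType) (X : metricType R) (delta : R).
Hypotheses (fp : four_point X delta) (delta_ge1 : 1 <= delta).
Local Ltac lrad := have := delta_ge1; lra.
Local Notation d := (@dist R X).
Variables (o p1 p2 p2' p3 z : X) (l D B Dv : R).
Hypotheses (p12 : d p1 p2 = l) (p23 : d p2' p3 = l) (p22 : d p2 p2' <= D).
Hypotheses (g1 : gromov_product p1 o p2 <= B) (g2 : gromov_product p2 p1 p3 <= Dv).
Hypotheses (g3 : gromov_product p3 p2' z <= B).
Hypotheses (DDv : 3 * D <= Dv) (BDv : 2 * B <= Dv) (dDv : 10 * delta <= Dv).
Hypothesis (lDv : 10 * Dv <= l).

(** The point at parameter [t] of a long segment from [a] to [e] lies near a geodesic from [o] to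
    [z], at a distance from [o] that is known once that of [e] is. *)
Definition chain_spec (a e : X) (t : R) (w : X) :=
  between (4 * delta) o z w /\ d o e - l + t <= d o w <= d o e - l + t + 2 * delta.

Let p23_ge : l - D <= d p2 p3.
Proof. by have := p23; have := p22; have := dist_triangle p2 p2' p3; rewrite (distC p2' p2); lra. Qed.

(** Seen from [p2], the points [p1] and [o] lie in the same direction for almost the length [l], so
    the bound on the product of [p1] and [p3] passes to that of [o] and [p3]. The next two bounds
    continue along the path in the same way. *)
Let q2 : gromov_product p2 o p3 <= Dv + delta.
Proof.
apply: (gromov_product_drop fp (x := p1)) => //.
have := g1; have := p12; have := lDv; have := BDv; have := dDv; rewrite !gromov_productE.
have := dist_ge0 p2 p2'; have := p22; have := DDv.
by rewrite (distC p2 p1) (distC p1 o); lrad.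
Qed.

Let q3 : gromov_product p3 o z <= B + D + delta.
Proof.
apply: (gromov_product_drop fp (x := p2)).
  have := gromov_product_move p3 p2 p2' z; have := g3; have := p22; lra.
have := q2; have := p23_ge; have := lDv; have := BDv; have := dDv; have := DDv.
have := p22; have := dist_ge0 p2 p2'.
by rewrite !gromov_productE (distC p3 p2) (distC p2 o) (distC p2 p3); lrad.
Qed.

Let q2z : gromov_product p2 o z <= Dv + 2 * delta.
Proof.
have -> : Dv + 2 * delta = Dv + delta + delta by lra.
rewrite gromov_productC; apply: (gromov_product_drop fp (x := p3)).
  by rewrite gromov_productC; apply: q2.
have := g3; have := gromov_product_move p3 p2 p2' z.
have := p23_ge; have := lDv; have := BDv; have := dDv; have := DDv; have := p22.
have := dist_ge0 p2 p2'; rewrite !gromov_productE (distC p3 p2) (distC z p2) (distC z p3).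
by lrad.
Qed.

Let chain0 (a e w : X) t : d a e = l -> d a w = t -> d w e = l - t ->
  gromov_product a o e <= t -> gromov_product e o z + delta <= l - t ->
  chain_spec a e t w.
Proof.
move=> ae aw we ga ge; split.
  have -> : 4 * delta = 2 * delta + 2 * delta by lra.
  apply: between_sym; apply: (between_extend fp (b := e)); last first.
    by rewrite (distC e w) we; have := ge; lra.
  apply: between_sym; have -> : 2 * delta = 0 + 2 * delta by lra.
  apply: (between_extend fp (b := a)); first by rewrite /between; lra.
  by rewrite mul0r addr0 gromov_productC aw.
have := dist_triangle w o e.
have bt : between (0 + 2 * delta) o e w.
  apply: (between_extend fp (b := a)); first by rewrite /between; lra.
  by rewrite mul0r addr0 gromov_productC aw.
by move: bt; rewrite /between; lra.
Qed.

Lemma chain_first w t : d p1 w = t -> d w p2 = l - t -> 3 * Dv <= t <= l - 3 * Dv ->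
  chain_spec p1 p2 t w.
Proof.
move=> *; apply: chain0 => //.
  by have := g1; have := BDv; have := dDv; lrad.
by have := q2z; have := dDv; lrad.
Qed.

Lemma chain_second w t : d p2' w = t -> d w p3 = l - t -> 3 * Dv <= t <= l - 3 * Dv ->
  chain_spec p2' p3 t w.
Proof.
move=> *; apply: chain0 => //.
  have := q2; rewrite !gromov_productE.
  have := dist_triangle p2 o p2'; have := dist_triangle p2 p3 p2'; have := p22.
  by have := DDv; have := dDv; rewrite (distC p3 p2) (distC p3 p2'); lrad.
by have := q3; have := dDv; have := BDv; have := DDv; lrad.
Qed.

Lemma chain_position1 : d o p1 - 2 * B <= d o p2 - l <= d o p1.
Proof.
have := g1; rewrite gromov_productE (distC p2) p12.
by have := dist_triangle p1 o p2; rewrite p12; lra.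
Qed.

Lemma chain_position2 : d o p2 + d p2 p3 - 2 * (Dv + delta) <= d o p3 <= d o p2 + d p2 p3.
Proof.
have := q2; rewrite gromov_productE (distC p3).
by have := dist_triangle p2 o p3; lra.
Qed.

End Chain.

(** * Rigidity of separated products *)

Section Rigidity.
Variables (R : realType) (X : metricType R) (G : groupType) (act : G -> X -> X).
Variables (delta R0 : R) (N0 : nat).
Hypotheses (isom : isometric_action act) (fp : four_point X delta).
Hypotheses (gX : geodesic_space X) (delta_ge1 : 1 <= delta).
Local Ltac lrad := have := delta_ge1; lra.
Local Notation d := (@dist R X).
Local Notation b := (orb act).
Implicit Types (g h s q y : G) (x z : X).
Hypothesis acyl : acylindrical_at act R0 N0 (100 * delta).

Lemma gromov_product_act g o x z :
  gromov_product (act g o) (act g x) (act g z) = gromov_product o x z.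
Proof. by rewrite !gromov_productE !dist_act. Qed.

Lemma commute_dvd y a j k : (j %| k)%N -> commute y (a ^+ j)%g -> commute y (a ^+ k)%g.
Proof. by move=> /dvdnP[i ->] c; rewrite mulnC expgnA; apply: commuteX. Qed.

Lemma commute_sg y h e k : commute y (sg e h ^+ k)%g -> commute y (h ^+ k)%g.
Proof. by case: e => //= /commuteV; rewrite expVgn invgK. Qed.

Variables (o : X) (h s : G) (p : nat) (L : R).
Let k := N0`!.
Let l := b o h p.
Let Dv := divergence act delta R0 N0 o h s.
Hypotheses (gh : good act delta o h) (ind : independent N0 h s).
Hypotheses (L0 : 0 <= L) (kp : (k %| p)%N) (lP : 20 * Dv + 4 * L <= l).

Let DvP : [/\ 3 * d o (act s o) <= Dv, 2 * (b o h 1 / 2 + delta) <= Dv,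
  10 * delta <= Dv & R0 + N0%:R * b o h 1 <= Dv].
Proof.
rewrite /Dv /divergence; have := acyl.1; have := orb_ge0 act o h 1.
have := dist_ge0 o (act s o).
have : 0 <= N0%:R * b o h 1 by rewrite mulr_ge0 ?orb_ge0.
by move=> *; split; lrad.
Qed.

(** Two translates of one segment of [a] run along the same geodesic from [o] to [z], at positions
    [psi1] and [psi2], so [y1^-1 y2] carries a long part of the segment along itself with a shift.
    The factorial exponent absorbs the unknown [j]. *)
Lemma shift_commute a y1 y2 z psi1 psi2 sh : good act delta o a ->
  b o a 1 = b o h 1 -> b o a p = l ->
  (forall t x, on_segment act o a p t x -> 3 * Dv <= t <= l - 3 * Dv ->
     between (4 * delta) o z (act y1 x) /\ psi1 + t <= d o (act y1 x) <= psi1 + t + 2 * delta) ->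
  (forall t x, on_segment act o a p t x -> 3 * Dv <= t <= l - 3 * Dv ->
     between (4 * delta) o z (act y2 x) /\ psi2 + t <= d o (act y2 x) <= psi2 + t + 2 * delta) ->
  `|psi1 - psi2| <= sh -> 8 * Dv + 2 * sh <= l ->
  commute (y1^-1 * y2)%g (a ^+ k)%g.
Proof.
move=> ga a1 ap H1 H2; rewrite ler_norml => psi shl.
have [D1 D2 D3 D4] := DvP; have b1 := orb_ge0 act o h 1.
have [||||t x x' tI sx sx'|j [/andP[j0 jN] e]] :=
  @fellow_travel_commute _ _ _ act delta R0 N0 isom fp gX delta_ge1 acyl o a (y1^-1 * y2)%g p
    (3 * Dv + sh) (psi2 - psi1) ga; rewrite ?a1 ?ap; [lrad | lrad | lrad | lrad | |].
  rewrite a1 in tI.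
  have [|bt1 pos1] := H1 _ _ sx'; first by lrad.
  have [|bt2 pos2] := H2 _ _ sx; first by lrad.
  rewrite (actM isom) dist_actl // invgK.
  have -> : 8 * delta = 2 * delta + 4 * delta + 2 * delta by lra.
  by apply: (between_close fp bt2 bt1); rewrite ler_norml; lra.
by apply: (commute_dvd _ e); rewrite /k dvdn_fact // j0.
Qed.

(** The signs are those for which the path does not backtrack at its outer corners, before the first
    long power and after the second. *)
Definition good_pair e1 e2 g q :=
  gromov_product o (act (g^-1)%g o) (act (sg e1 h ^+ p)%g o) <= b o h 1 / 2 + delta /\
  gromov_product o (act (sg e2 h ^- p)%g o) (act q o) <= b o h 1 / 2 + delta.

(** Two long powers, because [card_commuting] requires commutation with [h^k] and with its conjugate
    by [s]: each power yields one of them. Independence of [s] prevents backtracking between the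
    two. *)
Definition separated_product e1 e2 g q := (g * sg e1 h ^+ p * s * sg e2 h ^+ p * q)%g.

Section Pair.
Variables (e1 e2 : bool) (g q : G).
Hypothesis gq : good_pair e1 e2 g q.
Let z := act (separated_product e1 e2 g q) o.
Let P1 := act g o.
Let P2 := act (g * sg e1 h ^+ p)%g o.
Let P2' := act (g * sg e1 h ^+ p * s)%g o.
Let P3 := act (g * sg e1 h ^+ p * s * sg e2 h ^+ p)%g o.

Let p12 : d P1 P2 = l.
Proof. by rewrite /P2 actM // dist_act //; apply: orb_sg. Qed.

Let p23 : d P2' P3 = l.
Proof. by rewrite /P3 actM // dist_act //; apply: orb_sg. Qed.

Let p22 : d P2 P2' <= d o (act s o).
Proof. by rewrite /P2' (actM isom _ s) dist_act. Qed.

Let g1 : gromov_product P1 o P2 <= b o h 1 / 2 + delta.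
Proof.
have [H _] := gq; rewrite -(gromov_product_act g) in H.
by move: H; rewrite -!actM // mulgV act1.
Qed.

Let g2 : gromov_product P2 P1 P3 <= Dv.
Proof.
have := independent_product isom fp gX delta_ge1 acyl p (~~ e1) e2 gh ind.
rewrite -(gromov_product_act (g * sg e1 h ^+ p)%g) -!actM // !mulgA => /ltW.
congr (gromov_product _ (act _ _) _ <= _).
by case: e1; rewrite /= !expVgn ?mulgVK ?mulgK.
Qed.

Let g3 : gromov_product P3 P2' z <= b o h 1 / 2 + delta.
Proof.
have [_ H] := gq; rewrite -(gromov_product_act (g * sg e1 h ^+ p * s * sg e2 h ^+ p)%g) in H.
by move: H; rewrite -!actM // mulgK.
Qed.

Let lDv : 10 * Dv <= l.
Proof. by have [_ _ ? _] := DvP; have := lP; have := L0; lrad. Qed.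

Lemma pair_first t x : on_segment act o (sg e1 h) p t x -> 3 * Dv <= t <= l - 3 * Dv ->
  between (4 * delta) o z (act g x) /\
  d o P2 - l + t <= d o (act g x) <= d o P2 - l + t + 2 * delta.
Proof.
move=> [ox xp]; rewrite orb_sg // in xp; have [D1 D2 D3 _] := DvP.
apply: (chain_first fp delta_ge1 p12 p23 p22 g1 g2 g3 D1 D2 D3 lDv).
  by rewrite dist_act.
by rewrite /P2 actM // dist_act.
Qed.

Lemma pair_second t x : on_segment act o (sg e2 h) p t x -> 3 * Dv <= t <= l - 3 * Dv ->
  between (4 * delta) o z (act (g * sg e1 h ^+ p * s)%g x) /\
  d o P3 - l + t <= d o (act (g * sg e1 h ^+ p * s)%g x) <= d o P3 - l + t + 2 * delta.
Proof.
move=> [ox xp]; rewrite orb_sg // in xp; have [D1 D2 D3 _] := DvP.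
apply: (chain_second fp delta_ge1 p12 p23 p22 g1 g2 g3 D1 D2 D3 lDv).
  by rewrite dist_act.
by rewrite /P3 (actM isom _ (sg e2 h ^+ p)%g) dist_act.
Qed.

Lemma pair_position : 
  d o P1 - 2 * (b o h 1 / 2 + delta) <= d o P2 - l <= d o P1 /\
  d o P2 + d o (act (s * sg e2 h ^+ p)%g o) - 2 * (Dv + delta) <= d o P3
    <= d o P2 + d o (act (s * sg e2 h ^+ p)%g o).
Proof.
have [D1 D2 D3 _] := DvP; split; first exact: (chain_position1 p12 g1).
have := chain_position2 fp delta_ge1 p12 p22 g1 g2 D1 D2 D3 lDv.
suff -> : d P2 P3 = d o (act (s * sg e2 h ^+ p)%g o) by [].
by rewrite /P3 -(mulgA _ s) (actM isom _ (s * _)%g) dist_act.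
Qed.

End Pair.

Lemma pair_rigidity e1 e2 g q g' q' : good_pair e1 e2 g q -> good_pair e1 e2 g' q' ->
  separated_product e1 e2 g q = separated_product e1 e2 g' q' ->
  `|d o (act g o) - d o (act g' o)| <= L ->
  commute (g^-1 * g')%g (h ^+ k)%g /\ commute (g^-1 * g')%g (s * h ^+ k * s^-1)%g.
Proof.
move=> gq gq' eq_prod; rewrite ler_norml => gg'.
have [D1 D2 D3 D4] := DvP; have b1 := orb_ge0 act o h 1; have R00 := acyl.1.
have lP' := lP; have L0' := L0.
have [P1 P2] := pair_position gq; have [P1' P2'] := pair_position gq'.
have comh : commute (g^-1 * g')%g (h ^+ k)%g.
  apply: (@commute_sg _ _ e1).
  apply: (shift_commute (z := act (separated_product e1 e2 g q) o) (sh := L + Dv)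
    (good_sg isom e1 gh) (orb_sg isom _ _ _ _) (orb_sg isom _ _ _ _) (pair_first gq)).
  - by rewrite eq_prod; apply: pair_first gq'.
  - by rewrite ler_norml; lra.
  - by lrad.
split=> //.
have coma : commute (g^-1 * g')%g (sg e1 h ^+ p)%g.
  case: e1 {gq gq' eq_prod P1 P2 P1' P2'} => /=; last exact: commute_dvd comh.
  by rewrite expVgn; apply: commuteV; apply: commute_dvd comh.
(* Since [g^-1 g'] commutes with the first power, its conjugate by [s] is the quotient of the two
   elements that carry the second segment into place. *)
have : commute (s^-1 * (g^-1 * g') * s)%g (h ^+ k)%g.
  have -> : (s^-1 * (g^-1 * g') * s = (g * sg e1 h ^+ p * s)^-1 * (g' * sg e1 h ^+ p * s))%g.
    rewrite !invgM -!mulgA; congr (_ * _)%g; rewrite !mulgA; congr (_ * _)%g.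
    by rewrite -(mulgA _ g^-1 g')%g -mulgA coma mulKg.
  apply: (@commute_sg _ _ e2).
  apply: (shift_commute (z := act (separated_product e1 e2 g q) o) (sh := L + 4 * Dv)
    (good_sg isom e2 gh) (orb_sg isom _ _ _ _) (orb_sg isom _ _ _ _) (pair_second gq)).
  - by rewrite eq_prod; apply: pair_second gq'.
  - by rewrite ler_norml; lrad.
  - by lrad.
move=> e; rewrite /commute; apply: (mulIg s); apply: (mulgI (s^-1)%g).
by move: e; rewrite /commute !mulgA mulVg mul1g mulgVK -!mulgA => ->.
Qed.

End Rigidity.

(** * The product inequality *)

Lemma card_fibers (T U : choiceType) (W : finType) (A : {fset T}) (f : T -> U)
    (w : T -> W) (B : {fset U}) N : (forall x, x \in A -> f x \in B) ->
  (forall F : {fset T}, (forall x, x \in F -> x \in A) ->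
     (forall x y, x \in F -> y \in F -> f x = f y /\ w x = w y) -> (#|` F| <= N)%N) ->
  (#|` A| <= N * (#|` B| * #|W|))%N.
Proof.
move=> fB fib.
rewrite card_fset_sum1.
have -> : (\sum_(x <- A) 1 = \sum_(x <- A) \sum_(u <- B) \sum_(v : W) ((f x == u) && (w x == v)))%N.
  apply: eq_big_seq => x xA; rewrite (big_fsetD1 (f x)) ?fB //= eqxx.
  rewrite (bigD1 (w x)) //= eqxx big1 ?addn0 => [|v /negPf]; last by rewrite eq_sym => ->.
  rewrite [X in (_ + X)%N]big_seq big1 ?addn0 // => u; rewrite in_fsetD1 => /andP[/negPf uf _].
  by rewrite big1 // => v _; rewrite eq_sym uf.
rewrite exchange_big /=; apply: (@leq_trans (\sum_(u <- B) (N * #|W|))%N); last first.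
  by rewrite big_const_seq count_predT iter_addn_0 -mulnA (mulnC #|W|).
apply: leq_sum => u _; rewrite exchange_big /= mulnC -sum_nat_const.
apply: leq_sum => v _.
pose F := [fset x in [seq x <- A | (f x == u) && (w x == v)]]%fset.
have FE x : (x \in F) = ((f x == u) && (w x == v)) && (x \in A).
  by rewrite in_fset mem_filter.
have -> : (\sum_(x <- A) ((f x == u) && (w x == v)) = #|` F|)%N.
  rewrite /F card_fseq undup_id ?filter_uniq // size_filter -sum1_count.
  by rewrite [RHS]big_mkcond /=; apply: eq_bigr => x _; case: ifP.
apply: fib => [x|x y]; rewrite !FE; first by case/andP.
by move=> /andP[/andP[/eqP -> /eqP ->] _] /andP[/andP[/eqP -> /eqP ->] _].
Qed.

Lemma product_length i j n a c m : (i + j <= n)%N ->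
  (i + a * c + 1 + a * c + j <= n + (2 * (c * a) + 1 + 4 * m))%N.
Proof. by lia. Qed.

Lemma product_bound (B N n c : nat) :
  (N * (B * (2 * 2 * n.+1)) <= (2 * c + 1 + 4 * N) * n.+1 * B)%N.
Proof. by nia. Qed.

Section Product_count.
Variables (R : realType) (X : metricType R) (G : groupType) (act : G -> X -> X).
Variables (delta R0 : R) (N0 M : nat).
Hypotheses (isom : isometric_action act) (fp : four_point X delta).
Hypotheses (gX : geodesic_space X) (delta_ge1 : 1 <= delta).
Local Ltac lrad := have := delta_ge1; lra.
Local Notation d := (@dist R X).
Local Notation b := (orb act).
Implicit Types (g h s q y : G) (x z : X) (S : {fset G}).
Hypothesis acyl : acylindrical_at act R0 N0 (100 * delta).
Hypothesis nonelem : ~ elementary act.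
Hypothesis hypM : forall S, generating_set S ->
  exists2 g : G, g \in word_ball S M & hyperbolic_isometry (act g).

Lemma exists_good_pair o h p g q : good act delta o h ->
  exists e1 e2, good_pair act delta o h p e1 e2 g q.
Proof.
move=> gh; have hh := good_gromov_product isom fp delta_ge1 p p gh.
have [e1 H1] : exists e1, gromov_product o (act (g^-1)%g o) (act (sg e1 h ^+ p)%g o) <= b o h 1 / 2 + delta.
  case: (lerP (gromov_product o (act (g^-1)%g o) (act (h ^+ p)%g o)) (b o h 1 / 2 + delta)) => H.
    by exists false.
  by exists true; apply: (gromov_product_drop fp hh); rewrite gromov_productC.
have [e2 H2] : exists e2, gromov_product o (act (sg e2 h ^- p)%g o) (act q o) <= b o h 1 / 2 + delta.
  case: (lerP (gromov_product o (act (h ^- p)%g o) (act q o)) (b o h 1 / 2 + delta)) => H.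
    by exists false.
  exists true; rewrite /= -expVgn invgK gromov_productC.
  rewrite gromov_productC in hh; rewrite gromov_productC; rewrite gromov_productC.
  apply: (gromov_product_drop fp hh) => //; last by rewrite expVgn.
by exists e1, e2; split.
Qed.

Lemma product_count : exists C : nat, forall S, generating_set S ->
  forall n (Pi : {fset G * G}),
    (forall u, u \in Pi -> exists i j, [/\ (i + j <= n)%N, u.1 \in word_ball S i &
       u.2 \in word_ball S j]) ->
    (#|` Pi| <= C * n.+1 * #|` word_ball S (n + C)|)%N.
Proof.
have [C1 scale] := uniform_scale isom fp gX delta_ge1 acyl hypM.
(* [K * theta] will bound [Dv]: [3 * L] and [10 * delta] are covered by [7 * theta], the bound
   [b1 <= C1 * L] gives the term with [C1], and [1 <= theta] the last one. The exponent [p] makes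
   the displacement of [h^p] exceed [20 * Dv + 4 * L] for every [S] at once. *)
pose K := 7 + 2 * (N0%:R + 2) * C1%:R + R0 : R.
have R00 := acyl.1.
have K0 : 0 <= K by rewrite /K !addr_ge0 // !mulr_ge0 // addr_ge0.
have [p [Kp pK]] : exists p, (N0`! %| p)%N /\ 2 * (20 * K + 8) <= p%:R.
  exists (N0`! * Num.bound (2 * (20 * K + 8)))%N; split; first exact: dvdn_mulr.
  apply: le_trans (ltW (archi_boundP _)) _; first by lra.
  by rewrite ler_nat leq_pmull // fact_gt0.
exists (2 * (p * C1) + 1 + 4 * N0)%N => S gS n Pi PiP.
have [x0 [L [h [L0 SL hB gh Lth]]]] := scale S gS.
have [s sS ind] := exists_independent N0 isom fp delta_ge1 nonelem gS gh.
pose Dv := divergence act delta R0 N0 x0 h s.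
pose theta := b x0 h 2 - b x0 h 1.
have th1 : 1000 * delta <= theta by move: gh; rewrite /good /theta; lra.
have th0 : 1 <= theta by lrad.
have Lth2 : L <= 2 * theta := Lth.
have b1L : b x0 h 1 <= C1%:R * L.
  by rewrite (orb1 act x0 h); apply: dist_word_ball isom SL (ltW L0) hB.
have DvK : Dv <= K * theta.
  have h1 : (N0%:R + 2) * b x0 h 1 <= (N0%:R + 2) * (C1%:R * (2 * theta)).
    rewrite ler_wpM2l ?addr_ge0 //; apply: le_trans b1L _.
    by rewrite ler_wpM2l.
  have h2 : R0 <= R0 * theta by rewrite ler_peMr.
  have h3 := SL s sS.
  rewrite /Dv /divergence /K.
  have -> : (7 + 2 * (N0%:R + 2) * C1%:R + R0) * theta =
    7 * theta + (N0%:R + 2) * (C1%:R * (2 * theta)) + R0 * theta by ring.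
  by lrad.
have lP : 20 * Dv + 4 * L <= b x0 h p.
  apply: le_trans (orb_ge isom fp delta_ge1 p gh); rewrite -/theta.
  have : 2 * (20 * K + 8) * (theta - 2 * delta) <= p%:R * (theta - 2 * delta).
    by rewrite ler_wpM2r //; lrad.
  have : 2 * (20 * K + 8) * (theta / 2) <= 2 * (20 * K + 8) * (theta - 2 * delta).
    by rewrite ler_wpM2l //; lrad.
  have -> : 2 * (20 * K + 8) * (theta / 2) = 20 * (K * theta) + 8 * theta by field.
  by lrad.
have /choice[e eP] : forall u : G * G, exists e : bool * bool,
    good_pair act delta x0 h p e.1 e.2 u.1 u.2.
  by move=> u; have [e1 [e2 H]] := exists_good_pair p u.1 u.2 gh; exists (e1, e2).
pose f u := separated_product h s p (e u).1 (e u).2 u.1 u.2.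
(* Displacement in units of [L], which is at most [n]. Rigidity compares pairs in the same slot, and
   the [n + 1] slots are the linear factor of the inequality. *)
pose wd (u : G * G) : 'I_n.+1 := inord (Num.truncn (d x0 (act u.1 x0) / L)).
pose w u := (e u, wd u).
have uL u : u \in Pi -> d x0 (act u.1 x0) <= n%:R * L.
  move=> /PiP[i [j [ij u1 _]]].
  apply: le_trans (dist_word_ball isom SL (ltW L0) u1) _.
  by rewrite ler_wpM2r ?(ltW L0) // ler_nat (leq_trans (leq_addr _ _) ij).
have wdE u : u \in Pi -> (wd u)%:R * L <= d x0 (act u.1 x0) < (wd u)%:R * L + L.
  move=> uP; have d0 : 0 <= d x0 (act u.1 x0) / L by rewrite divr_ge0 ?dist_ge0 ?ltW.
  have -> : (wd u : nat) = Num.truncn (d x0 (act u.1 x0) / L).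
    rewrite /wd inordK // ltnS -(ler_nat R).
    apply: (@le_trans _ _ (d x0 (act u.1 x0) / L)); first by rewrite truncn_le.
    by rewrite ler_pdivrMr // uL.
  have /andP[H1 H2] := truncn_itv d0.
  by rewrite -ler_pdivlMr // H1 /= -[X in _ + X]mul1r -mulrDl natr1 -ltr_pdivrMr.
have hBe c : sg c h \in word_ball S C1 by case: c => //=; apply: word_ballV.
have fB u : u \in Pi -> f u \in word_ball S (n + (2 * (p * C1) + 1 + 4 * N0))%N.
  move=> /PiP[i [j [ij u1 u2]]].
  apply: (word_ball_mono (product_length _ _ _ ij)).
  apply: word_ballM u2; apply: word_ballM (word_ballX _ (hBe _)).
  apply: word_ballM (word_ball_gen sS); exact: word_ballM u1 (word_ballX _ (hBe _)).
apply: leq_trans (card_fibers (N := N0) (w := w) fB _) _; last first.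
  by rewrite !card_prod card_bool card_ord; apply: product_bound.
move=> F FPi Fw; case: (fset_0Vmem F) => [->|[u uF]]; first by rewrite cardfs0.
pose A := [fset (u.1^-1 * v.1)%g | v in F]%fset.
have same v : v \in F -> [/\ e v = e u, f v = f u & wd v = wd u].
  by move=> vF; have [E1 E2] := Fw v u vF uF; case: E2.
have inj : {in F &, injective (fun v : G * G => (u.1^-1 * v.1)%g)}.
  move=> v v' vF v'F /mulgI e1.
  have [ev fv _] := same v vF; have [ev' fv' _] := same v' v'F.
  have := fv; rewrite -fv' /f /separated_product ev ev' e1 => /mulgI e2.
  by rewrite [v]surjective_pairing [v']surjective_pairing e1 e2.
have <- : #|` A| = #|` F| by rewrite card_in_imfset.
apply: (card_commuting isom fp gX delta_ge1 acyl gh ind (fact_gt0 N0)) => y.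
move=> /imfsetP[v vF ->]; have [ev fv wv] := same v vF.
have gv := eP v; rewrite ev in gv.
apply: (pair_rigidity isom fp gX delta_ge1 acyl gh ind (ltW L0) Kp lP (eP u) gv).
  by move: fv; rewrite /f ev.
have := wdE u (FPi u uF); have := wdE v (FPi v vF); rewrite wv => H1 H2.
by rewrite ler_norml; lra.
Qed.

End Product_count.

(** * Normal subgroups, and superlinear growth of balls *)

Definition normal_subgroup (G : groupType) (A : set G) :=
  [/\ A 1%g, forall x y, A x -> A y -> A (x * y)%g, forall x, A x -> A (x^-1)%g &
      forall g x, A x -> A (g * x * g^-1)%g].

Definition more_than (T : choiceType) (N : nat) (A : set T) :=
  exists2 F : {fset T}, (forall x, x \in F -> A x) & (N < #|` F|)%N.

Section Normal_subgroups.
Variables (R : realType) (X : metricType R) (G : groupType) (act : G -> X -> X).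
Variables (delta R0 : R) (N0 M : nat).
Hypotheses (isom : isometric_action act) (fp : four_point X delta).
Hypotheses (gX : geodesic_space X) (delta_ge1 : 1 <= delta).
Local Ltac lrad := have := delta_ge1; lra.
Local Notation d := (@dist R X).
Local Notation b := (orb act).
Implicit Types (g h s q y : G) (x z : X) (S : {fset G}) (A B : set G).
Hypothesis acyl : acylindrical_at act R0 N0 (100 * delta).
Hypothesis nonelem : ~ elementary act.
Hypothesis hypM : forall S, generating_set S ->
  exists2 g : G, g \in word_ball S M & hyperbolic_isometry (act g).

Lemma good_exp o h m : good act delta o h -> 1000 * delta <= m%:R ->
  good act delta o (h ^+ m)%g.
Proof.
move=> gh mD; have := orb_incr_nat isom fp delta_ge1 m m gh.
by rewrite /good !orb_exp muln1 muln2 -addnn; lra.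
Qed.

(** The commutator and its inverse move [o] in the directions of [y h^p o] and [h^p o], which
    diverge by independence, while the displacement grows with [p]. *)
Lemma good_commutator o h y : good act delta o h -> independent N0 h y ->
  exists p, good act delta o (y * h ^+ p * y^-1 * h ^- p)%g.
Proof.
move=> gh ind; pose Dv := divergence act delta R0 N0 o h y; pose D := d o (act y o).
have D0 : 0 <= D := dist_ge0 _ _.
have [p pP] := orb_unbounded isom fp delta_ge1 (3 * Dv + 6 * D + 1100 * delta) gh (isT : 0 < 1)%N.
have := pP p (leqnn _); rewrite mul1n => {pP} bp; exists p.
pose v := act (h^-1 ^+ p)%g o; pose u := act (h ^+ p)%g o.
have ou : d o u = b o h p by [].
have ov : d o v = b o h p by apply: orbV.
have uu : gromov_product o u (act y u) <= Dv.
  by apply: ltW; rewrite /u -actM //; apply: (independent_product isom fp gX delta_ge1 acyl p false false gh ind).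
have vv : gromov_product o v (act y v) <= Dv.
  by apply: ltW; rewrite /v -actM //; apply: (independent_product isom fp gX delta_ge1 acyl p true true gh ind).
have Dv0 : 0 <= Dv.
  apply: le_trans uu; rewrite gromov_productE.
  by have := dist_triangle o u (act y u); rewrite (distC _ o) (distC _ o); lra.
set g := (y * _ * _ * _)%g.
have gE : act g o = act (y * h ^+ p * y^-1)%g v by rewrite /v /g actM // expVgn.
have gVE : act (g^-1)%g o = act (h ^+ p * y)%g (act (h^-1 ^+ p)%g (act (y^-1)%g o)).
  by rewrite /g !invgM !invgK expVgn -!actM // !mulgA.
have yo : d o (act (y^-1)%g o) = D by apply: dist_actV.
have yv : d (act (h^-1 ^+ p * y^-1)%g o) v = D by rewrite /v actM // dist_act // distC.
have uE : act (h^-1 ^+ p)%g u = o by rewrite /u -actM // expVgn mulVg act1.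
have yuE : act (h^-1 ^+ p * y^-1)%g (act y u) = o by rewrite -actM // mulgVK uE.
(* the turn at [y h^p o] on the way to [g o] *)
have turn1 : gromov_product (act y u) o (act g o) <= Dv + 2 * D.
  rewrite -(gromov_product_act isom (h^-1 ^+ p * y^-1)%g) yuE gE.
  have -> : act (h^-1 ^+ p * y^-1)%g (act (y * h ^+ p * y^-1)%g v) = act (y^-1)%g v.
    by rewrite -!actM // expVgn !mulgA mulgVK mulVg mul1g.
  have := gromov_product_move o (act (h^-1 ^+ p * y^-1)%g o) v (act (y^-1)%g v).
  rewrite yv; have : gromov_product o v (act (y^-1)%g v) <= Dv + D; last by lra.
  rewrite -(gromov_product_act isom y) -actM // mulgV act1 // gromov_productC.
  by have := gromov_product_base (act y o) o v (act y v); rewrite (distC _ o) -/D; lra.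
have turn2 : gromov_product u o (act (g^-1)%g o) <= Dv + D.
  rewrite -(gromov_product_act isom (h^-1 ^+ p)%g) uE gVE.
  rewrite -/v (actM isom _ y) -(actM isom (h^-1 ^+ p)%g (h ^+ p)%g) expVgn mulVg act1 //.
  rewrite gromov_productC -expVgn.
  have := gromov_product_move o (act y (act (h^-1 ^+ p)%g (act (y^-1)%g o))) (act y v) v.
  rewrite !dist_act // (distC _ o) yo (gromov_productC o (act y v)); lra.
have oyu : b o h p - D <= d o (act y u).
  by have := dist_triangle o (act y o) (act y u); rewrite dist_act // ou (distC _ o) -/D; lra.
have yug : b o h p - D <= d (act y u) (act g o).
  have -> : d (act y u) (act g o) = d o (act (y^-1)%g v).
    rewrite gE -(dist_act isom (h^-1 ^+ p * y^-1)%g) yuE -!actM //.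
    by rewrite expVgn !mulgA mulgVK mulVg mul1g.
  have := dist_triangle (act (y^-1)%g o) o (act (y^-1)%g v); rewrite yo => H.
  have := dist_triangle (act y o) o v; rewrite -/D ov.
  by have := dist_triangle o (act (y^-1)%g o) (act (y^-1)%g v); rewrite dist_act // ov (distC _ o) yo; lra.
apply: good_of_gromov_product => //.
have r1 : gromov_product o u (act g o) <= Dv + delta.
  rewrite gromov_productC; rewrite gromov_productC in uu.
  rewrite gromov_productC; rewrite gromov_productC; apply: (gromov_product_drop fp uu).
  move: turn1; rewrite !gromov_productE (distC (act g o) o) (distC o (act y u)) (distC (act g o) (act y u)) (distC (act y u) o).
  by lrad.
have r2 : gromov_product o (act g o) (act (g^-1)%g o) <= Dv + delta + delta.
  rewrite gromov_productC; apply: (gromov_product_drop fp r1).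
  move: turn2; rewrite !gromov_productE !(distC _ o) ou (distC (act (g^-1)%g o) u).
  by lrad.
move: turn1; rewrite gromov_productE (distC (act g o) (act y u)); lrad.
Qed.

(** If all of [B] commuted with [h^k], then by normality also with its conjugate by [s], and [B]
    would have at most [N0] elements. So some [y] in [B] does not: if it is independent, its
    commutator with a power of [h] is good; if it inverts [h^j], then [h^(2j)] lies in [B]. *)
Lemma normal_subgroup_good B : normal_subgroup B -> more_than N0 B ->
  finitely_generated G -> exists o h, B h /\ good act delta o h.
Proof.
move=> [B1 BM BV BJ] [F FB NF] [S gS].
have [C1 scale] := uniform_scale isom fp gX delta_ge1 acyl hypM.
have [x0 [L [h [L0 SL hB gh Lth]]]] := scale S gS.
have [s sS ind] := exists_independent N0 isom fp delta_ge1 nonelem gS gh.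
pose k := N0`!.
have [y yB ny] : exists2 y, B y & ~ commute y (h ^+ k)%g.
  apply: contrapT => com.
  have com' y : B y -> commute y (h ^+ k)%g.
    by move=> yB; apply: contrapT => ny; apply: com; exists y.
  move: NF; rewrite ltnNge => /negP; apply.
  apply: (card_commuting isom fp gX delta_ge1 acyl gh ind (fact_gt0 N0)) => y /FB yB.
  split; first exact: com'.
  have := com' _ (BJ (s^-1)%g _ yB); rewrite /commute invgK => e.
  apply: (mulIg s); apply: (mulgI (s^-1)%g).
  by move: e; rewrite !mulgA mulVg mul1g mulgVK -!mulgA => ->.
case: (pselect (independent N0 h y)) => [indy|].
  have [p gp] := good_commutator gh indy; exists x0, (y * h ^+ p * y^-1 * h ^- p)%g; split=> //.
  by rewrite -!mulgA; apply: BM => //; rewrite mulgA; apply/BJ/BV.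
move=> /existsNP[j] /not_implyP[/andP[j0 jN]] /not_andP; rewrite !not_notE => -[e|e].
  by case: ny; apply: (commute_dvd (j := j)) => //; rewrite dvdn_fact // j0.
pose m := Num.bound (1000 * delta).
have h2 : B (h ^- (j + j))%g.
  have -> : (h ^- (j + j) = y * (h ^+ j * y^-1 * h ^- j))%g.
    have yh : (y * h ^+ j = h ^- j * y)%g by apply: (mulgI (h ^+ j)%g); rewrite mulgA e mulVKg.
    by rewrite !mulgA yh mulgK -invgM -expgnDr.
  by apply: BM => //; apply/BJ/BV.
exists x0, (h ^+ ((j + j) * m))%g; split.
  rewrite expgnA; have := BV _ h2; rewrite invgK => {}h2.
  by elim: m => [|m IH]; [rewrite expg0 | rewrite expgS; apply: BM].
apply: good_exp => //; apply: le_trans (ltW (archi_boundP _)) _; first by lrad.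
by rewrite ler_nat leq_pmull // addn_gt0 j0.
Qed.

Lemma commuting_normal_subgroups A B : normal_subgroup A -> normal_subgroup B ->
  finitely_generated G -> (forall x y : G, A x -> B y -> commute x y) ->
  more_than N0 B -> ~ more_than N0 A.
Proof.
move=> nA nB fg comAB mB [F FA]; apply/negP; rewrite -leqNgt.
have [x0 [h [hB gh]]] := normal_subgroup_good nB mB fg.
have [S gS] := fg; have [s sS ind] := exists_independent N0 isom fp delta_ge1 nonelem gS gh.
have [_ _ _ BJ] := nB.
apply: (card_commuting isom fp gX delta_ge1 acyl gh ind (isT : 0 < 1)%N) => y /FA yA.
by rewrite expg1; split; apply: comAB => //; apply: BJ.
Qed.

Lemma finite_normal_subgroup B : normal_subgroup B -> finitely_generated G ->
  finite_set B -> ~ more_than N0 B.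
Proof.
move=> nB fg fB mB; have [x0 [h [hB gh]]] := normal_subgroup_good nB mB fg.
have [B1 BM _ _] := nB.
have hnB n : B (h ^+ n)%g by elim: n => [|n IH]; [rewrite expg0 | rewrite expgS; apply: BM].
have inj : injective (fun n => h ^+ n)%g.
  have lt i j : (i < j)%N -> (h ^+ i)%g <> (h ^+ j)%g.
    move=> ij e; have := orb_incr_nat isom fp delta_ge1 i (j - i) gh.
    rewrite subnKC 1?ltnW // /orb -e => H.
    have : 1 <= (j - i)%N%:R :> R by rewrite ler1n subn_gt0.
    by move=> ?; have : (1 : R) <= 0 by [lra]; rewrite ler10.
  by move=> i j e; case: (ltngtP i j) => // /lt; rewrite e.
have /finite_fsetP[F BF] := fB.
have : uniq [seq (h ^+ n)%g | n <- iota 0 #|` F|.+1] by rewrite map_inj_uniq ?iota_uniq.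
move=> /uniq_leq_size/(_ (_ : {subset _ <= F})); rewrite size_map size_iota ltnn => H.
by apply: notF; apply: H => _ /mapP[n _ ->]; have := hnB n; rewrite BF.
Qed.

(** A coincidence would give [h^a s = s h^c] or [h^a s = s h^-c] with [0 < a]. Displacements of
    powers force [a = c]; then [h^(an) o] stays close to [s h^(an) o] or [s h^(-an) o] for all [n],
    against independence. *)
Lemma independent_power_sum h s x0 i j i' j' : good act delta x0 h -> independent N0 h s ->
  (h ^+ i * s * h ^+ j = h ^+ i' * s * h ^+ j')%g -> i = i' /\ j = j'.
Proof.
move=> gh ind.
have inj m n : (h ^+ m = h ^+ n)%g -> m = n.
  have lt u v : (u < v)%N -> (h ^+ u)%g <> (h ^+ v)%g.
    move=> uv e; have := orb_incr_nat isom fp delta_ge1 u (v - u) gh.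
    rewrite subnKC 1?ltnW // /orb -e => H.
    have : 1 <= (v - u)%N%:R :> R by rewrite ler1n subn_gt0.
    by move=> ?; have : (1 : R) <= 0 by [lra]; rewrite ler10.
  by move=> e; case: (ltngtP m n) => // /lt; rewrite e.
pose D := d x0 (act s x0).
have noconj e a c : (0 < a)%N -> (h ^+ a * s)%g <> (s * sg e h ^+ c)%g.
  move=> a0 E; have En n : (h ^+ (a * n) * s = s * sg e h ^+ (c * n))%g.
    elim: n => [|n IH]; first by rewrite !muln0 !expg0 mulg1 mul1g.
    by rewrite !mulnS !expgnDr -mulgA IH !mulgA E.
  have close n : `|b x0 h (a * n) - b x0 h (c * n)| <= 2 * D.
    have := congr1 (fun g => d x0 (act g x0)) (En n); rewrite /= !actM //.
    pose u := act (h ^+ (a * n))%g x0; pose v := act (h ^+ (a * n))%g (act s x0).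
    pose w := act s (act (sg e h ^+ (c * n))%g x0); rewrite -/v -/w => vw.
    have sw : d (act s x0) w = b x0 h (c * n) by rewrite /w dist_act //; apply: orb_sg.
    have uv : d u v = D by rewrite /u /v dist_act.
    have := dist_triangle u x0 v; have := dist_triangle v x0 u.
    have := dist_triangle (act s x0) x0 w; have := dist_triangle x0 (act s x0) w.
    rewrite (distC (act s x0) x0) (distC v u) -/D sw uv -/(b x0 h (a * n)) ler_norml.
    by lra.
  have ac : a = c.
    have far u v : (u < v)%N -> exists n, 2 * D < b x0 h (v * n) - b x0 h (u * n).
      move=> uv; exists (Num.bound (2 * D)); set n := Num.bound _.
      have := orb_incr_nat isom fp delta_ge1 (u * n) (v * n - u * n) gh.
      rewrite subnKC ?leq_mul2r ?(ltnW uv) ?orbT // -mulnBl.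
      have : n%:R <= ((v - u) * n)%N%:R :> R by rewrite ler_nat leq_pmull // subn_gt0.
      have := archi_boundP (mulr_ge0 (ler0n R 2) (dist_ge0 x0 (act s x0))).
      by rewrite -/D -/n; lra.
    case: (ltngtP a c) => // /far[n]; have := close n; rewrite ler_norml => + H.
      by move=> ?; have : (1 : R) <= 0 by [lra]; rewrite ler10.
    by move=> ?; have : (1 : R) <= 0 by [lra]; rewrite ler10.
  have [n0 n0P] := orb_unbounded isom fp delta_ge1 (divergence act delta R0 N0 x0 h s + D) gh a0.
  have := independent_product isom fp gX delta_ge1 acyl (a * n0) false e gh ind.
  have := En n0; rewrite -ac /= => <-; have := n0P n0 (leqnn _).
  rewrite gromov_productE actM // dist_act // -/D !(distC _ x0) -/(b x0 h _).
  have := dist_triangle (act (h ^+ (a * n0))%g (act s x0)) x0 (act (h ^+ (a * n0))%g x0).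
  rewrite dist_act // (distC _ x0) -/D -/(b x0 h _) => ? ? ?.
  by have : (1 : R) <= 0 by [lra]; rewrite ler10.
wlog ii : i j i' j' / (i <= i')%N => [H e|].
  by case: (leqP i i') => [/H|/ltnW/H] ii; [apply: ii | case: (ii _ _ (esym e))].
rewrite -{1}(subnKC ii) expgnDr -!mulgA => /mulgI; rewrite mulgA => e.
have ji : i = i'.
  apply/eqP; rewrite eqn_leq ii leqNgt; apply/negP => lt.
  have pos : (0 < i' - i)%N by rewrite subn_gt0.
  case: (leqP j' j) => jj.
    apply: (noconj false _ (j - j')%N pos); rewrite /=; apply: (mulIg (h ^+ j')%g).
    by rewrite -e -mulgA -expgnDr subnK.
  apply: (noconj true _ (j' - j)%N pos); rewrite /= expVgn; apply: (mulIg (h ^+ j')%g).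
  have E : (h ^+ j' = h ^+ (j' - j) * h ^+ j)%g by rewrite -expgnDr subnK // ltnW.
  by rewrite -e [in RHS]E -mulgA mulKg.
split=> //; move: e; rewrite ji subnn expg0 mul1g => /mulgI/inj; exact.
Qed.

(** A ball of radius O(m) contains the [(m+1)^2] elements [h^i s h^j]. This rules out the rate 1,
    for which the upper bound on balls is linear. *)
Lemma word_ball_superlinear S (K : R) : generating_set S ->
  exists n, K * n.+1%:R < #|` word_ball S n|%:R.
Proof.
move=> gS; have [C1 scale] := uniform_scale isom fp gX delta_ge1 acyl hypM.
have [x0 [L [h [L0 SL hB gh Lth]]]] := scale S gS.
have [s sS ind] := exists_independent N0 isom fp delta_ge1 nonelem gS gh.
pose m := Num.bound (`|K| * (2 * C1%:R + 2)).
exists (C1 * m + 1 + C1 * m)%N.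
have big : (m.+1 * m.+1 <= #|` word_ball S (C1 * m + 1 + C1 * m)|)%N.
  pose f (ij : 'I_m.+1 * 'I_m.+1) := (h ^+ ij.1 * s * h ^+ ij.2)%g.
  have fi : injective f.
    move=> [i j] [i' j'] /(independent_power_sum gh ind)[/= /val_inj -> /val_inj ->] //.
  have -> : (m.+1 * m.+1)%N = size [seq f ij | ij <- enum {: 'I_m.+1 * 'I_m.+1}].
    by rewrite size_map -cardE card_prod !card_ord.
  apply: uniq_leq_size; first by rewrite map_inj_uniq ?enum_uniq.
  move=> _ /mapP[[i j] _ ->]; rewrite /f /=.
  have hm (k : 'I_m.+1) : (h ^+ k)%g \in word_ball S (C1 * m).
    by apply: word_ball_mono (word_ballX k hB); rewrite leq_mul2l -ltnS ltn_ord orbT.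
  by apply: word_ballM => //; apply: word_ballM => //; apply: word_ball_gen.
apply: lt_le_trans (_ : (m.+1 * m.+1)%N%:R <= _); last by rewrite ler_nat.
have Kge : K * (C1 * m + 1 + C1 * m).+1%:R <= `|K| * (C1 * m + 1 + C1 * m).+1%:R.
  by rewrite ler_wpM2r // ler_norm.
apply: le_lt_trans Kge _.
have le1 : (C1 * m + 1 + C1 * m).+1%:R <= (2 * C1%:R + 2) * m.+1%:R :> R.
  rewrite -!natrM -natrD -natrM ler_nat; nia.
apply: (@le_lt_trans _ _ (`|K| * ((2 * C1%:R + 2) * m.+1%:R))).
  by rewrite ler_wpM2l.
rewrite mulrA natrM ltr_pM2r //.
apply: lt_le_trans (archi_boundP _) _; last by rewrite ler_nat leqW.
by rewrite mulr_ge0 // addr_ge0 // mulr_ge0.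
Qed.

End Normal_subgroups.

(** * Growth rates and the upper bound on balls *)

Section Exponential_growth.
Variable R : realType.
Implicit Types (x y c theta : R) (n m k : nat).

Lemma expr_ge_linear x n : 0 <= x -> 1 + n%:R * x <= (1 + x) ^+ n.
Proof.
move=> x0; elim: n => [|n IH]; first by rewrite mul0r addr0 expr0.
rewrite exprS -natr1; have : (1 + x) * (1 + n%:R * x) <= (1 + x) * (1 + x) ^+ n.
  by rewrite ler_wpM2l // addr_ge0.
have : 0 <= n%:R * x * x by rewrite !mulr_ge0.
by rewrite !mulrDl !mul1r !mulrDr !mulr1; lra.
Qed.

Lemma expr_unbounded theta c : 1 < theta ->
  exists n0, forall n, (n0 <= n)%N -> c <= theta ^+ n.
Proof.
move=> th1; have t0 : 0 < theta - 1 by rewrite subr_gt0.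
exists (Num.bound (`|c| / (theta - 1))) => n n0.
have := expr_ge_linear n (ltW t0); have -> : 1 + (theta - 1) = theta by ring.
move=> H; apply: le_trans (ler_norm c) _.
apply: (@le_trans _ _ (n%:R * (theta - 1))); last by lra.
rewrite -ler_pdivrMr //; apply: le_trans (ltW (archi_boundP _)) _.
  by rewrite divr_ge0 // ltW.
by rewrite ler_nat.
Qed.

Lemma expr_beats_linear theta c : 1 < theta ->
  exists n0, forall n, (n0 <= n)%N -> c * n.+1%:R <= theta ^+ n.
Proof.
move=> th1; have t0 : 0 < theta - 1 by rewrite subr_gt0.
exists (Num.bound (4 * `|c| / (theta - 1) ^+ 2)).*2.+2 => n nN.
set N := Num.bound _ in nN; pose j := n./2.
have jN : (N < j)%N by rewrite /j; lia.
have nj : (n.+1 <= 4 * j)%N by rewrite /j; lia.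
have j2 : (j * 2 <= n)%N by rewrite /j; lia.
have jlin : j%:R * (theta - 1) <= theta ^+ j.
  have := expr_ge_linear j (ltW t0); have -> : 1 + (theta - 1) = theta by ring.
  by lra.
have cj : 4 * `|c| <= j%:R * (theta - 1) ^+ 2.
  rewrite -ler_pdivrMr ?exprn_gt0 //; apply: le_trans (ltW (archi_boundP _)) _.
    by rewrite divr_ge0 ?mulr_ge0 // ?exprn_ge0 // ltW.
  by rewrite ler_nat ltnW.
apply: (@le_trans _ _ (theta ^+ (j * 2))); last by rewrite ler_weXn2l // ltW.
rewrite exprM; apply: (@le_trans _ _ ((j%:R * (theta - 1)) ^+ 2)); last first.
  by rewrite lerXn2r // nnegrE ?exprn_ge0 // ?mulr_ge0 //; lra.
apply: (@le_trans _ _ (`|c| * (4 * j)%N%:R)).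
  apply: (@le_trans _ _ (`|c| * n.+1%:R)); first by rewrite ler_wpM2r // ler_norm.
  by rewrite ler_wpM2l // ler_nat.
have -> : `|c| * (4 * j)%N%:R = j%:R * (4 * `|c|) by rewrite natrM; ring.
have -> : (j%:R * (theta - 1)) ^+ 2 = j%:R * (j%:R * (theta - 1) ^+ 2) by ring.
by rewrite ler_wpM2l.
Qed.

Lemma powR_rootK x n : 0 <= x -> (0 < n)%N -> (x `^ (n%:R^-1)) ^+ n = x.
Proof.
move=> x0 n0; rewrite -powR_mulrn ?powR_ge0 // -powRrM mulVf ?powRr1 //.
by rewrite pnatr_eq0 -lt0n.
Qed.

Lemma powR_root_le x y n : 0 <= x -> 0 <= y -> (0 < n)%N -> 
  (x `^ (n%:R^-1) <= y) = (x <= y ^+ n).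
Proof.
by move=> x0 y0 n0; rewrite -(ler_pXn2r n0) ?nnegrE ?powR_ge0 // powR_rootK.
Qed.

Variable F : nat -> R.
Hypotheses (F0 : F 0 = 1) (F1 : forall n, 1 <= F n) (Fmono : forall m n, (m <= n)%N -> F m <= F n).
Hypothesis Fsub : forall m n, F (m + n) <= F m * F n.
Let a n := F n `^ (n%:R^-1).

Lemma submultiplicative_bound m y n : (0 < m)%N -> 1 <= y -> F m <= y ^+ m ->
  F n <= y ^+ n * F m.
Proof.
move=> m0 y1 Fm; rewrite {1}(divn_eq n m); apply: le_trans (Fsub _ _) _.
have Fpos k : 0 <= F k by apply: le_trans (F1 k).
have y0 : 0 <= y by apply: le_trans y1.
apply: ler_pM => //; last by apply: Fmono; rewrite ltnW // ltn_mod.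
apply: (@le_trans _ _ (y ^+ (n %/ m * m))); last first.
  by rewrite ler_weXn2l // leq_trunc_div.
elim: (n %/ m)%N => [|q IH]; first by rewrite mul0n F0 expr0.
by rewrite mulSn exprD; apply: le_trans (Fsub _ _) _; apply: ler_pM.
Qed.

Let Fpos n : 0 <= F n. Proof. by apply: le_trans (F1 n). Qed.

Lemma root_ge1 n : 1 <= a n.
Proof.
case: n => [|n]; first by rewrite /a F0 powR1.
rewrite leNgt; apply/negP => lt; have := F1 n.+1; rewrite leNgt => /negP; apply.
by rewrite -(powR_rootK (Fpos n.+1) (ltn0Sn n)) exprn_ilt1 // powR_ge0.
Qed.

(** Fekete's lemma in multiplicative form: the limit is the infimum of the roots, whence a lower
    bound on [F n] for every [n]. *)
Lemma growth_limit : exists2 rho : R, a n @[n --> \oo] --> rho & forall n, rho ^+ n <= F n.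
Proof.
(* [a 0 = 1] carries no information on [F] and is kept out of the infimum. *)
pose A := [set a n.+1 | n in [set: nat]].
have hA : has_inf A.
  by split; [exists (a 1), 0%N | exists 1 => _ [n _ <-]; apply: root_ge1].
have A1 : 1 <= inf A.
  by apply: lb_le_inf; [case: hA | move=> _ [n _ <-]; apply: root_ge1].
have infA n : inf A <= a n.+1 by apply: ge_inf; [case: hA | exists n].
exists (inf A); last first.
  case=> [|n]; first by rewrite expr0.
  rewrite -(powR_rootK (Fpos n.+1) (ltn0Sn n)); apply: lerXn2r => //.
  - by rewrite nnegrE; lra.
  - by rewrite nnegrE powR_ge0.
  - exact: infA.
apply/cvgrPdist_le => e e0.
have e20 : 0 < e / 2 by rewrite divr_gt0.
have [y [m _ yE] ym] := inf_adherent e20 hA; rewrite -{}yE in ym.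
pose y1 := inf A + e / 2; pose y2 := inf A + e.
have Fm : F m.+1 <= y1 ^+ m.+1 by rewrite -powR_root_le //; [exact: ltW | rewrite /y1; lra].
have y12 : 1 < y2 / y1 by rewrite ltr_pdivlMr /y1 /y2; lra.
have [n0 n0P] := expr_unbounded (F m.+1) y12.
exists n0.+1 => // n /= n0n; case: n n0n => // n n0n.
rewrite ler_norml; have := infA n.
suff : a n.+1 <= y2 by rewrite /y2; lra.
rewrite powR_root_le //; last by rewrite /y2; lra.
apply: le_trans (@submultiplicative_bound m.+1 y1 n.+1 _ _ Fm) _ => //.
  by rewrite /y1; lra.
have -> : y2 ^+ n.+1 = y1 ^+ n.+1 * (y2 / y1) ^+ n.+1.
  by rewrite -exprMn; congr (_ ^+ _); field; rewrite /y1 gt_eqF //; lra.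
rewrite ler_wpM2l //; first by rewrite exprn_ge0 // /y1; lra.
by apply: n0P; rewrite ltnW.
Qed.

Lemma growth_limit_bounds rho : rho = lim (a n @[n --> \oo]) ->
  [/\ 1 <= rho, forall n, rho ^+ n <= F n &
     forall theta, rho < theta -> exists n0, forall n, (n0 <= n)%N -> F n <= theta ^+ n].
Proof.
move=> ->; have [l al lF] := growth_limit; rewrite (cvg_lim _ al) //.
have l1 : 1 <= l.
  rewrite -(cvg_lim (@Rhausdorff R) al); apply: limr_ge; first by apply/cvg_ex; exists l.
  by apply: nearW => n; apply: root_ge1.
split=> // theta lt; have th0 : 0 <= theta by lra.
have [n0 _ n0P] : \forall n \near \oo, a n <= theta.
  by apply: (cvgr_le l al theta).
exists n0.+1 => n n0n; rewrite -powR_root_le //; last by rewrite (leq_ltn_trans _ n0n).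
by apply: n0P; rewrite /= ltnW.
Qed.

End Exponential_growth.

Section Word_growth.
Variables (R : realType) (G : groupType).
Implicit Types (S : {fset G}) (rho : R) (C m n : nat).

Definition fset_pairs (T U : choiceType) (A : {fset T}) (B : {fset U}) : {fset T * U} :=
  [fset u in [seq (x, y) | x <- A, y <- B]]%fset.

Lemma in_fset_pairs (T U : choiceType) (A : {fset T}) (B : {fset U}) u :
  (u \in fset_pairs A B) = (u.1 \in A) && (u.2 \in B).
Proof.
rewrite in_fset; apply/allpairsP/andP => [[[x y] /= [xA yB ->]]//|[xA yB]].
by exists u; split=> //; case: u {xA yB}.
Qed.

Lemma card_fset_pairs (T U : choiceType) (A : {fset T}) (B : {fset U}) :
  #|` fset_pairs A B| = (#|` A| * #|` B|)%N.
Proof.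
rewrite card_fseq undup_id ?size_allpairs // allpairs_uniq //.
by move=> [x y] [x' y'] _ _ /= [-> ->].
Qed.

Lemma card_word_ball_gt0 S n : (0 < #|` word_ball S n|)%N.
Proof. by rewrite cardfs_gt0; apply/fset0Pn; exists 1%g; apply: word_ball1. Qed.

Lemma card_word_ball_mono S m n : (m <= n)%N -> (#|` word_ball S m| <= #|` word_ball S n|)%N.
Proof. by move=> mn; apply: fsubset_leq_card; apply/fsubsetP => x; apply: word_ball_mono. Qed.

Lemma word_ball_split S m n x : x \in word_ball S (m + n) ->
  exists y z, [/\ y \in word_ball S m, z \in word_ball S n & x = (y * z)%g].
Proof.
elim: n x => [|n IH] x; first by rewrite addn0 => xm; exists x, 1%g; rewrite word_ball0 eqxx mulg1.
rewrite addnS => /word_ballS[/IH[y [z [ym zn ->]]]|[w [s [/IH[y [z [ym zn ->]]] sS ->]]]].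
  by exists y, z; split=> //; apply: word_ball_subS.
exists y, (z * s)%g; rewrite mulgA; split=> //.
by rewrite -addn1; apply: word_ballM => //; apply: word_ball_gen.
Qed.

Lemma card_word_ballD S m n :
  (#|` word_ball S (m + n)| <= #|` word_ball S m| * #|` word_ball S n|)%N.
Proof.
rewrite -card_fset_pairs.
have sub : (word_ball S (m + n) `<=`
    [fset (u.1 * u.2)%g | u in fset_pairs (word_ball S m) (word_ball S n)])%fset.
  apply/fsubsetP => x /word_ball_split[y [z [ym zn ->]]].
  by apply/imfsetP; exists (y, z) => //=; rewrite in_fset_pairs ym.
by apply: leq_trans (fsubset_leq_card sub) _; apply: leq_imfset_card.
Qed.

Lemma growth_rate_bounds S rho : growth_rate R S = rho ->
  [/\ 1 <= rho, forall n, rho ^+ n <= #|` word_ball S n|%:R &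
     forall theta, rho < theta -> exists n0, forall n, (n0 <= n)%N ->
       #|` word_ball S n|%:R <= theta ^+ n].
Proof.
move=> gr; apply: growth_limit_bounds => //.
- by rewrite /word_ball /= cardfs1.
- by move=> n; rewrite ler1n card_word_ball_gt0.
- by move=> m n mn; rewrite ler_nat card_word_ball_mono.
- by move=> m n; rewrite -natrM ler_nat card_word_ballD.
Qed.

(** The form in which the geometry enters the growth estimates: a property of the word metric of [S]
    alone. *)
Definition product_bounded C S := forall n (Pi : {fset G * G}),
  (forall u, u \in Pi -> exists i j, [/\ (i + j <= n)%N, u.1 \in word_ball S i &
     u.2 \in word_ball S j]) ->
  (#|` Pi| <= C * n.+1 * #|` word_ball S (n + C)|)%N.

Lemma product_bounded_gt0 C S : product_bounded C S -> (0 < C)%N.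
Proof.
move=> H; have := H 0%N [fset (1%g, 1%g)]%fset; rewrite cardfs1.
case: C {H} => // H; have : (0 < 0 * 1 * #|` word_ball S (0 + 0)|)%N; last by rewrite !mul0n.
by apply: H => u; rewrite inE => /eqP ->; exists 0%N, 0%N; rewrite !word_ball0 !eqxx.
Qed.

(* Doubling: [phi_m = |B_m| / (4 C (m + C))] satisfies
   [phi_m ^ 2 <= phi_(2 m + C)]. *)
Lemma word_ball_linear_bound C S rho : product_bounded C S -> growth_rate R S = rho ->
  forall m, #|` word_ball S m|%:R <= 4 * C%:R * (m + C)%:R * rho ^+ (m + C).
Proof.
move=> pb gr m; have [rho1 _ rho_up] := growth_rate_bounds gr.
have C0 := product_bounded_gt0 pb.
pose F n := #|` word_ball S n|%:R : R.
have dbl n : F n ^+ 2 <= (C * (n + n).+1)%:R * F (n + n + C)%N.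
  rewrite /F -natrM -natrX ler_nat -mulnn -card_fset_pairs; apply: pb => u.
  by rewrite in_fset_pairs => /andP[u1 u2]; exists n, n.
pose lam n := 4 * C%:R * (n + C)%:R : R.
have lam0 n : 0 < lam n by rewrite /lam !mulr_gt0 ?ltr0n ?addn_gt0 ?C0 ?orbT.
rewrite -/(F m) -/(lam m) mulrC -ler_pdivrMr //; set phi := F m / lam m.
rewrite leNgt; apply/negP => big.
pose N := (m + C)%N; have N0 : (0 < N)%N by rewrite addn_gt0 C0 orbT.
have phi0 : 0 <= phi by rewrite divr_ge0 // ltW.
pose theta := phi `^ (N%:R^-1).
have thN : theta ^+ N = phi by apply: powR_rootK.
have th : rho < theta.
  rewrite ltNge; apply/negP => le; move: big; rewrite -/N ltNge -thN => /negP; apply.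
  by apply: lerXn2r => //; rewrite nnegrE ?powR_ge0 //; lra.
(* Iterated doubling: [mm j + C = 2^j * N], so [phi^(2^j) = theta^(mm j + C)], and along this
   sequence the balls would grow at the rate [theta > rho]. *)
pose mm := fix mm j := if j is j'.+1 then (mm j' + mm j' + C)%N else m.
have mmE j : (mm j + C = 2 ^ j * N)%N by elim: j => [|j IH]; rewrite ?mul1n //= expnS -mulnA -IH; lia.
have mmj j : (j <= mm j)%N by elim: j => [|j IH] //=; lia.
have low j : lam (mm j) * phi ^+ (2 ^ j) <= F (mm j).
  elim: j => [|j IH]; first by rewrite /= expr1 /phi mulrC divfK // gt_eqF.
  have c0 : 0 < (C * (mm j + mm j).+1)%:R :> R by rewrite ltr0n muln_gt0 C0.
  rewrite -(ler_pM2l c0); apply: le_trans (dbl (mm j)).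
  apply: (@le_trans _ _ ((lam (mm j) * phi ^+ (2 ^ j)) ^+ 2)); last first.
    by rewrite lerXn2r // nnegrE ?mulr_ge0 ?exprn_ge0 // ?ltW // ltW.
  have -> : phi ^+ (2 ^ j.+1) = (phi ^+ (2 ^ j)) ^+ 2 by rewrite -exprM mulnC -expnS.
  rewrite [X in _ <= X]exprMn mulrA ler_wpM2r ?sqr_ge0 //.
  have -> : lam (mm j.+1) = 2 * lam (mm j) by rewrite /lam /= !natrD; ring.
  rewrite expr2 mulrA (ler_pM2r (lam0 _)).
  have : (C * (mm j + mm j).+1 * 2 <= 4 * C * (mm j + C))%N by nia.
  by rewrite -(ler_nat R) /lam !natrM.
pose th' := (rho + theta) / 2.
have rt : rho < th' by rewrite /th'; lra.
have [n0 n0P] := rho_up th' rt.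
have := n0P (mm n0) (mmj n0); rewrite -/(F _) leNgt => /negP; apply.
have th'1 : 1 <= th' by lra.
apply: (@le_lt_trans _ _ (th' ^+ (2 ^ n0 * N))).
  by rewrite -mmE ler_weXn2l // leq_addr.
apply: (@lt_le_trans _ _ (theta ^+ (2 ^ n0 * N))).
  rewrite ltr_pXn2r ?nnegrE ?muln_gt0 ?expn_gt0 ?N0 //; rewrite /th'; lra.
rewrite mulnC exprM thN; apply: le_trans (low n0).
rewrite ler_peMl ?exprn_ge0 //.
have : (1 <= 4 * C * (mm n0 + C))%N by rewrite !muln_gt0 addn_gt0 C0 orbT.
by rewrite -(ler_nat R) /lam !natrM.
Qed.

End Word_growth.

(** * Generating sets marked by a free group *)

Section Evaluation_morphism.
Variables (G : groupType) (l : nat).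
Implicit Types (f : 'I_l -> G) (u v w : free_group l).

Definition gen (i : 'I_l) : free_group l := @FreeGroup l [:: (i, false)] isT.

Definition wlen w := size (word w).

Lemma free_eval1 f : free_eval f 1%g = 1%g.
Proof. by rewrite /free_eval big_nil. Qed.

Lemma free_evalV f w : free_eval f (w^-1)%g = ((free_eval f w)^-1)%g.
Proof. by apply: (mulgI (free_eval f w)); rewrite -free_evalM !mulgV free_eval1. Qed.

Lemma free_eval_gen f i : free_eval f (gen i) = f i.
Proof. by rewrite /free_eval big_seq1. Qed.

Lemma size_reduce (s : seq (letter l)) : (size (reduce s) <= size s)%N.
Proof.
elim: s => [//|a s IH]; rewrite /reduce /= -/(reduce s).
case: (reduce s) IH => [//|b t] /=; case: ifP => _ //= H.
by rewrite leqW // ltnW.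
Qed.

Lemma wlenM u v : (wlen (u * v)%g <= wlen u + wlen v)%N.
Proof. by rewrite /wlen -size_cat; apply: size_reduce. Qed.

Lemma wlenV u : (wlen (u^-1)%g <= wlen u)%N.
Proof. by apply: leq_trans (size_reduce _) _; rewrite size_rev size_map. Qed.

Lemma finite_wlen n : finite_set [set w | (wlen w <= n)%N].
Proof.
have fin : finite_set [set s : seq (letter l) | (size s <= n)%N].
  elim: n => [|n IH].
    by apply: (sub_finite_set _ (finite_set1 [::])) => s /=; rewrite leqn0 => /nilP.
  apply: (@sub_finite_set _ _ ([set [::]] `|` [set a.1 :: a.2 | a in setT `*` [set s : seq (letter l) | (size s <= n)%N]])).
    by case=> [|a s] /= sn; [left | right; exists (a, s)].
  rewrite finite_setU; split; first exact: finite_set1.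
  by apply: finite_image; apply: finite_setX => //; apply: finite_finset.
have -> : [set w | (wlen w <= n)%N] = (@word l) @^-1` [set s | (size s <= n)%N] by [].
by apply: finite_preimage fin => u v _ _; apply: val_inj.
Qed.

Definition rng f : {fset G} := [fset x in codom f]%fset.

Lemma rngP f x : reflect (exists i, f i = x) (x \in rng f).
Proof.
rewrite in_fset; apply: (iffP codomP) => [[i ->]|[i <-]]; first by exists i.
by exists i.
Qed.

Lemma free_eval_word_ball f w : generating_set (rng f) ->
  free_eval f w \in word_ball (rng f) (wlen w).
Proof.
move=> [symS _]; rewrite /free_eval /wlen.
elim: (word w) => [|a s IH]; first by rewrite big_nil word_ball1.
rewrite big_cons; apply: (@word_ballM _ _ 1) IH; apply: word_ball_gen.
have fa : f a.1 \in rng f by apply/rngP; exists a.1.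
by rewrite /eval_letter; case: a.2 => //; apply: symS.
Qed.

(** The [w i] are successive prefixes of a word for [g]. Bounding every [(w i)^-1 w j] controls all
    subwords, as insertion at arbitrary places requires. *)
Lemma word_ball_path f n g : g \in word_ball (rng f) n -> exists w : nat -> free_group l,
  [/\ w 0%N = 1%g, free_eval f (w n) = g &
      forall i j, (i <= j)%N -> (wlen ((w i)^-1 * w j)%g <= j - i)%N].
Proof.
elim: n g => [|n IH] g.
  rewrite word_ball0 => /eqP ->; exists (fun=> 1%g); split=> //; exact: free_eval1.
suff H : forall y s, y \in word_ball (rng f) n -> (wlen s <= 1)%N -> free_eval f s = (y^-1 * g)%g ->
    exists w : nat -> free_group l, [/\ w 0%N = 1%g, free_eval f (w n.+1) = g &
      forall i j, (i <= j)%N -> (wlen ((w i)^-1 * w j)%g <= j - i)%N].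
  move=> /word_ballS[gn|[y [s [yn /rngP[i si] gE]]]].
    by apply: (H g 1%g gn) => //; rewrite mulVg free_eval1.
  by apply: (H y (gen i) yn) => //; rewrite gE -si mulKg free_eval_gen.
move=> y s /IH[w [w0 wn wlip]] s1 sE.
exists (fun i => if (i <= n)%N then w i else (w n * s)%g); split=> //.
  by rewrite ltnn free_evalM wn sE mulVKg.
move=> i j ij; case: (leqP j n) => jn.
  by rewrite (leq_trans ij jn) wlip.
case: (leqP i n) => ni; last by rewrite mulVg.
rewrite mulgA; apply: leq_trans (wlenM _ _) _.
by apply: leq_trans (leq_add (wlip _ _ ni) s1) _; rewrite addn1 -subSn // leq_sub2r.
Qed.

Lemma free_eval_surj f : generating_set (rng f) -> forall g, exists w, free_eval f w = g.
Proof.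
by move=> [_ H] g; have [n /word_ball_path[w [_ wn _]]] := H g; exists (w n).
Qed.

End Evaluation_morphism.

Section Marked_groups.
Variable G : groupType.

Lemma free_eval_comp (l m : nat) (g : 'I_m -> G) (t : 'I_l -> free_group m) w :
  free_eval g (free_eval t w) = free_eval (fun i => free_eval g (t i)) w.
Proof.
rewrite {2}/free_eval (big_morph _ (free_evalM g) (free_eval1 g)).
by apply: eq_bigr => -[i []] _ //=; rewrite /eval_letter /= ?free_evalV.
Qed.

Lemma eq_free_eval (l : nat) (f g : 'I_l -> G) w : f =1 g -> free_eval f w = free_eval g w.
Proof. by move=> fg; apply: eq_bigr => a _; rewrite /eval_letter fg. Qed.

(* Centralizers of verbal images are defined by finitely many equations, in
   the variables of [f] and one more. *)
Lemma noetherian_centralizer (l : nat) (N : set (free_group l)) :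
  equationally_noetherian G ->
  exists2 E : {fset free_group l}, (forall r, r \in E -> N r) &
    forall (f : 'I_l -> G) y, (forall r, r \in E -> commute y (free_eval f r)) ->
      forall w, N w -> commute y (free_eval f w).
Proof.
move=> EN; pose t (i : 'I_l) := gen (lift ord0 i); pose y0 := gen (ord0 : 'I_l.+1).
pose c w := (y0 * free_eval t w * y0^-1 * (free_eval t w)^-1)%g.
have [S0 [fS0 S0N S0E]] := EN l.+1 isT [set c w | w in N].
(* Each equation of the finite system is the commutator of the extra variable with a word of [N];
   these words form [E]. *)
have [E EN' ES0] : exists2 E : {fset free_group l}, (forall r, r \in E -> N r) &
    S0 `<=` [set c r | r in [set` E]].
  have /choice[p pP] : forall s : free_group l.+1, exists w, S0 s -> N w /\ c w = s.
    move=> s; case: (pselect (S0 s)) => [/[dup] s0 /S0N[w Nw cw]|ns]; first by exists w.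
    by exists 1%g.
  have /finite_fsetP[S1 S1E] := fS0.
  exists [fset p s | s in S1]%fset.
    move=> r /imfsetP[s sS ->]; have : S0 s by rewrite S1E.
    by move=> /pP[].
  move=> s s0; exists (p s); last by have [] := pP s s0.
  by apply/imfsetP; exists s => //; move: s0; rewrite S1E.
exists E => // f y com w Nw.
pose g (i : 'I_l.+1) := if unlift ord0 i is Some j then f j else y.
have gt u : free_eval g (free_eval t u) = free_eval f u.
  by rewrite free_eval_comp; apply: eq_free_eval => i; rewrite free_eval_gen /g liftK.
have gy : free_eval g y0 = y by rewrite free_eval_gen /g unlift_none.
have gc u : free_eval g (c u) = (y * free_eval f u * y^-1 * (free_eval f u)^-1)%g.
  by rewrite /c !free_evalM !free_evalV gt gy.
have : solutions S0 g.
  move=> s /ES0[r rE <-]; rewrite gc.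
  by rewrite (com r rE) mulgK mulgV.
rewrite S0E => /(_ (c w)) H; have := H (ex_intro2 _ _ w Nw erefl); rewrite gc => e.
rewrite /commute; apply: (mulIg (y^-1)%g); apply: (mulIg ((free_eval f w)^-1)%g).
by rewrite e mulgK mulgV.
Qed.

(** With equal kernels, the value of a word under one tuple determines its value under the other,
    and the resulting map is an automorphism carrying one tuple to the other. *)
Lemma aut_orbit_of_kernel (l : nat) (f f0 : 'I_l -> G) : generating_set (rng f) ->
  generating_set (rng f0) -> (forall w, free_eval f w = 1%g <-> free_eval f0 w = 1%g) ->
  aut_orbit (rng f) = aut_orbit (rng f0).
Proof.
suff main (f1 f2 : 'I_l -> G) : generating_set (rng f1) -> generating_set (rng f2) ->
    (forall w, free_eval f1 w = 1%g <-> free_eval f2 w = 1%g) ->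
    aut_orbit (rng f1) `<=` aut_orbit (rng f2).
  move=> g1 g2 K; apply/seteqP; split; first exact: main.
  by apply: main => // w; split=> /K.
move=> g1 g2 K.
have /choice[p pP] := free_eval_surj g2.
have eqK u v : free_eval f1 u = free_eval f1 v <-> free_eval f2 u = free_eval f2 v.
  have e f' : free_eval f' u = free_eval f' v <-> free_eval f' (u * v^-1)%g = 1%g.
    rewrite free_evalM free_evalV; split=> [->|/eqP]; first by rewrite mulgV.
    by rewrite divg_eq1 => /eqP.
  by rewrite !e.
pose ph g := free_eval f1 (p g).
have phE w : ph (free_eval f2 w) = free_eval f1 w by apply/eqK; rewrite pP.
have phM : {morph ph : x y / (x * y)%g}.
  by move=> x y; rewrite -(pP x) -(pP y) -free_evalM !phE free_evalM.
have phi_inj : injective ph by move=> x y /eqK; rewrite !pP.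
have ph_bij : bijective ph.
  have /choice[q qP] := free_eval_surj g1.
  exists (fun g => free_eval f2 (q g)) => x; last by rewrite phE.
  by apply: phi_inj; rewrite phE qP.
pose phm : {multiplicative G -> G} := HB.pack ph (isMultiplicative.Build G G ph phM).
move=> _ [psi psib <-]; exists (psi \o phm : {multiplicative G -> G}).
  exact: bij_comp.
apply/fsetP => x; apply/imfsetP/imfsetP => /= -[y].
  move=> /rngP[i <-] ->; exists (f1 i); first by apply/rngP; exists i.
  by rewrite -(free_eval_gen f2) phE free_eval_gen.
move=> /rngP[i <-] ->; exists (f2 i); first by apply/rngP; exists i.
by rewrite -(free_eval_gen f2) phE free_eval_gen.
Qed.

End Marked_groups.

(** * Amplification of lower bounds on balls *)

Lemma expr_beats_quadratic (R : realType) (theta c : R) : 1 < theta ->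
  exists n0, forall n, (n0 <= n)%N -> c * n.+1%:R ^+ 2 <= theta ^+ n.
Proof.
move=> th1; pose s := Num.sqrt theta; have s1 : 1 < s by rewrite -[ltLHS]sqrtr1 ltr_sqrt //; lra.
have [n0 n0P] := expr_beats_linear (Num.max c 1) s1.
exists n0 => n /n0P; have -> : theta = s ^+ 2 by rewrite sqr_sqrtr //; lra.
have c1 : 1 <= Num.max c 1 by rewrite le_max lexx orbT.
have cc : c <= Num.max c 1 by rewrite le_max lexx.
move: (Num.max c 1) c1 cc => c2 c1 cc le.
rewrite -exprM mulnC exprM; apply: (@le_trans _ _ ((c2 * n.+1%:R) ^+ 2)); last first.
  by rewrite lerXn2r // nnegrE ?mulr_ge0 ?exprn_ge0 //; lra.
rewrite exprMn ler_wpM2r ?sqr_ge0 //; apply: le_trans cc _.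
by rewrite expr2 ler_peMl //; lra.
Qed.

Lemma sum_ord_from (R : realType) (f : nat -> R) (a N : nat) :
  \sum_(i < N | (a <= i)%N) f i = \sum_(a <= i < N) f i.
Proof. by rewrite big_geq_mkord. Qed.

Lemma pred_split n i : (i < n)%N -> n.-1 = (n - i.+1 + i)%N.
Proof. by lia. Qed.

Section Bootstrap.
Variables (R : realType) (G : groupType) (C : nat) (rho : R).
Hypothesis rho1 : 1 < rho.
Implicit Types S : {fset G}.

(** A telescoping sum, used in a summation by parts that turns a sum over elements sorted by length
    into a sum of ball sizes. *)
Lemma geometric_tail (n N a : nat) : (a <= N)%N -> (N <= n)%N ->
  (rho - 1) * \sum_(i < N | (a <= i)%N) rho ^+ (n - i.+1) <= rho ^+ (n - a).
Proof.
have rho0 : 0 <= rho by have := rho1; lra.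
move=> aN Nn; suff -> : (rho - 1) * \sum_(i < N | (a <= i)%N) rho ^+ (n - i.+1) =
  rho ^+ (n - a) - rho ^+ (n - N) by rewrite gerBl exprn_ge0.
rewrite (sum_ord_from (fun i => rho ^+ (n - i.+1))).
elim: N aN Nn => [|N IH] aN Nn.
  by move: aN; rewrite leqn0 => /eqP ->; rewrite big_geq // mulr0 subrr.
move: aN; rewrite leq_eqVlt => /predU1P[->|aN]; first by rewrite big_geq // mulr0 subrr.
have aN' : (a <= N)%N by [].
rewrite (big_nat_recr _ _ _ aN') mulrDr (IH aN' (ltnW Nn)).
have -> : rho ^+ (n - N) = rho * rho ^+ (n - N.+1) by rewrite -exprS -subSn.
by ring.
Qed.

(** Count the pairs with [|x| <= N] and [|y| <= n - |x|]. With the lower bound applied to [y] and,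
    after summation by parts, to [x], each radius from [m0] to [N - 1] contributes
    [(rho - 1) * beta^2 * rho^(n-1)]. The resulting factor [N - m0] cancels the linear factor of the
    product inequality. *)
Lemma bootstrap S (beta : R) m0 n1 : product_bounded C S -> 0 <= beta ->
  (forall m, (m0 <= m <= n1)%N -> beta * rho ^+ m <= #|` word_ball S m|%:R) ->
  forall m, (4 * m0 + 1 + C <= m <= n1)%N ->
    (rho - 1) / (2 * C%:R * rho ^+ C.+1) * beta ^+ 2 * rho ^+ m <= #|` word_ball S m|%:R.
Proof.
move=> pb beta0 low m /andP[m_ge mn1]; have C0 := product_bounded_gt0 pb.
pose F i := #|` word_ball S i|%:R : R.
have rho0 : 0 < rho by have := rho1; lra.
pose n := (m - C)%N; pose N := (n - m0)%N.
have mE : m = (n + C)%N by rewrite /n subnK //; lia.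
have nm0 : (4 * m0 + 1 <= n)%N by rewrite /n; lia.
(* Word length, meaningful on the ball of radius [N] only. *)
pose len (g : G) := find (fun i => g \in word_ball S i) (iota 0 N.+1).
have lenP g : g \in word_ball S N -> [/\ (len g <= N)%N, g \in word_ball S (len g) &
    forall i, (i <= N)%N -> g \in word_ball S i -> (len g <= i)%N].
  move=> gN; have hs : has (fun i => g \in word_ball S i) (iota 0 N.+1).
    by apply/hasP; exists N; [rewrite mem_iota leqnn | exact: gN].
  have lN : (len g <= N)%N by rewrite -ltnS; move: hs; rewrite has_find size_iota.
  split=> //; first by have := nth_find 0%N hs; rewrite nth_iota.
  move=> i iN gi; rewrite leqNgt; apply/negP => /(before_find 0%N).
  by rewrite nth_iota // gi.
pose Pi := [fset u in [seq (x, y) | x <- word_ball S N, y <- word_ball S (n - len x)]]%fset.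
have cardPi : (#|` Pi| = \sum_(x <- word_ball S N) #|` word_ball S (n - len x)|)%N.
  rewrite card_fseq undup_id; last first.
    apply: allpairs_uniq_dep => [|x _|[x y] [x' y'] _ _ /= [-> ->]] //.
    exact: fset_uniq.
  by rewrite size_allpairs_dep sumnE big_map.
have PiP : (#|` Pi| <= C * n.+1 * #|` word_ball S (n + C)|)%N.
  apply: pb => u; rewrite in_fset => /allpairsPdep[x [y [xN yn ->]]].
  have [lN xl _] := lenP x xN; exists (len x), (n - len x)%N; split=> //.
  by rewrite subnKC //; lia.
have H1 : beta * \sum_(x <- word_ball S N) rho ^+ (n - len x) <= #|` Pi|%:R.
  rewrite cardPi natr_sum mulr_sumr big_seq [leRHS]big_seq; apply: ler_sum => x xN.
  by have [lN _ _] := lenP x xN; apply: low; rewrite /N in lN; lia.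
have H2 : (rho - 1) * \sum_(i < N) rho ^+ (n - i.+1) * F i <=
    \sum_(x <- word_ball S N) rho ^+ (n - len x).
  have -> : \sum_(i < N) rho ^+ (n - i.+1) * F i =
      \sum_(x <- word_ball S N) \sum_(i < N | (len x <= i)%N) rho ^+ (n - i.+1).
    under [RHS]eq_bigr do rewrite big_mkcond.
    rewrite exchange_big /=; apply: eq_bigr => i _.
    have iN : (i <= N)%N := ltnW (ltn_ord i).
    rewrite -big_mkcond /= /F card_fset_sum1 natr_sum mulr_sumr.
    have -> : \sum_(x <- word_ball S N | (len x <= i)%N) rho ^+ (n - i.+1) =
        \sum_(x <- [seq x <- word_ball S N | (len x <= i)%N]) rho ^+ (n - i.+1).
      by rewrite big_filter.
    rewrite (perm_big [seq x <- word_ball S N | (len x <= i)%N]) /=.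
      by apply: eq_bigr => x _; rewrite mulr1.
    apply: uniq_perm => [||x]; [exact: fset_uniq | by rewrite filter_uniq // fset_uniq |].
    rewrite mem_filter.
    apply/idP/andP => [xi|[li xN]].
      have xN := word_ball_mono iN xi; split=> //.
      by have [_ _] := lenP x xN; apply.
    by have [_ xl _] := lenP x xN; apply: word_ball_mono li xl.
  rewrite mulr_sumr big_seq [leRHS]big_seq; apply: ler_sum => x xN.
  by have [lN _ _] := lenP x xN; apply: geometric_tail => //; rewrite /N leq_subr.
have H3 : (N - m0)%N%:R * (beta * rho ^+ n.-1) <= \sum_(i < N) rho ^+ (n - i.+1) * F i.
  rewrite (bigID (fun i : 'I_N => (m0 <= i)%N)) /=.
  apply: (@le_trans _ _ (\sum_(i < N | (m0 <= i)%N) rho ^+ (n - i.+1) * F i)); last first.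
    by rewrite lerDl sumr_ge0 // => i _; rewrite mulr_ge0 // exprn_ge0 // ltW.
  apply: (@le_trans _ _ (\sum_(i < N | (m0 <= i)%N) beta * rho ^+ n.-1)).
    rewrite (sum_ord_from (fun=> beta * rho ^+ n.-1)).
    by rewrite big_const_nat iter_addr addr0 mulr_natl.
  apply: ler_sum => i mi.
  have iN : (i < n)%N := leq_trans (ltn_ord i) (leq_subr _ _).
  rewrite (pred_split iN).
  rewrite exprD mulrCA ler_wpM2l ?exprn_ge0 //; first exact: ltW.
  apply: low; rewrite mi /=; apply: leq_trans mn1; rewrite ltnW //.
  by apply: leq_trans iN (leq_subr _ _).
(* The bound for [y] requires [m0 <= n - |x|], whence [N = n - m0]. That at least [(n + 1) / 2]
   radii remain amounts to [4 * m0 + 1 <= n]. *)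
have H4 : n.+1%:R <= 2 * (N - m0)%N%:R :> R.
  by rewrite -natrM ler_nat /N; lia.
have Fm : #|` word_ball S m|%:R = F (n + C)%N by rewrite /F -mE.
have PiR : #|` Pi|%:R <= C%:R * n.+1%:R * F (n + C)%N.
  by rewrite /F -!natrM ler_nat.
rewrite Fm mE.
have cR : 0 < C%:R :> R by rewrite ltr0n.
have dn : 0 < n.+1%:R :> R by rewrite ltr0n.
have k1 : 0 < C%:R * n.+1%:R :> R by rewrite mulr_gt0.
rewrite -(ler_pM2l k1); apply: le_trans PiR; apply: le_trans H1.
apply: le_trans (ler_wpM2l beta0 H2).
have r1 : 0 <= rho - 1 by have := rho1; lra.
apply: le_trans (ler_wpM2l beta0 (ler_wpM2l r1 H3)).
have -> : rho ^+ (n + C) = rho ^+ n.-1 * rho ^+ C.+1.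
  by rewrite -exprD; congr (_ ^+ _); lia.
have rC : rho ^+ C.+1 != 0 by rewrite expf_neq0 // gt_eqF.
have -> : C%:R * n.+1%:R * ((rho - 1) / (2 * C%:R * rho ^+ C.+1) * beta ^+ 2 *
    (rho ^+ n.-1 * rho ^+ C.+1)) = (rho - 1) * beta ^+ 2 * rho ^+ n.-1 * (n.+1%:R / 2).
  by field; rewrite rC gt_eqF.
have -> : beta * ((rho - 1) * ((N - m0)%N%:R * (beta * rho ^+ n.-1))) =
  (rho - 1) * beta ^+ 2 * rho ^+ n.-1 * (N - m0)%N%:R by ring.
apply: ler_wpM2l; last by lra.
by rewrite !mulr_ge0 // ?sqr_ge0 // exprn_ge0 // ltW.
Qed.

(** [beta] precedes [m0], which will be chosen in terms of it. Starting from [c * beta = 2], the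
    iteration gives [c * be j = 2^(2^j)] at a length of order [4^j], more than the upper bound
    allows for large [j]; [n1] is such a length, the same for all [S]. *)
Lemma no_uniform_lower_bound : exists2 beta : R, 0 < beta & forall m0, exists n1, forall S,
  product_bounded C S -> growth_rate R S = rho ->
  ~ (forall m, (m0 <= m <= n1)%N -> beta * rho ^+ m <= #|` word_ball S m|%:R).
Proof.
have rho0 : 0 < rho by have := rho1; lra.
case: (posnP C) => C0.
  exists 1 => // m0; exists 0%N => S /product_bounded_gt0; rewrite C0 //.
have cR : 0 < C%:R :> R by rewrite ltr0n.
pose c := (rho - 1) / (2 * C%:R * rho ^+ C.+1).
have c0 : 0 < c.
  rewrite /c divr_gt0 ?mulr_gt0 ?exprn_gt0 //; have := rho1; lra.
exists (2 / c) => [|m0]; first by rewrite divr_gt0.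
pose D := c * (4 * C%:R * rho ^+ C * (m0 + C + 1)%N%:R).
have two1 : 1 < 2 :> R by rewrite ltr1n.
have [n0 n0P] := expr_beats_quadratic (D + 1) two1.
pose mm := fix mm j := if j is j'.+1 then (4 * mm j' + 1 + C)%N else m0.
pose be := fix be j := if j is j'.+1 then c * be j' ^+ 2 else 2 / c.
exists (mm n0) => S pb gr low.
have mm_mono j : (mm j <= mm j.+1)%N by rewrite /=; lia.
have mm_le i j : (i <= j)%N -> (mm i <= mm j)%N.
  by move=> /subnK <-; elim: (j - i)%N => [//|k IH]; rewrite addSn; apply: leq_trans IH (mm_mono _).
have beE j : c * be j = 2 ^+ (2 ^ j).
  elim: j => [|j IH] /=; first by rewrite expr1 mulrC divfK // gt_eqF.
  by rewrite expnS mulnC exprM -IH; ring.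
have be0 j : 0 <= be j.
  by rewrite -(pmulr_rge0 _ c0) beE exprn_ge0.
have step j : forall m, (mm j <= m <= mm n0)%N -> be j * rho ^+ m <= #|` word_ball S m|%:R.
  elim: j => [|j IH] m; first exact: low.
  by move=> mI; apply: (bootstrap pb (be0 j) IH).
have := step n0 (mm n0); rewrite !leqnn => /(_ isT) H.
have := word_ball_linear_bound pb gr (mm n0) => H'.
have mmE j : (mm j + C + 1 <= 4 ^ j * (m0 + C + 1))%N.
  by elim: j => [|j IH] /=; rewrite ?mul1n // expnS -mulnA; lia.
have beD : be n0 <= 4 * C%:R * rho ^+ C * (mm n0 + C)%N%:R.
  rewrite -(ler_pM2r (exprn_gt0 (mm n0) rho0)); apply: le_trans H _; apply: le_trans H' _.
  by rewrite exprD le_eqVlt; apply/orP; left; apply/eqP; ring.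
have : 2 ^+ (2 ^ n0) <= D * ((2 ^ n0) .+1)%:R ^+ 2.
  rewrite -beE /D -[leRHS]mulrA ler_pM2l // ; apply: le_trans beD _.
  rewrite -!mulrA !ler_pM2l ?exprn_gt0 //.
  have : (mm n0 + C <= (m0 + C + 1) * (2 ^ n0).+1 ^ 2)%N.
    have := mmE n0; have -> : (4 ^ n0 = (2 ^ n0) ^ 2)%N by rewrite -expnM mulnC expnM.
    move=> H2; apply: (@leq_trans (mm n0 + C + 1)); first by rewrite leq_addr.
    by apply: leq_trans H2 _; rewrite mulnC leq_mul2l leq_sqr leqnSn orbT.
  by rewrite -(ler_nat R) natrM natrX.
have := n0P (2 ^ n0)%N (ltnW (ltn_expl n0 (isT : 1 < 2)%N)); rewrite mulrDl mul1r.
have : 0 < (2 ^ n0).+1%:R ^+ 2 :> R by rewrite exprn_gt0.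
move: (D * _) => Dy Dy0 H1 H2; have : (1 : R) <= 0 by [lra].
by rewrite ler10.
Qed.

End Bootstrap.

(** * Insertion of relators *)

Lemma card_disjoint_family (T U : choiceType) (A : {fset T}) (V : T -> {fset U})
    (W : {fset U}) t : (forall g, g \in A -> (t <= #|` V g|)%N) ->
  (forall g x, g \in A -> x \in V g -> x \in W) ->
  (forall g g' x, g \in A -> g' \in A -> x \in V g -> x \in V g' -> g = g') ->
  (t * #|` A| <= #|` W|)%N.
Proof.
move=> tV VW disj.
apply: (@leq_trans (\sum_(g <- A) \sum_(x <- W) (x \in V g))%N).
  rewrite mulnC card_fset_sum1 big_distrl /= big_seq [leqRHS]big_seq.
  apply: leq_sum => g gA; rewrite mul1n; apply: leq_trans (tV g gA) _.
  have -> : (\sum_(x <- W) (x \in V g) = \sum_(x <- W | x \in V g) 1)%N.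
    by rewrite [RHS]big_mkcond /=; apply: eq_bigr => x _; case: (x \in V g).
  rewrite sum1_count -size_filter; apply: uniq_leq_size => // x xV.
  by rewrite mem_filter xV (VW g).
rewrite exchange_big /= card_fset_sum1; apply: leq_sum => x _.
have -> : (\sum_(g <- A) (x \in V g) = \sum_(g <- A | x \in V g) 1)%N.
  by rewrite [RHS]big_mkcond /=; apply: eq_bigr => g _; case: (x \in V g).
rewrite sum1_count -size_filter.
case E : [seq g <- A | x \in V g] => [//|g [//|g' s]] /=.
have u : uniq [seq g <- A | x \in V g] by rewrite filter_uniq.
have : g \in [seq g <- A | x \in V g] by rewrite E mem_head.
have : g' \in [seq g <- A | x \in V g] by rewrite E in_cons mem_head orbT.
rewrite !mem_filter => /andP[xg' g'A] /andP[xg gA].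
by move: u; rewrite E /= in_cons (disj g g' x) // eqxx.
Qed.

Lemma conj_eq_commute (G : groupType) (a b c : G) :
  (a * c * a^-1 = b * c * b^-1)%g -> commute (a^-1 * b)%g c.
Proof.
move=> e; rewrite /commute -mulgA.
have -> : (b * c = a * c * a^-1 * b)%g by rewrite e mulgVK.
by rewrite -!mulgA mulKg.
Qed.

Section Insertion.
Variables (R : realType) (G : groupType) (l C N0 : nat) (rho : R).
Hypothesis rho1 : 1 < rho.
Implicit Types (f phi : 'I_l -> G) (u v w r z : free_group l).

Definition relators f : set (free_group l) := [set w | free_eval f w = 1%g].

Definition same_ball n f phi := forall w, (wlen w <= n)%N -> free_eval phi w = 1%g -> free_eval f w = 1%g.

(** This keeps words with different values under [f] apart under [phi], so that the sets of lifts of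
    distinct elements are disjoint. *)
Lemma same_ball_eq n f phi u v : same_ball (n + n) f phi -> (wlen u <= n)%N -> (wlen v <= n)%N ->
  free_eval phi u = free_eval phi v -> free_eval f u = free_eval f v.
Proof.
move=> sb un vn e; apply: (mulgI ((free_eval f u)^-1)%g); rewrite mulVg -free_evalV -free_evalM.
apply/esym/sb; last by rewrite free_evalM free_evalV e mulVg.
by apply: leq_trans (wlenM _ _) (leq_add (leq_trans (wlenV _) un) vn).
Qed.

Definition verbal_centralizer f phi : set G :=
  [set y | forall w, relators f w -> commute y (free_eval phi w)].

(* The prefixes [w i] of a word for [g] give the elements
   [w_i r w_i^-1 w_k], which all map to [g] under [f].  If few of them are
   distinct under [phi], some subword [z] of length at least [h] satisfies
   [phi z] in the centralizer of [phi (ker f)]; such [g] are rare. *)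
Lemma insertion_dichotomy phi (E : {fset free_group l}) t h Q (w : nat -> free_group l) :
  (Q = t.+1 ^ #|` E|)%N ->
  (forall r, r \in E -> 
    (#|` [fset y in [seq free_eval phi (w (i * h)%N * r * (w (i * h)%N)^-1)%g | i <- iota 0 Q.+1]]%fset| <= t)%N) ->
  exists i j, [/\ (i < j <= Q)%N &
    forall r, r \in E -> commute (free_eval phi ((w (i * h)%N)^-1 * w (j * h)%N)%g) (free_eval phi r)].
Proof.
move=> QE few.
pose V r := [fset y in [seq free_eval phi (w (i * h)%N * r * (w (i * h)%N)^-1)%g | i <- iota 0 Q.+1]]%fset.
pose x (r : free_group l) (i : nat) := free_eval phi (w (i * h)%N * r * (w (i * h)%N)^-1)%g.
(* Each of the [Q + 1] positions is coloured by the values of its insertions, for all [r] in [E]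
   together. There are [Q] colours, so two positions agree for every [r]. *)
pose col (i : 'I_Q.+1) : {ffun E -> 'I_t.+1} :=
  [ffun r : E => inord (index (x (fsval r) i) (V (fsval r)))].
have xV (r : E) (i : 'I_Q.+1) : x (fsval r) i \in V (fsval r).
  rewrite in_fset; apply: (map_f (fun i => x (fsval r) i)).
  by rewrite mem_iota add0n leq0n ltn_ord.
have ncol : ~~ injectiveb col.
  apply/negP => /injectiveP/leq_card; rewrite card_ord card_ffun card_ord -cardfE -QE.
  by rewrite ltnn.
move/injectivePn: ncol => [i0 [j0 ij cij]].
have eqx (r : E) : x (fsval r) i0 = x (fsval r) j0.
  have lt (i : 'I_Q.+1) : (index (x (fsval r) i) (V (fsval r)) < t.+1)%N.
    by rewrite ltnS; apply: leq_trans (few _ (fsvalP r)); rewrite ltnW // index_mem xV.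
  have := congr1 (fun c : {ffun E -> 'I_t.+1} => val (c r)) cij.
  rewrite /= !ffunE !inordK //.
  exact: (index_inj 1%g (xV r i0) (xV r j0)).
have fin (i j : 'I_Q.+1) : (i < j)%N -> (forall r : E, x (fsval r) i = x (fsval r) j) ->
    exists i j, [/\ (i < j <= Q)%N &
    forall r, r \in E -> commute (free_eval phi ((w (i * h)%N)^-1 * w (j * h)%N)%g) (free_eval phi r)].
  move=> lij e; exists i, j; split; first by rewrite lij -ltnS ltn_ord.
  move=> r1 rE; have := e [` rE]%fset; rewrite /x /= !free_evalM !free_evalV.
  exact: conj_eq_commute.
have : (val i0 != val j0) by apply: contra ij => /eqP/val_inj ->.
rewrite neq_ltn => /orP[] lij; first exact: (fin i0 j0).
by apply: (fin j0 i0) => // r; rewrite eqx.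
Qed.

(** An element of [B_k(f)] with more than [t] distinct insertions of some relator contributes
    [t + 1] elements to the ball of [phi], disjointly from the others. Any other element is a
    prefix, a piece with at most [N0] possible values, and a suffix. The piece takes up at least [h]
    of the length, whence the exponent [k - h], and [(Q + 1)^2] bounds the choices of its ends. *)
Lemma insertion_lower_bound f phi (E : {fset free_group l}) t h Q k q (a : R) :
  generating_set (rng f) -> generating_set (rng phi) ->
  (forall r, r \in E -> relators f r) -> (forall r, r \in E -> (wlen r <= q)%N) ->
  same_ball (k + q + (k + q)) f phi ->
  (forall y, (forall r, r \in E -> commute y (free_eval phi r)) -> verbal_centralizer f phi y) ->
  ~ more_than N0 (verbal_centralizer f phi) ->
  (Q = t.+1 ^ #|` E|)%N -> (Q * h <= k)%N -> 0 <= a ->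
  (forall i, (i <= k)%N -> #|` word_ball (rng f) i|%:R <= a * rho ^+ i) ->
  t.+1%:R * (#|` word_ball (rng f) k|%:R - Q.+1%:R ^+ 2 * (N0%:R * a ^+ 2 * rho ^+ (k - h)))
    <= #|` word_ball (rng phi) (k + q)|%:R.
Proof.
move=> gf gphi Eker Eq sb cent ncent QE Qh a0 Fa.
have rho0 : 0 <= rho by have := rho1; lra.
pose B := word_ball (rng f) k.
have /choice[w wP] : forall g, exists w : nat -> free_group l, g \in B ->
    [/\ w 0%N = 1%g, free_eval f (w k) = g &
      forall i j, (i <= j)%N -> (wlen ((w i)^-1 * w j)%g <= j - i)%N].
  move=> g; case: (boolP (g \in B)) => [/word_ball_path[w wP]|_]; first by exists w.
  by exists (fun=> 1%g).
have wl g i : g \in B -> (wlen (w g i) <= i)%N.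
  by move=> /wP[w0 _ wlip]; have := wlip _ _ (leq0n i); rewrite w0 invg1 mul1g subn0.
pose V g r := [fset y in [seq free_eval phi (w g (i * h)%N * r * (w g (i * h)%N)^-1)%g
  | i <- iota 0 Q.+1]]%fset.
pose goodP g := exists2 r, r \in E & (t < #|` V g r|)%N.
pose Bg := [fset g in B | `[< goodP g >]]%fset.
pose Bb := [fset g in B | ~~ `[< goodP g >]]%fset.
have cardB : (#|` B| = #|` Bg| + #|` Bb|)%N.
  have e1 : (B `&` Bg)%fset = Bg by apply/fsetP => g; rewrite !inE /=; case: (g \in B).
  have e2 : (B `\` Bg)%fset = Bb by apply/fsetP => g; rewrite !inE /=; case: (g \in B); rewrite ?andbT.
  by rewrite -(cardfsID Bg B) e1 e2.
have ihk i : (i <= Q)%N -> (i * h <= k)%N.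
  by move=> iQ; apply: leq_trans Qh; rewrite leq_mul2r iQ orbT.
have good_part : (t.+1 * #|` Bg| <= #|` word_ball (rng phi) (k + q)|)%N.
  have /choice[r rP] : forall g, exists r, g \in Bg -> r \in E /\ (t < #|` V g r|)%N.
    move=> g; case: (boolP (g \in Bg)) => [|_]; last by exists 1%g.
    by rewrite !inE /= => /andP[_ /asboolP[r rE tr]]; exists r.
  pose W g := [fset (y * free_eval phi (w g k))%g | y in V g (r g)]%fset.
  have WP g x : g \in Bg -> x \in W g -> exists u,
      [/\ (wlen u <= k + q)%N, free_eval phi u = x & free_eval f u = g].
    move=> gB /imfsetP[y /= yV ->]; have [rE _] := rP g gB.
    have {}gB : g \in B by move: gB; rewrite !inE => /andP[].
    have [w0 wk wlip] := wP g gB.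
    move: yV; rewrite in_fset => /mapP[i]; rewrite mem_iota add0n ltnS leq0n /= => iQ ->.
    exists (w g (i * h)%N * r g * ((w g (i * h)%N)^-1 * w g k))%g; split.
    - apply: leq_trans (wlenM _ _) _.
      apply: leq_trans (leq_add (leq_trans (wlenM _ _) (leq_add (wl _ _ gB) (Eq _ rE))) (wlip _ _ (ihk i iQ))) _.
      by have := ihk i iQ; lia.
    - by rewrite !free_evalM !mulgA.
    - rewrite !free_evalM free_evalV (Eker _ rE) mulg1 mulVKg wk //.
  apply: (@card_disjoint_family _ _ Bg W).
  - move=> g gB; have [_ tV] := rP g gB; rewrite card_imfset //=; exact: mulIg.
  - move=> g x gB /(WP g x gB)[u [ul <- _]].
    by apply: word_ball_mono ul _; apply: free_eval_word_ball.
  - move=> g g' x gB g'B /(WP g x gB)[u [ul ux <-]] /(WP g' x g'B)[v [vl vx <-]].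
    by apply: (same_ball_eq sb ul vl); rewrite ux vx.
pose ZP x := exists z, [/\ (wlen z <= k)%N, free_eval f z = x &
  verbal_centralizer f phi (free_eval phi z)].
pose ZZ := [fset x in B | `[< ZP x >]]%fset.
have cardZ : (#|` ZZ| <= N0)%N.
  have /choice[z zP] : forall x, exists z, x \in ZZ -> [/\ (wlen z <= k)%N, free_eval f z = x &
      verbal_centralizer f phi (free_eval phi z)].
    move=> x; case: (boolP (x \in ZZ)) => [|_]; last by exists 1%g.
    by rewrite !inE /= => /andP[_ /asboolP[z zP]]; exists z.
  rewrite leqNgt; apply/negP => big; apply: ncent.
  exists [fset free_eval phi (z x) | x in ZZ]%fset.
    by move=> y /imfsetP[x /= xZ ->]; have [] := zP x xZ.
  rewrite card_in_imfset //= => x x' xZ x'Z e.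
  have [zl zx _] := zP x xZ; have [zl' zx' _] := zP x' x'Z.
  rewrite -zx -zx'; apply: (same_ball_eq sb) e.
    exact: leq_trans zl (leq_addr _ _).
  exact: leq_trans zl' (leq_addr _ _).
pose IJ := seq.filter (fun ij : 'I_Q.+1 * 'I_Q.+1 => (ij.1 < ij.2)%N) (enum {: 'I_Q.+1 * 'I_Q.+1}).
pose L (ij : 'I_Q.+1 * 'I_Q.+1) := [seq (x.1 * x.2 * y)%g |
  x <- fset_pairs (word_ball (rng f) (ij.1 * h)%N) ZZ, y <- word_ball (rng f) (k - ij.2 * h)%N].
have bad_sub : {subset Bb <= [seq y | ij <- IJ, y <- L ij]}.
  move=> g; rewrite !inE /= => /andP[gB /asboolPn ng].
  have few r : r \in E -> (#|` V g r| <= t)%N.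
    by move=> rE; rewrite leqNgt; apply/negP => big; apply: ng; exists r.
  have [i [j [/andP[ij jQ] com]]] := insertion_dichotomy QE few.
  have [w0 wk wlip] := wP g gB.
  have iQ1 : (i < Q.+1)%N by rewrite ltnS (leq_trans (ltnW ij) jQ).
  have jQ1 : (j < Q.+1)%N by rewrite ltnS.
  have ijh : (i * h <= j * h)%N by rewrite leq_mul2r (ltnW ij) orbT.
  apply/allpairsPdep; exists (Ordinal iQ1, Ordinal jQ1), g; split=> //.
    by rewrite mem_filter /= ij mem_enum.
  apply/allpairsP => /=.
  exists ((free_eval f (w g (i * h)%N), free_eval f ((w g (i * h)%N)^-1 * w g (j * h)%N)%g),
    free_eval f ((w g (j * h)%N)^-1 * w g k)%g); split=> /=.
  - rewrite in_fset_pairs /=; apply/andP; split.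
      exact: word_ball_mono (wl _ _ gB) (free_eval_word_ball _ gf).
    have zl : (wlen ((w g (i * h)%N)^-1 * w g (j * h)%N)%g <= k)%N.
      by apply: leq_trans (wlip _ _ ijh) _; apply: leq_trans (leq_subr _ _) (ihk j jQ).
    rewrite !inE /= (word_ball_mono zl (free_eval_word_ball _ gf)) /=.
    apply/asboolP; exists ((w g (i * h)%N)^-1 * w g (j * h)%N)%g; split=> //.
    exact: cent com.
  - apply: word_ball_mono (wlip _ _ (ihk j jQ)) (free_eval_word_ball _ gf).
  - by rewrite -!free_evalM !mulVKg wk.
have cardBb : #|` Bb|%:R <= Q.+1%:R ^+ 2 * (N0%:R * a ^+ 2 * rho ^+ (k - h)).
  have := uniq_leq_size (fset_uniq Bb) bad_sub; rewrite -(ler_nat R) => /le_trans; apply.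
  rewrite size_allpairs_dep sumnE big_map natr_sum.
  apply: (@le_trans _ _ (\sum_(ij <- IJ) (N0%:R * a ^+ 2 * rho ^+ (k - h)))).
    rewrite big_seq [leRHS]big_seq; apply: ler_sum => -[i j]; rewrite mem_filter /= => /andP[ij _].
    rewrite size_allpairs card_fset_pairs !natrM.
    have iQ : (i <= Q)%N by rewrite -ltnS ltn_ord.
    have jQ : (j <= Q)%N by rewrite -ltnS ltn_ord.
    have F1 := Fa _ (ihk i iQ); have F2 := Fa _ (leq_subr (j * h) k).
    apply: (@le_trans _ _ (a * rho ^+ (i * h) * N0%:R * (a * rho ^+ (k - j * h)))).
      apply: ler_pM => //; apply: ler_pM => //; by rewrite ler_nat.
    have -> : a * rho ^+ (i * h) * N0%:R * (a * rho ^+ (k - j * h)) =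
      N0%:R * a ^+ 2 * rho ^+ (i * h + (k - j * h)) by rewrite exprD; ring.
    apply: ler_wpM2l; first by rewrite mulr_ge0 // sqr_ge0.
    apply: ler_weXn2l; first exact: ltW.
    have : (i * h + h <= j * h)%N by rewrite -mulSnr leq_mul2r ij orbT.
    by have := ihk j jQ; lia.
  rewrite big_const_seq iter_addr addr0 count_predT.
  rewrite -[leLHS]mulr_natl; apply: ler_wpM2r; first by rewrite !mulr_ge0 ?sqr_ge0 ?exprn_ge0.
  rewrite -natrX ler_nat size_filter; apply: leq_trans (count_size _ _) _.
  by rewrite -cardE card_prod card_ord mulnn.
apply: (@le_trans _ _ (t.+1%:R * #|` Bg|%:R)); last by rewrite -natrM ler_nat.
apply: ler_wpM2l => //; rewrite cardB natrD; move: cardBb; lra.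
Qed.

End Insertion.

(** * Ultrafilters and limit groups *)

(** The starting filter consists of the sets whose complement in [A] takes finitely many values
    under [o]: the ultrafilter has to avoid whole orbits, and not only single markings. *)
Lemma exists_nonprincipal_ultrafilter (T U : Type) (A : set T) (o : T -> U) :
  infinite_set (o @` A) -> exists F : set_system T,
    [/\ UltraFilter F, F A & forall y, F [set x | o x <> y]].
Proof.
move=> inf; pose F0 : set_system T := [set B | finite_set (o @` (A `\` B))].
have sub B B' : A `\` B `<=` A `\` B' -> F0 B' -> F0 B.
  by move=> BB'; apply: sub_finite_set; apply: image_subset.
have F0T B : A `<=` B -> F0 B.
  move=> AB; apply: (sub_finite_set _ (finite_set0 U)) => _ [x [Ax nBx] <-].
  by case: nBx; apply: AB.
have F0P : ProperFilter F0.
  split; first by rewrite /F0 /= setD0.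
  split; first exact: F0T.
    move=> B B' FB FB'; rewrite /F0 /= setDIr image_setU.
    by rewrite finite_setU.
  by move=> B B' BB'; apply: sub => x [Ax nx]; split=> // /BB'.
have [F [uF FF]] := ultraFilterLemma F0P.
exists F; split=> // [|y]; apply: FF; first exact: F0T.
apply: (sub_finite_set _ (finite_set1 y)) => _ [x [_ nx] <-] /=.
exact: contrapT.
Qed.

Section Limit_groups.
Variables (G : groupType) (l N0 : nat) (U : set_system ('I_l -> G)).
Hypotheses (ultraU : UltraFilter U) (l_gt0 : (0 < l)%N).
Hypothesis genU : U [set f | generating_set (rng f)].
Implicit Types (f phi : 'I_l -> G) (u v w r : free_group l) (D E : {fset free_group l}).

(** The kernel of the map from the free group to the ultrapower of [G] along [U]; the quotient by it
    is the limit group. *)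
Definition limit_kernel : set (free_group l) := [set w | U [set f | free_eval f w = 1%g]].

Lemma limit_kernel_agree D :
  U [set phi | forall w, w \in D -> (free_eval phi w = 1%g <-> limit_kernel w)].
Proof.
have : U (\bigcap_(w in [set` D]) [set phi | free_eval phi w = 1%g <-> limit_kernel w]).
  apply: filter_bigI => w _; case: (pselect (limit_kernel w)) => Kw.
    by apply: (filterS _ (Kw)) => phi /= e; split.
  have [//|] := in_ultra_setVsetC [set f | free_eval f w = 1%g] ultraU.
  by apply: filterS => phi /= ne; split.
by apply: filterS => phi H w wD; apply: H.
Qed.

Lemma limit_kernel_ball n :
  U [set phi | forall w, (wlen w <= n)%N -> (free_eval phi w = 1%g <-> limit_kernel w)].
Proof.
have /finite_fsetP[D DE] := finite_wlen l n.
apply: filterS (limit_kernel_agree D) => phi H w wn; apply: H.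
by have : [set` D] w by rewrite -DE.
Qed.

Lemma limit_kernel1 : limit_kernel 1%g.
Proof. by rewrite /limit_kernel; apply: filterS filterT => f _ /=; apply: free_eval1. Qed.

(** As equations, the words of [limit_kernel] have the same solutions as finitely many of them, and
    these hold simultaneously for most [f]. *)
Lemma limit_kernel_noetherian : equationally_noetherian G ->
  U [set f | limit_kernel `<=` relators f].
Proof.
move=> EN; have [S0 [/finite_fsetP[D SE] sub e]] := EN l l_gt0 limit_kernel.
apply: filterS (limit_kernel_agree D) => f H w Kw.
have : solutions S0 f.
  move=> s; rewrite SE /= => sD; apply/(H s sD); apply: sub; by rewrite SE.
by rewrite e; apply.
Qed.

Lemma normal_preimage f (B : set G) : normal_subgroup B -> normal_subgroup (free_eval f @^-1` B).
Proof.
move=> [B1 BM BV BJ]; split=> /= [|x y|x|g x]; rewrite ?free_eval1 ?free_evalM ?free_evalV //.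
- exact: BM.
- exact: BV.
- exact: BJ.
Qed.

Lemma normal_relators f : normal_subgroup (relators f).
Proof.
apply: (@normal_preimage f [set 1%g]); split=> //= [x y -> ->|x ->|g x ->].
- exact: mul1g.
- exact: invg1.
- by rewrite mulg1 mulgV.
Qed.

Lemma normal_image f (N : set (free_group l)) : generating_set (rng f) ->
  normal_subgroup N -> normal_subgroup (free_eval f @` N).
Proof.
move=> gf [N1 NM NV NJ]; split.
- by exists 1%g => //; apply: free_eval1.
- by move=> _ _ [u Nu <-] [v Nv <-]; exists (u * v)%g; [apply: NM | rewrite free_evalM].
- by move=> _ [u Nu <-]; exists (u^-1)%g; [apply: NV | rewrite free_evalV].
- move=> g _ [u Nu <-]; have [v <-] := free_eval_surj gf g.
  by exists (v * u * v^-1)%g; [apply: NJ | rewrite !free_evalM free_evalV].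
Qed.

Lemma normal_verbal_centralizer f phi : generating_set (rng phi) ->
  normal_subgroup (verbal_centralizer f phi).
Proof.
move=> gphi; have [K1 KM KV KJ] := normal_relators f; split.
- by move=> w _; apply/commute_sym/commute1.
- by move=> x y Zx Zy w Kw; apply/commute_sym/commuteM; apply/commute_sym; [apply: Zx | apply: Zy].
- by move=> x Zx w Kw; apply/commute_sym/commuteV/commute_sym/Zx.
- move=> g x Zx w Kw; have [v <-] := free_eval_surj gphi g.
  have := Zx _ (KJ (v^-1)%g _ Kw); rewrite !free_evalM !free_evalV !invgK /commute => e.
  apply: (mulIg (free_eval phi v)); apply: (mulgI ((free_eval phi v)^-1)%g).
  by move: e; rewrite !mulgA mulVg mul1g mulgVK.
Qed.

(* A maximal finite normal subgroup [F] is lifted to words; if the image of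
   [ker f] under [phi] is finite, [phi (f^-1 F)] is a larger one. *)
Lemma verbal_image_large f r :
  (forall B : set G, normal_subgroup B -> finite_set B -> ~ more_than N0 B) ->
  generating_set (rng f) -> limit_kernel `<=` relators f -> relators f r -> ~ limit_kernel r ->
  U [set phi | more_than N0 (free_eval phi @` relators f)].
Proof.
move=> fin gf Kf fr nKr.
pose P n := `[< exists2 F : {fset G}, normal_subgroup [set` F] & #|` F| = n >].
have P1 : exists n, P n.
  exists 1%N; apply/asboolP; exists [fset 1%g]%fset; last exact: cardfs1.
  split=> /= [|x y|x|g x]; rewrite !inE //.
  - by move=> /eqP -> /eqP ->; rewrite mulg1.
  - by move=> /eqP ->; rewrite invg1.
  - by move=> /eqP ->; rewrite mulg1 mulgV.
have PN n : P n -> (n <= N0)%N.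
  move=> /asboolP[F nF <-]; rewrite leqNgt; apply/negP => big.
  by apply: (fin _ nF (finite_fset _)); exists F.
case: (ex_maxnP P1 PN) => _ /asboolP[F nF <-] Fmax {P1 PN}.
have /choice[p pP] := free_eval_surj gf.
(* Lifts [p x] of the elements of [F], and one more word: [r * p 1] has value 1 under [f] but
   differs from every [p x] modulo [limit_kernel]. Agreeing with the limit on the quotients in [DD],
   [phi] takes one value more on [D] than [F] has elements, all in the image of the preimage of
   [F]. *)
pose D := ((r * p 1%g)%g |` [fset p x | x in F])%fset.
pose DD := [fset (uv.1 * uv.2^-1)%g | uv in fset_pairs D D]%fset.
apply: filterS (filterI genU (limit_kernel_agree DD)) => phi [gphi agr].
apply: contrapT => few.
have finK : finite_set (free_eval phi @` relators f).
  apply: contrapT => inf; apply: few.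
  have [A AK Ac] := infinite_set_fset N0.+1 inf; exists A => //.
have nF1 := normal_image gphi (normal_preimage f nF).
have finF1 : finite_set (free_eval phi @` (free_eval f @^-1` [set` F])).
  apply: (@sub_finite_set _ _ [set (x * y)%g | x in [set` [fset free_eval phi (p x) | x in F]%fset]
      & y in free_eval phi @` relators f]).
    move=> _ [u /= uF <-]; exists (free_eval phi (p (free_eval f u))).
      by rewrite /=; apply/imfsetP; exists (free_eval f u).
    exists (free_eval phi ((p (free_eval f u))^-1 * u)%g).
      exists ((p (free_eval f u))^-1 * u)%g => //.
      by rewrite /relators /= free_evalM free_evalV pP mulVg.
    by rewrite -free_evalM mulVKg.
  by apply: finite_image2 => //; apply: finite_fset.
have /finite_fsetP[F1 F1E] := finF1.
have : P #|` F1| by apply/asboolP; exists F1; rewrite // -F1E.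
move=> /Fmax; apply/negP; rewrite -ltnNge.
have injD u v : u \in D -> v \in D -> free_eval phi u = free_eval phi v -> limit_kernel (u * v^-1)%g.
  move=> uD vD e; apply/(agr (u * v^-1)%g); last by rewrite free_evalM free_evalV e mulgV.
  by apply/imfsetP; exists (u, v) => //=; rewrite in_fset_pairs uD.
have Df u : u \in D -> free_eval f u \in F.
  rewrite !inE => /orP[/eqP ->|/imfsetP[x xF ->]]; last by rewrite pP.
  by rewrite free_evalM fr mul1g pP; have [] := nF.
have fK u v : limit_kernel (u * v^-1)%g -> free_eval f u = free_eval f v.
  by move=> /Kf; rewrite /relators /= free_evalM free_evalV => /eqP; rewrite divg_eq1 => /eqP.
have nK y : ~ limit_kernel (r * p 1%g * (p y)^-1)%g.
  move=> /[dup] /fK; rewrite free_evalM fr mul1g !pP => <-; rewrite mulgK; exact: nKr.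
have injphi : {in D &, injective (free_eval phi)}.
  move=> u v uD vD e; have := injD u v uD vD e; have := injD v u vD uD (esym e).
  move: uD vD {e}; rewrite !inE => /orP[/eqP ->|/imfsetP[x xF ->]] /orP[/eqP ->|/imfsetP[y yF ->]] //.
  - by move=> _ /nK.
  - by move=> /nK.
  - by move=> _ /fK; rewrite !pP => ->.
have <- : #|` D| = #|` F|.+1.
  rewrite cardfsU1 card_imfset //=; last first.
    by move=> x y /(congr1 (free_eval f)); rewrite !pP.
  have -> // : (r * p 1%g)%g \notin [fset p x | x in F]%fset.
  apply/negP => /imfsetP[x /= xF e]; apply: (nK x); rewrite e mulgV.
  exact: limit_kernel1.
have <- : #|` [fset free_eval phi u | u in D]%fset| = #|` D| by rewrite card_in_imfset.
apply: fsubset_leq_card; apply/fsubsetP => _ /imfsetP[u /= uD ->].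
have : [set` F1] (free_eval phi u) by rewrite -F1E; exists u => //; apply: Df.
by [].
Qed.

End Limit_groups.

(** * Choice of constants, and finiteness *)

(** [t] gives the gain [beta] with a factor 2 to spare, [Q] follows from [t], and [h] is about
    [k / Q]. In the error term, factors polynomial in [k] compete with the loss of [rho^h], so for
    large [k] it is at most half of [rho^k]. *)
Lemma insertion_gain (R : realType) (rho beta : R) (C N0 q e : nat) : 1 < rho -> 0 <= beta ->
  exists t Q k0, [/\ Q = (t.+1 ^ e)%N & forall k, (k0 <= k)%N -> exists h, (Q * h <= k)%N /\
    forall F : R, rho ^+ k <= F ->
    beta * rho ^+ (k + q) <= t.+1%:R * (F - Q.+1%:R ^+ 2 *
      (N0%:R * (4 * C%:R * (k + C)%:R * rho ^+ C) ^+ 2 * rho ^+ (k - h)))].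
Proof.
move=> rho1 b0; have rho0 : 0 < rho by lra.
pose t := Num.bound (2 * beta * rho ^+ q); pose Q := (t.+1 ^ e)%N.
have Q0 : (0 < Q)%N by rewrite expn_gt0.
have tP : 2 * beta * rho ^+ q <= t.+1%:R.
  apply: le_trans (ltW (archi_boundP _)) _; last by rewrite ler_nat.
  by rewrite !mulr_ge0 // exprn_ge0 // ltW.
pose a0 := 4 * C%:R * rho ^+ C : R.
have [h0 h0P] := expr_beats_quadratic (2 * (Q.+1%:R ^+ 2 * N0%:R * a0 ^+ 2 * (Q + C)%:R ^+ 2)) rho1.
exists t, Q, (Q * h0)%N; split=> // k kP; exists (k %/ Q)%N.
move: (k %/ Q)%N (leq_trunc_div k Q) (ltn_ceil k Q0) (kP) => h hk kh kh0.
rewrite mulnC; split=> // F Fk.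
have hh0 : (h0 <= h)%N by rewrite leqNgt; apply/negP => lt; move: kh kP; nia.
have kC : (k + C <= (Q + C) * h.+1)%N by nia.
have err : 2 * (Q.+1%:R ^+ 2 * (N0%:R * (4 * C%:R * (k + C)%:R * rho ^+ C) ^+ 2 * rho ^+ (k - h)))
    <= rho ^+ k.
  have hk' : (h <= k)%N by nia.
  have -> : rho ^+ k = rho ^+ h * rho ^+ (k - h) by rewrite -exprD subnKC.
  have -> : 2 * (Q.+1%:R ^+ 2 * (N0%:R * (4 * C%:R * (k + C)%:R * rho ^+ C) ^+ 2 * rho ^+ (k - h))) =
    2 * (Q.+1%:R ^+ 2 * N0%:R * a0 ^+ 2) * (k + C)%:R ^+ 2 * rho ^+ (k - h) by rewrite /a0; ring.
  rewrite ler_wpM2r ?exprn_ge0 ?(ltW rho0) //; apply: le_trans (h0P h hh0).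
  have -> : 2 * (Q.+1%:R ^+ 2 * N0%:R * a0 ^+ 2 * (Q + C)%:R ^+ 2) * h.+1%:R ^+ 2 =
    2 * (Q.+1%:R ^+ 2 * N0%:R * a0 ^+ 2) * ((Q + C) * h.+1)%:R ^+ 2 by rewrite natrM; ring.
  apply: ler_wpM2l; last by rewrite lerXn2r ?nnegrE // ler_nat.
  by rewrite mulr_ge0 // mulr_ge0 ?sqr_ge0 // mulr_ge0 ?sqr_ge0.
move: err; move: (Q.+1%:R ^+ 2 * _) => err errP.
apply: (@le_trans _ _ (t.+1%:R * (rho ^+ k / 2))); last by rewrite ler_wpM2l //; lra.
rewrite exprD; have := ler_wpM2r (exprn_ge0 k (ltW rho0)) tP; lra.
Qed.

Lemma exists_enumeration (G : choiceType) (S : {fset G}) s l : s \in S -> (#|` S| <= l)%N ->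
  exists f : 'I_l -> G, [fset x in codom f]%fset = S.
Proof.
move=> sS Sl; exists (fun i => nth s S i); apply/fsetP => x; rewrite in_fset.
apply/codomP/idP => [[i ->]|xS].
  by case: (ltnP i (size S)) => iS; [apply: mem_nth | rewrite nth_default].
have xl : (index x S < l)%N by apply: leq_trans Sl; rewrite index_mem.
by exists (Ordinal xl); rewrite /= nth_index.
Qed.

Section Finiteness.
Variables (R : realType) (G : groupType) (C N0 : nat).
Hypothesis pb : forall S : {fset G}, generating_set S -> product_bounded C S.
Hypothesis superlinear : forall (S : {fset G}) (K : R), generating_set S ->
  exists n, K * n.+1%:R < #|` word_ball S n|%:R.
Hypothesis finite_normal : forall B : set G, normal_subgroup B -> finite_set B -> ~ more_than N0 B.
Hypothesis commuting_normal : forall A B : set G, normal_subgroup A -> normal_subgroup B ->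
  (forall x y, A x -> B y -> commute x y) -> more_than N0 B -> ~ more_than N0 A.
Hypothesis noethG : equationally_noetherian G.
Implicit Types S : {fset G}.

Lemma generating_set_neq0 S : generating_set S -> exists s, s \in S.
Proof.
move=> gS; case: (fset_0Vmem S) => [S0|[s sS]]; last by exists s.
have [n] := superlinear 1 gS; rewrite mul1r ltr_nat ltnNge => /negP; case.
suff -> : word_ball S n = [fset 1%g]%fset by rewrite cardfs1.
apply/fsetP => x; rewrite inE; apply/idP/eqP => [|->]; last exact: word_ball1.
elim: n x => [|n IH] x; first by rewrite word_ball0 => /eqP.
by move=> /word_ballS[/IH//|[y [s [_]]]]; rewrite S0 inE.
Qed.

Lemma growth_rate_gt1 S rho : generating_set S -> growth_rate R S = rho -> 1 < rho.
Proof.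
move=> gS gr; have [rho1 _ _] := growth_rate_bounds gr.
rewrite lt_neqAle rho1 andbT eq_sym; apply/eqP => rE.
have [n] := superlinear (4 * C%:R * C.+1%:R) gS; rewrite ltNge => /negP; apply.
have := word_ball_linear_bound (pb gS) gr n; rewrite rE expr1n mulr1 => /le_trans; apply.
rewrite -[leRHS]mulrA -(natrM R C.+1) ler_wpM2l ?mulr_ge0 // ler_nat; nia.
Qed.

Lemma finitely_many_orbits rho : finite_set [set aut_orbit S | S in
  [set S : {fset G} | generating_set S /\ growth_rate R S = rho]].
Proof.
pose good := [set S : {fset G} | generating_set S /\ growth_rate R S = rho].
rewrite -/good; apply: contrapT => inf.
have [S0 [gS0 rS0]] : exists S, good S.
  apply: contrapT => none; apply: inf.
  by apply: (sub_finite_set _ (finite_set0 _)) => _ [S gS <-]; case: none; exists S.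
have rho1 := growth_rate_gt1 gS0 rS0; have rho0 : 0 < rho by lra.
have [l0 Sl] : exists l0, forall S, good S -> (#|` S| <= l0.+1)%N.
  exists (Num.bound (4 * C%:R * (1 + C)%:R * rho ^+ (1 + C)%N)) => S [gS rS].
  apply: (@leq_trans #|` word_ball S 1|).
    by apply: fsubset_leq_card; apply/fsubsetP => x; apply: word_ball_gen.
  apply: leqW; rewrite -(ler_nat R); apply: le_trans (word_ball_linear_bound (pb gS) rS 1) _.
  apply/ltW/archi_boundP; rewrite mulr_ge0 ?mulr_ge0 // exprn_ge0 // ltW //.
pose marks := [set f : 'I_l0.+1 -> G | good (rng f)].
pose o (f : 'I_l0.+1 -> G) := aut_orbit (rng f).
have infm : infinite_set (o @` marks).
  move=> fin; apply: inf; apply: sub_finite_set fin => _ [S gS <-].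
  have [s sS] := generating_set_neq0 gS.1.
  have [f fS] := exists_enumeration sS (Sl S gS).
  by exists f; rewrite /o /marks /= /rng fS.
have [U [uU Um Uo]] := exists_nonprincipal_ultrafilter infm.
have Ugen : U [set f | generating_set (rng f)] by apply: filterS Um => f [].
have UK := limit_kernel_noetherian uU isT noethG.
have [f [fm fK [r [fr nKr]]]] : exists f, [/\ marks f, limit_kernel U `<=` relators f &
    exists r, relators f r /\ ~ limit_kernel U r].
  apply: contrapT => none.
  (* Otherwise most markings have exactly [limit_kernel] as kernel, so any two of them lie in one
     orbit, while [U] avoids the orbit of [f1]. *)
  have ker f : marks f -> limit_kernel U `<=` relators f -> relators f = limit_kernel U.
    move=> fm fK; apply/seteqP; split=> // r fr; apply: contrapT => nKr.
    by apply: none; exists f; split=> //; exists r.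
  have [f1 [f1m f1K]] := filter_ex (filterI Um UK).
  have [f2 [[f2m f2K]]] := filter_ex (filterI (filterI Um UK) (Uo (o f1))); apply.
  apply: aut_orbit_of_kernel => [||w]; [exact: f2m.1 | exact: f1m.1|].
  have e : relators f2 = relators f1 by rewrite (ker f2) // (ker f1).
  by have := congr1 (fun A => A w) e; rewrite /relators /= => ->.
have Ularge := verbal_image_large uU Ugen finite_normal fm.1 fK fr nKr.
have [E Er Ecent] := noetherian_centralizer (relators f) noethG.
have [q Eq] : exists q, forall w, w \in E -> (wlen w <= q)%N.
  by exists (\max_(w <- E) wlen w)%N => w wE; apply: leq_bigmax_seq.
(* The order of choices matters: [q] depends on [f], [beta] on [C] and [rho], then [k0] on these,
   and [n1] on [k0 + q]. The marking [phi] comes last, as it agrees with the limit group only on a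
   ball of radius fixed beforehand. *)
have [beta b0 nlow] := no_uniform_lower_bound G C rho1.
have [t [Q [k0 [QE gain]]]] := insertion_gain C N0 q #|` E| rho1 (ltW b0).
have [n1 n1P] := nlow (k0 + q)%N.
have Uball := limit_kernel_ball uU (n1 + n1).
have [phi [[phim large] ball]] := filter_ex (filterI (filterI Um Ularge) Uball).
apply: (n1P (rng phi) (pb phim.1) phim.2) => m /andP[km mn].
have kq : (m = (m - q) + q)%N by rewrite subnK //; lia.
move: (m - q)%N kq => k kq; have {km}k0k : (k0 <= k)%N by lia.
have [h [Qh hP]] := gain k k0k; have [_ low _] := growth_rate_bounds fm.2.
rewrite kq; apply: le_trans (hP _ (low k)) _.
have ncent : ~ more_than N0 (verbal_centralizer f phi).
  have nZ := normal_verbal_centralizer f phim.1.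
  apply: (commuting_normal nZ (normal_image phim.1 (normal_relators f)) _ large).
  by move=> x _ xZ [w fw <-]; apply: xZ.
apply: (@insertion_lower_bound R G l0.+1 N0 rho rho1 f phi E t h Q k q _ fm.1 phim.1 Er Eq) => //.
- move=> w wl /ball H; apply: fK; apply/H; lia.
- exact: Ecent.
- by rewrite !mulr_ge0 // exprn_ge0 // ltW.
- move=> i ik; apply: le_trans (word_ball_linear_bound (pb fm.1) fm.2 i) _.
  rewrite addnC exprD mulrA ler_wpM2r ?exprn_ge0 ?(ltW rho0) //.
  rewrite ler_wpM2r ?exprn_ge0 ?(ltW rho0) // ler_wpM2l ?mulr_ge0 // ler_nat; lia.
Qed.

End Finiteness.

Lemma acylindrical_bound (R : realType) (X : metricType R) (G : groupType) (act : G -> X -> X) e :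
  acylindrical act -> 0 < e -> exists R0 N0, acylindrical_at act R0 N0 e.
Proof.
move=> acyl /acyl[r [N [r0 _ H]]]; exists r, N; split=> [|x z rxz A AP]; first exact: ltW.
have : [set` A] `<=` [set g | mdist x (act g x) <= e /\ mdist z (act g z) <= e].
  by move=> g /AP.
move=> /subset_card_le/card_le_trans/(_ (H x z rxz)).
have /card_eqPle[_ /card_le_trans h] : ([set` A] #= `I_#|` A|)%card by apply/card_eq_fsetP.
move=> /h; by rewrite card_le_II.
Qed.

Theorem theorem1p5 (R : realType) (G : groupType) (X : metricType R)
    (delta : R) (act : G -> X -> X) (M : nat)
    (fgG : finitely_generated G)
    (hypX : hyperbolic_space X delta)
    (isomact : isometric_action act)
    (acyl : acylindrical act)
    (nonelem : ~ elementary act)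
    (hypM : forall S : {fset G}, generating_set S ->
       exists2 g : G, g \in word_ball S M & hyperbolic_isometry (act g))
    (noethG : equationally_noetherian G) :
  forall rho : R, growth_rates G R rho ->
    finite_set [set aut_orbit S | S in
      [set S : {fset G} | generating_set S /\ growth_rate R S = rho]].
Proof.
(* Enlarging [delta] preserves the four-point inequality, and [1 <= dl] keeps all error margins
   positive. *)
move=> rho _; pose dl := Num.max delta 1.
have dl1 : 1 <= dl by rewrite le_max lexx orbT.
have fp : four_point X dl.
  have dd : delta <= dl by rewrite le_max lexx.
  by move=> x y z w; case: (hyperbolic_four_point hypX x y z w) => h; [left|right]; lra.
have e0 : 0 < 100 * dl by lra.
have [R0 [N0 acylN]] := acylindrical_bound acyl e0.
have gX := hypX.1.
have [C pb] := product_count isomact fp gX dl1 acylN nonelem hypM.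
apply: (@finitely_many_orbits R G C N0) => //.
- by move=> S K; apply: (word_ball_superlinear isomact fp gX dl1 acylN nonelem hypM).
- by move=> B nB fB; apply: (finite_normal_subgroup isomact fp gX dl1 acylN nonelem hypM).
- by move=> A B nA nB com mB; apply: (commuting_normal_subgroups isomact fp gX dl1 acylN nonelem hypM nA nB).
Qed.
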